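(* Let $0<R_1<R_2$. There exists $C>0$ such that for all $\epsilon\in(0,\frac\pi2)$, $$\frac{j_{1,1}^2}{R_2^2}\le\lambda_1^{NDD}(\widehat{\mathfrak D}(2,\epsilon))\le\frac{j_{1,1}^2}{R_2^2}+C\left(\frac\pi2-\epsilon\right)^2.$$
   Context: Let $(r,\theta)$ be polar coordinates in $\mathbb R^2$. For $\epsilon\in[0,\frac\pi2]$, $$\widehat{\mathfrak D}(2,\epsilon)=\{0<r<R_2,\ 0<\theta<\tfrac\pi2\}\setminus\{r=R_1,\ \epsilon\le\theta<\tfrac\pi2\},$$ i.e. the open quarter disc of radius $R_2$ from which a circular-arc crack on the circle of radius $R_1$ has been removed. $\lambda_1^{NDD}(\widehat{\mathfrak D}(2,\epsilon))$ is the lowest eigenvalue of $-\Delta$ in $\widehat{\mathfrak D}(2,\epsilon)$ with homogeneous Neumann condition on the radius $\theta=0$, homogeneous Dirichlet condition on the radius $\theta=\frac\pi2$, and homogeneous Dirichlet condition on the rest of the boundary (the exterior arc $r=R_2$ and the crack). $j_{\ell,k}$ is the $k$-th positive zero of the Bessel function $J_\ell$. The constant $C$ may depend on $R_1,R_2$ but not on $\epsilon$. *)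

(* Defs.v *)
From HB Require Import structures.
From mathcomp Require Import all_boot all_order all_algebra.
From mathcomp Require Import all_classical all_reals all_analysis.

Set Implicit Arguments.
Unset Strict Implicit.
Unset Printing Implicit Defensive.

Import Order.TTheory GRing.Theory Num.Theory.
Import numFieldNormedType.Exports.

Local Open Scope classical_set_scope.
Local Open Scope ring_scope.

Definition besselJ (R : realType) (l : nat) (x : R) : R :=
  limn (series (fun m : nat =>
    (-1) ^+ m / (m`! * (m + l)`!)%:R * (x / 2) ^+ (m.*2 + l))).

(* [besselJ_zero R l k] is $j_{l,k}$ for [k >= 1]; the value [0] at [k = 0]
   only starts the recursion. The zeros of J_l form a discrete unbounded set,
   so each infimum is a minimum. *)
Fixpoint besselJ_zero (R : realType) (l k : nat) : R :=
  if k is k'.+1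
  then inf [set x : R | besselJ_zero R l k' < x /\ besselJ l x = 0]
  else 0.

Definition polar (R : realType) (rt : R * R) : R * R :=
  (rt.1 * cos rt.2, rt.1 * sin rt.2).
Arguments polar {R} rt.

Definition cracked_sector (R : realType) (R1 R2 eps : R) : set (R * R) :=
  polar @` ([set rt | 0 < rt.1 < R2 /\ 0 < rt.2 < pi / 2] `\`
            [set rt | rt.1 = R1 /\ eps <= rt.2 < pi / 2]).

Definition neumann_radius (R : realType) (R2 : R) : set (R * R) :=
  polar @` [set rt | 0 < rt.1 < R2 /\ rt.2 = 0].

Definition boundary (R : realType) (Om : set (R * R)) : set (R * R) :=
  closure Om `\` Om°.

(* The plane with the sigma-algebra on which [lebesgue_measure \x
   lebesgue_measure] is a measure; as a type it is [R * R]. *)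
Definition mplane (R : realType) := (measurableTypeR R * measurableTypeR R)%type.
HB.instance Definition _ (R : realType) := Measurable.on (mplane R).

Definition lebesgue2 (R : realType) : set (mplane R) -> \bar R :=
  (@lebesgue_measure R \x @lebesgue_measure R)%E.
HB.instance Definition _ (R : realType) := Measure.on (@lebesgue2 R).

Definition partial1 (R : realType) (v : R * R -> R) (p : R * R) : R :=
  derive1 (fun t : R => v (t, p.2)) p.1.

Definition partial2 (R : realType) (v : R * R -> R) (p : R * R) : R :=
  derive1 (fun t : R => v (p.1, t)) p.2.

Definition C1 (R : realType) (v : R * R -> R) : Prop :=
  [/\ forall p : R * R, derivable (fun t : R => v (t, p.2)) p.1 1,
      forall p : R * R, derivable (fun t : R => v (p.1, t)) p.2 1,
      continuous (partial1 v) & continuous (partial2 v)].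

Definition L2_cvg (R : realType) (Om : set (R * R))
    (v : nat -> R * R -> R) (u : R * R -> R) : Prop :=
  (\int[@lebesgue2 R]_(p in Om) ((v n p - u p) ^+ 2)%:E)%E @[n --> \oo]
    --> (0 : \bar R).

(* [H1D Om D u g1 g2], for a bounded [Om]: [u] belongs to $H^1_D(\Omega)$, the
   closure in $H^1(\Omega)$ of the restrictions to [Om] of the C^1 functions on
   the plane whose support does not meet [D], and [(g1, g2)] is its weak gradient. No
   condition is put on the rest of the boundary. For an open [Om] the gradient
   is determined by [u] almost everywhere on [Om]. *)
Definition H1D (R : realType) (Om D : set (R * R))
    (u g1 g2 : R * R -> R) : Prop :=
  [/\ measurable_fun (Om : set (mplane R)) u,
      measurable_fun (Om : set (mplane R)) g1,
      measurable_fun (Om : set (mplane R)) g2 &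
      exists v : nat -> R * R -> R,
      [/\ forall n, C1 (v n) /\
            (forall p, D p -> \forall q \near p, v n q = 0),
          L2_cvg Om v u,
          L2_cvg Om (fun n => partial1 (v n)) g1 &
          L2_cvg Om (fun n => partial2 (v n)) g2]].

(* Eigenvalues of the self-adjoint realization of $-\Delta$ on [Om] with
   Dirichlet condition on [D] and Neumann condition on the rest of the
   boundary, i.e. of the operator associated with the Dirichlet form
   $\int_\Omega \nabla u\cdot\nabla w$ of domain $H^1_D(\Omega)$. *)
Definition laplace_eigenvalue (R : realType) (Om D : set (R * R))
    (lambda : R) : Prop :=
  exists u g1 g2 : R * R -> R,
    [/\ H1D Om D u g1 g2,
        (\int[@lebesgue2 R]_(p in Om) (u p ^+ 2)%:E != 0)%E &
        forall w h1 h2 : R * R -> R, H1D Om D w h1 h2 ->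
          (\int[@lebesgue2 R]_(p in Om) (g1 p * h1 p + g2 p * h2 p))%R =
          lambda * (\int[@lebesgue2 R]_(p in Om) (u p * w p))%R].

Definition lowest_laplace_eigenvalue (R : realType) (Om D : set (R * R))
    (lambda : R) : Prop :=
  laplace_eigenvalue Om D lambda /\
  (forall mu : R, laplace_eigenvalue Om D mu -> lambda <= mu).

(* [lambda1_NDD R1 R2 eps lambda]: [lambda] is $\lambda_1^{NDD}$ of the cracked
   quarter disc. *)
Definition lambda1_NDD (R : realType) (R1 R2 eps lambda : R) : Prop :=
  let Om := cracked_sector R1 R2 eps in
  lowest_laplace_eigenvalue Om (boundary Om `\` neumann_radius R2) lambda.

(* Main.v *)
Require Import Defs.
From mathcomp Require Import all_boot all_order all_algebra.
From mathcomp Require Import all_classical all_reals all_analysis.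
From mathcomp Require Import measurable_realfun ring lra.

(** The lowest eigenvalue is the infimum of the Rayleigh quotient
[int |grad v|^2 / int v^2] over the admissible functions, which are of class C^1
and vanish near the Dirichlet part of the boundary. The infimum is attained by a
limit of admissible functions: [friedrichs] provides the compactness and
[minimizer_exists] runs the direct method, so that [lambda1_bottom] identifies
the infimum with the lowest eigenvalue. Both bounds are then statements on the
Rayleigh quotient.

They come from one identity. Let [mu = j_{1,1}^2 / R2^2]. The function
[phi = J_1(j_{1,1} r / R2) cos theta] is positive in the quarter disc, satisfies
[- Delta phi = mu phi], vanishes for [r = R2] and [theta = pi / 2], and has zero
normal derivative for [theta = 0]: it is the ground state of the quarter disc
without crack. Every admissible [v] satisfies Jacobi's identity ([adm_jacobi])

  [int |grad v|^2 = mu int v^2 + int |grad v - (v / phi) grad phi|^2].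

The last term is nonnegative, whence the lower bound.

For the upper bound put [d = pi / 2 - eps]. The crack lies within distance
[R1 * d] of the point [(0, R1)] ([crack_near]). The trial function is
[v = phi chi], where [chi] vanishes near the crack, equals 1 outside a disc of
radius of order [d] about that point, and has a gradient of order [1 / d]; a
further truncation near the Dirichlet boundary makes it admissible and
disappears in the limit ([err_int_small]). The last term of the identity becomes
[int phi^2 |grad chi|^2]. As [phi] vanishes on the axis [theta = pi / 2], it is of
order [d] on the support of [grad chi], so the integrand is bounded, and the
support has area of order [d^2]: the excess over [mu] is of order [d^2]
([trial_defect], [trial_norm]). When [d] is not small, one fixed function
supported away from all the cracks gives a bounded quotient ([bottom_upper]). *)

Set Implicit Arguments.
Unset Strict Implicit.
Unset Printing Implicit Defensive.

Import Order.TTheory GRing.Theory Num.Theory.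
Import numFieldNormedType.Exports.

Local Open Scope classical_set_scope.
Local Open Scope ring_scope.

(** * Square-integrable functions *)

Section SquareIntegrable.
Context d (T : measurableType d) (R : realType).
Variables (mu : {measure set T -> \bar R}) (D : set T).
Hypothesis mD : measurable D.
Implicit Types f g h : T -> R.

Definition sqint f :=
  measurable_fun D f /\ (\int[mu]_(x in D) (f x ^+ 2)%:E < +oo)%E.

Definition ip f g : R := \int[mu]_(x in D) (f x * g x).

Lemma sqint_measurable f : sqint f -> measurable_fun D f.
Proof. by case. Qed.

Lemma sqint_integrable_sqr f :
  sqint f -> mu.-integrable D (EFin \o (fun x => f x ^+ 2)).
Proof.
move=> [mf If]; apply/integrableP; split.
  exact/measurable_EFinP/measurable_funX.
rewrite (eq_integral (fun x => (f x ^+ 2)%:E)) // => x _ /=.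
by rewrite ger0_norm// sqr_ge0.
Qed.

Lemma bounded_integrable f (M : R) : (mu D < +oo)%E -> measurable_fun D f ->
  (forall x, D x -> `|f x| <= M) -> mu.-integrable D (EFin \o f).
Proof.
move=> fD mf bf; apply: measurable_bounded_integrable => //.
by exists M; split; [exact: num_real|move=> y My x Dx; apply: le_trans (bf x Dx) (ltW My)].
Qed.

Lemma bounded_sqint f (M : R) : (mu D < +oo)%E -> measurable_fun D f ->
  (forall x, D x -> `|f x| <= M) -> sqint f.
Proof.
move=> fD mf bf; split => //.
have : mu.-integrable D (EFin \o (fun x => f x ^+ 2)).
  apply: (@bounded_integrable _ (M ^+ 2)) => //; first exact: measurable_funX.
  by move=> x Dx; rewrite normrX ler_pXn2r ?nnegrE//; [exact: bf|apply: le_trans (bf x Dx)].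
move/integrableP => [_]; apply: le_lt_trans.
have m2 : measurable_fun D (fun x => (f x ^+ 2)%:E).
  exact/measurable_EFinP/measurable_funX.
apply: ge0_le_integral => //.
- by move=> x _; rewrite lee_fin sqr_ge0.
- exact: measurableT_comp.
- by move=> x _; exact: lee_abs.
Qed.

Lemma sqint_mul f g : sqint f -> sqint g ->
  mu.-integrable D (EFin \o (fun x => f x * g x)).
Proof.
move=> sf sg.
have := integrableD mD (sqint_integrable_sqr sf) (sqint_integrable_sqr sg).
apply: le_integrable => //.
  apply/measurable_EFinP/measurable_funM; exact: sqint_measurable.
move=> x Dx /=; rewrite lee_fin normrM [leRHS]ger0_norm ?addr_ge0 ?sqr_ge0//.
rewrite -(real_normK (num_real (f x))) -(real_normK (num_real (g x))).
have := sqr_ge0 (`|f x| - `|g x|); have := normr_ge0 (f x).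
have := normr_ge0 (g x); nra.
Qed.

Lemma sqint_lin f g a b : sqint f -> sqint g ->
  sqint (fun x => a * f x + b * g x).
Proof.
move=> sf sg; split.
  by apply: measurable_funD; apply: measurable_funM => //; apply: sqint_measurable.
have I : mu.-integrable D (EFin \o (fun x => (2 * a ^+ 2) * f x ^+ 2 + (2 * b ^+ 2) * g x ^+ 2)).
  have := integrableD mD (integrableZl mD (2 * a ^+ 2) (sqint_integrable_sqr sf))
    (integrableZl mD (2 * b ^+ 2) (sqint_integrable_sqr sg)).
  by apply: eq_integrable => // x _ /=.
move/integrableP : I => [_]; apply: le_lt_trans; apply: ge0_le_integral => //.
- by move=> x _; rewrite lee_fin sqr_ge0.
- apply/measurable_EFinP/measurable_funX.
  by apply: measurable_funD; apply: measurable_funM => //; apply: sqint_measurable.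
- apply/measurableT_comp => //; apply/measurable_EFinP.
  by apply: measurable_funD; apply: measurable_funM => //;
    apply/measurable_funX/sqint_measurable.
- move=> x Dx /=; rewrite lee_fin ger0_norm.
    have := sqr_ge0 (a * f x - b * g x); nra.
  by rewrite addr_ge0 // mulr_ge0 ?sqr_ge0 // mulr_ge0 ?sqr_ge0.
Qed.

Lemma sqintB f g : sqint f -> sqint g -> sqint (fun x => f x - g x).
Proof.
move=> sf sg; have := sqint_lin 1 (-1) sf sg.
by under eq_fun do rewrite mul1r mulN1r.
Qed.

Lemma eq_ip f1 g1 f2 g2 : (forall x, D x -> f1 x * g1 x = f2 x * g2 x) ->
  ip f1 g1 = ip f2 g2.
Proof. by move=> e; apply: eq_Rintegral => x; rewrite inE => /e. Qed.

Lemma ipC f g : ip f g = ip g f.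
Proof. by apply: eq_ip => x _; rewrite mulrC. Qed.

Lemma ip_linl f g h a b : sqint f -> sqint g -> sqint h ->
  ip (fun x => a * f x + b * g x) h = a * ip f h + b * ip g h.
Proof.
move=> sf sg sh; rewrite /ip.
have If := sqint_mul sf sh; have Ig := sqint_mul sg sh.
rewrite -(RintegralZl a)// -(RintegralZl b)// -RintegralD//.
- by apply: eq_Rintegral => x _ /=; ring.
- by have := integrableZl mD a If; apply: eq_integrable => // x _ /=.
- by have := integrableZl mD b Ig; apply: eq_integrable => // x _ /=.
Qed.

Lemma ip_linr f g h a b : sqint f -> sqint g -> sqint h ->
  ip h (fun x => a * f x + b * g x) = a * ip h f + b * ip h g.
Proof. by move=> sf sg sh; rewrite ipC ip_linl// ipC (ipC g). Qed.

Lemma ip_quad f g a b : sqint f -> sqint g ->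
  ip (fun x => a * f x + b * g x) (fun x => a * f x + b * g x) =
  a ^+ 2 * ip f f + 2 * a * b * ip f g + b ^+ 2 * ip g g.
Proof.
move=> sf sg; rewrite ip_linl// ?ip_linr//; last exact: sqint_lin.
by rewrite (ipC g f); ring.
Qed.

Lemma ip_ge0 f : 0 <= ip f f.
Proof. by apply: Rintegral_ge0 => x _; rewrite -expr2 sqr_ge0. Qed.

Lemma ip_sqE f : sqint f -> (\int[mu]_(x in D) (f x ^+ 2)%:E = (ip f f)%:E)%E.
Proof.
move=> sf; rewrite /ip /Rintegral fineK; first exact: eq_integral.
apply: integrable_fin_num => //; exact: sqint_mul.
Qed.

Lemma ip_sqB f g : sqint f -> sqint g ->
  ip (fun x => f x - g x) (fun x => f x - g x) = ip f f - 2 * ip f g + ip g g.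
Proof.
move=> sf sg.
transitivity (ip (fun x => 1 * f x + (-1) * g x) (fun x => 1 * f x + (-1) * g x)).
  by apply: eq_ip => x _; ring.
by rewrite ip_quad//; ring.
Qed.

Lemma quad_discr (A B C : R) : 0 <= A -> 0 <= C ->
  (forall t, 0 <= A + 2 * t * B + t ^+ 2 * C) -> B ^+ 2 <= A * C.
Proof.
move=> A0 C0 H; have [C00|Cn0] := eqVneq C 0.
  subst C; have [->|Bn0] := eqVneq B 0; first by rewrite expr0n mulr0.
  have := H (- (A + 1) / (2 * B)); rewrite mulr0 addr0.
  have -> : 2 * (- (A + 1) / (2 * B)) * B = - (A + 1) by field.
  lra.
have Cp : 0 < C by rewrite lt_neqAle eq_sym Cn0.
have := H (- B / C).
have -> : A + 2 * (- B / C) * B + (- B / C) ^+ 2 * C = (A * C - B ^+ 2) / C by field.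
by rewrite pmulr_lge0 ?invr_gt0// subr_ge0.
Qed.

Lemma ip_CauchySchwarz f g : sqint f -> sqint g -> ip f g ^+ 2 <= ip f f * ip g g.
Proof.
move=> sf sg; apply: quad_discr; rewrite ?ip_ge0 // => t.
have := ip_ge0 (fun x => 1 * f x + t * g x); rewrite ip_quad//.
rewrite (_ : 1 ^+ 2 * _ + _ + _ = ip f f + 2 * t * ip f g + t ^+ 2 * ip g g) //; by ring.
Qed.

(** Continuity of the inner product. The bounds come from the positivity of
the form at [u + e * v] and [u - e * v], so that no norm, hence no square root,
has to be introduced. *)
Lemma ip_near f g f' g' (e : R) : 0 < e -> e <= 1 ->
  sqint f -> sqint g -> sqint f' -> sqint g' ->
  ip (fun x => f' x - f x) (fun x => f' x - f x) <= e ^+ 2 ->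
  ip (fun x => g' x - g x) (fun x => g' x - g x) <= e ^+ 2 ->
  `|ip f' g' - ip f g| <= e * (ip f f + ip g g + 2).
Proof.
move=> e0 e1 sf sg sf' sg' Hf Hg.
have sF := sqintB sf' sf; have sG := sqintB sg' sg.
set F := (fun x => f' x - f x) in Hf sF *.
set G := (fun x => g' x - g x) in Hg sG *.
have -> : ip f' g' - ip f g = ip F g + ip f G + ip F G.
  have -> : ip f' g' = ip (fun x => 1 * f x + 1 * F x) (fun x => 1 * g x + 1 * G x).
    by apply: eq_ip => x _; rewrite /F /G; ring.
  rewrite ip_linl// ?ip_linr//; first by ring.
  exact: sqint_lin.
have wb (u v : T -> R) : sqint u -> sqint v -> ip u u <= e ^+ 2 -> 
    `|ip u v| <= e * (ip v v + 1) / 2.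
  move=> su sv hu; have h s : s ^+ 2 = 1 -> 0 <= ip u u + 2 * s * e * ip u v + e ^+ 2 * ip v v.
    move=> s1; have := ip_ge0 (fun x => 1 * u x + (s * e) * v x); rewrite ip_quad//.
    by rewrite expr1n !mul1r mulr1 exprMn s1 mul1r mulrA.
  have h1 := h 1 (expr1n _ _); have h2 := h (-1) (etrans (sqrrN 1) (expr1n _ _)).
  have hv := ip_ge0 v.
  rewrite ler_norml; apply/andP; split; rewrite -(ler_pM2l e0); nra.
have h1 := wb F g sF sg Hf.
have h2 : `|ip f G| <= e * (ip f f + 1) / 2 by rewrite ipC; exact: wb.
have h3 := wb F G sF sG Hf.
have hf := ip_ge0 f; have hg := ip_ge0 g.
apply: (le_trans (ler_normD _ _)); have := ler_normD (ip F g) (ip f G).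
have : e * ip G G <= e.
  have : e ^+ 2 <= 1 by rewrite expr_le1// ltW.
  move=> ee; rewrite -[leRHS]mulr1; apply: ler_wpM2l; first exact: ltW.
  exact: le_trans ee.
nra.
Qed.

End SquareIntegrable.

Section Complete.
Context d (T : measurableType d) (R : realType).
Variables (mu : {measure set T -> \bar R}) (D : set T).
Hypothesis mD : measurable D.
Implicit Types f g h : T -> R.

(** The increments are dominated by a geometric sequence of ratio 1/2, hence
summable. *)
Lemma cvg_of_sqr_bound (u : R^nat) (M : R) :
  (forall n, 4 ^+ n * (u n.+1 - u n) ^+ 2 <= M) -> cvgn u.
Proof.
move=> H; have M0 : 0 <= M.
  by apply: le_trans (H 0%N); rewrite expr0 mul1r sqr_ge0.
(* [1 + M] replaces the square root of [M], since [M <= (1 + M) ^+ 2]. *)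
have b n : `|telescope u n| <= geometric (1 + M) 2^-1 n.
  rewrite /telescope /geometric /=.
  have p2 : 0 < (2^-1 : R) ^+ n by rewrite exprn_gt0// invr_gt0.
  have M1 : 0 <= 1 + M by rewrite addr_ge0.
  rewrite -(@ler_pXn2r _ 2) ?nnegrE ?mulr_ge0 ?(ltW p2)//.
  rewrite real_normK ?num_real// exprMn -exprM mulnC exprM.
  have -> : (2^-1 : R) ^+ 2 = 4^-1 by field.
  rewrite exprVn -(ler_pM2l (_ : 0 < 4 ^+ n)) ?exprn_gt0//.
  rewrite [leRHS]mulrCA mulfV ?gt_eqF ?exprn_gt0// mulr1.
  apply: (le_trans (H n)); nra.
have : cvgn (series (telescope u)).
  apply: normed_cvg; apply: (series_le_cvg _ _ b) => //.
  - by move=> n; rewrite /geometric/= mulr_ge0 ?exprn_ge0 ?addr_ge0.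
  - by apply: is_cvg_geometric_series; rewrite gtr0_norm ?invr_gt0// invf_lt1// ltr1n.
rewrite telescopeK => cu.
have -> : u = (fun n => [sequence u n - u 0%N]_n n + u 0%N).
  by apply/funext => n /=; rewrite subrK.
by apply: is_cvgD => //; exact: is_cvg_cst.
Qed.

(** Riesz--Fischer. With the rate [8^-1 ^+ k] the sum [G] of the squared
increments weighted by [4 ^+ n] is still integrable, so it is finite almost
everywhere, and there [cvg_of_sqr_bound] gives pointwise convergence; Fatou's
lemma carries the rate to the limit. *)
Lemma L2_complete (v : nat -> T -> R) :
  (forall n, sqint mu D (v n)) ->
  (forall k l, (k <= l)%N ->
     ip mu D (fun x => v k x - v l x) (fun x => v k x - v l x) <= (8^-1) ^+ k) ->
  exists u, sqint mu D u /\
   forall k, ip mu D (fun x => v k x - u x) (fun x => v k x - u x) <= (8^-1) ^+ k.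
Proof.
move=> sv H.
pose dn n x := 4 ^+ n * (v n x - v n.+1 x) ^+ 2.
pose G x := (\sum_(n <oo) (dn n x)%:E)%E.
have sd n := sqintB mD (sv n) (sv n.+1).
have dn0 n x : (0 <= (dn n x)%:E)%E.
  by rewrite lee_fin mulr_ge0 ?sqr_ge0 ?exprn_ge0.
have md n : measurable_fun D (fun x => (dn n x)%:E).
  by apply/measurable_EFinP/measurable_funM => //; apply/measurable_funX/sqint_measurable/sd.
have mG : measurable_fun D G.
  by apply: (ge0_emeasurable_sum (P := xpredT)) => // k x _ _.
have Idn n : (\int[mu]_(x in D) (dn n x)%:E <= ((2^-1) ^+ n)%:E)%E.
  rewrite /dn; under eq_integral do rewrite EFinM.
  rewrite (ge0_integralZl_EFin mu mD _ _ (exprn_ge0 n _))//; [idtac|by move=> x _; rewrite lee_fin sqr_ge0|].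
  2: by apply/measurable_EFinP/measurable_funX/sqint_measurable/sd.
  rewrite ip_sqE// -EFinM lee_fin.
  apply: (@le_trans _ _ (4 ^+ n * (8^-1) ^+ n)).
    by rewrite ler_wpM2l ?exprn_ge0//; apply: H.
  by rewrite -exprMn (_ : 4 * 8^-1 = 2^-1 :> R) //; field.
have IG : mu.-integrable D G.
  apply/integrableP; split => //.
  rewrite (eq_integral G); last first.
    by move=> x _; rewrite gee0_abs// nneseries_ge0.
  rewrite integral_nneseries//.
  apply: (@le_lt_trans _ _ (\sum_(n <oo) ((2^-1) ^+ n : R)%:E)%E).
    apply: lee_nneseries => n *; first exact: integral_ge0.
    exact: Idn.
  have := @cvg_geometric_eseries_half R 2 0.
  move=> /cvg_lim => /(_ (@ereal_hausdorff R)) h.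
  rewrite (_ : (\sum_(n <oo) ((2^-1) ^+ n : R)%:E)%E = (2 / 2 ^+ 0)%:E) ?ltry//.
  rewrite -h; congr (limn _); apply/funext => n; rewrite /eseries/=.
  apply: eq_bigr => i _; congr (_%:E).
  by rewrite addn1 natrX exprS invfM mulrA mulfV// mul1r exprVn.
have aeG := integrable_ae mD IG.
pose A := D `&` [set x | (G x < +oo)%E].
have mA : measurable A.
  by apply: emeasurable_fun_infty_o.
have cvA x : A x -> cvgn (fun n => v n x).
  move=> [Dx Gx].
  have Gf : G x \is a fin_num by rewrite ge0_fin_numE// nneseries_ge0.
  apply: (@cvg_of_sqr_bound _ (fine (G x))) => n.
  rewrite -lee_fin fineK//.
  rewrite -(sqrrN) opprB -/(dn n x).
  apply: (@le_trans _ _ (\sum_(0 <= i < n.+1) (dn i x)%:E)%E).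
    by rewrite big_nat_recr//= leeDr// sume_ge0.
  by apply: nneseries_lim_ge => //.
(* Off [A] the sequence is replaced by 0, so that it converges everywhere. *)
pose w n x := v n x * \1_A x.
pose u x := if pselect (A x) then limn (fun n => v n x) else 0.
have wu x : D x -> w n x @[n --> \oo] --> u x.
  move=> Dx; rewrite /w /u indicE; case: pselect => [Ax|nAx].
    by rewrite mem_set//; under eq_fun do rewrite mulr1; exact: cvA.
  by rewrite memNset//; under eq_fun do rewrite mulr0; exact: cvg_cst.
have mw n : measurable_fun D (w n).
  apply: measurable_funM; first exact: (sv n).1.
  exact: measurable_indic.
have mu_ : measurable_fun D u by apply: measurable_fun_cvg mw wu.
have K n : (\int[mu]_(x in D) ((v n x - u x) ^+ 2)%:E <= ((8^-1) ^+ n)%:E)%E.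
  rewrite (@ge0_ae_eq_integral _ _ _ mu D _ (fun x => ((w n x - u x) ^+ 2)%:E))//; last 5 first.
  - by apply/measurable_EFinP/measurable_funX/measurable_funB => //; exact: (sv n).1.
  - by apply/measurable_EFinP/measurable_funX/measurable_funB.
  - by move=> x _; rewrite lee_fin sqr_ge0.
  - by move=> x _; rewrite lee_fin sqr_ge0.
  - case: aeG => N [mN N0 sN]; exists N; split => //; apply: subset_trans sN.
    apply: subsetC => x /= h Dx; rewrite /w indicE mem_set ?mulr1//.
    by split => //=; rewrite ltey_eq h.
  rewrite (eq_integral (fun x => limn_einf (fun m => ((w n x - w m x) ^+ 2)%:E))); last first.
    move=> x; rewrite inE => Dx.
    suff /cvg_limn_einf_sup[-> _] : ((w n x - w m x) ^+ 2)%:E @[m --> \oo] --> ((w n x - u x) ^+ 2)%:E by [].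
    apply: cvg_EFin; first exact: nearW.
    rewrite expr2; apply: (@cvg_trans _ ((w n x - w m x) * (w n x - w m x) @[m --> \oo])) => //.
    by apply: cvgM; (apply: cvgB; [exact: cvg_cst|exact: wu]).
  apply: le_trans (fatou _ _ _ _) _ => //.
  - by move=> m; apply/measurable_EFinP/measurable_funX/measurable_funB.
  - by move=> m x _; rewrite lee_fin sqr_ge0.
  rewrite limn_einf_lim; apply: lime_le.
    exact: is_cvg_einfs.
  apply: nearW => m.
  apply: (@le_trans _ _ (\int[mu]_(x in D) ((w n x - w (maxn n m) x) ^+ 2)%:E)%E).
    by apply: ereal_inf_lbound; exists (maxn n m) => //=; exact: leq_maxr.
  apply: (@le_trans _ _ (\int[mu]_(x in D) ((v n x - v (maxn n m) x) ^+ 2)%:E)%E).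
    apply: ge0_le_integral => //.
    - by move=> x _; rewrite lee_fin sqr_ge0.
    - by apply/measurable_EFinP/measurable_funX/measurable_funB.
    - by apply/measurable_EFinP/measurable_funX/measurable_funB; apply sv.
    - move=> x Dx; rewrite lee_fin /w -mulrBl exprMn indicE.
      by case: (x \in A); rewrite ?expr1n ?mulr1// expr0n mulr0 sqr_ge0.
  rewrite ip_sqE//; last exact: sqintB.
  by rewrite lee_fin H// leq_maxl.
have sB n : sqint mu D (fun x => v n x - u x).
  split; first by apply: measurable_funB => //; apply sv.
  by apply: le_lt_trans (K n) _; rewrite ltry.
exists u; split.
  have := sqintB mD (sv 0%N) (sB 0%N).
  by under eq_fun do rewrite opprB addrC subrK.
by move=> k; have := K k; rewrite ip_sqE.
Qed.

End Complete.

(** * The infimum of the Rayleigh quotient is an eigenvalue *)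

(** Passage to the limit in the estimates given by [ip_near], which hold for
[e <= 1] only. *)
Lemma ler_addMeps (R : realType) (a b C : R) : 0 <= C ->
  (forall e : R, 0 < e -> e <= 1 -> a <= b + e * C) -> a <= b.
Proof.
move=> C0 H; apply/ler_addgt0Pr => e e0.
have C1 : 0 < C + 1 by rewrite ltr_wpDl.
pose e' := Num.min 1 (e / (C + 1)).
have e'0 : 0 < e' by rewrite lt_min ltr01 divr_gt0.
apply: le_trans (H e' e'0 _) _; first by rewrite ge_min lexx.
rewrite lerD2l; apply: (@le_trans _ _ (e / (C + 1) * C)).
  by rewrite ler_wpM2r// ge_min lexx orbT.
by rewrite mulrAC ler_pdivrMr// ler_wpM2l ?ltW// ltr_pwDr.
Qed.

Section Minimizer.
Context d (T : measurableType d) (R : realType).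
Variables (mu : {measure set T -> \bar R}) (D : set T).
Hypothesis mD : measurable D.
Variables (A : set (T -> R)) (d1 d2 : (T -> R) -> T -> R).
Implicit Types u v w f g : T -> R.

Local Notation ip := (ip mu D).
Local Notation sqint := (sqint mu D).

Definition energy v := ip (d1 v) (d1 v) + ip (d2 v) (d2 v).

Hypothesis A_lin : forall f g a b, A f -> A g -> A (fun x => a * f x + b * g x).
Hypothesis d1_lin : forall f g a b, A f -> A g ->
  d1 (fun x => a * f x + b * g x) = (fun x => a * d1 f x + b * d1 g x).
Hypothesis d2_lin : forall f g a b, A f -> A g ->
  d2 (fun x => a * f x + b * g x) = (fun x => a * d2 f x + b * d2 g x).
Hypothesis A_sq : forall v, A v -> [/\ sqint v, sqint (d1 v) & sqint (d2 v)].
(* Rellich compactness in quantitative form: along a sequence of bounded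
   energy, the norm is controlled by finitely many coefficients. *)
Hypothesis A_compact : forall e : R, 0 < e -> exists (I : finType) (psi : I -> T -> R),
  (forall i, sqint (psi i)) /\
  forall v, A v -> ip v v <= \sum_i (ip v (psi i)) ^+ 2 + e * energy v.
Hypothesis A_nz : exists2 v, A v & 0 < ip v v.

Definition rayleigh : set R :=
  [set r | exists v, [/\ A v, 0 < ip v v & r = energy v / ip v v]].

Definition rayleigh_bottom : R := inf rayleigh.

Lemma energy_ge0 v : 0 <= energy v.
Proof. by rewrite addr_ge0 ?ip_ge0. Qed.

Lemma rayleigh_lb : lbound rayleigh 0.
Proof. by move=> _ [v [_ v0 ->]]; rewrite divr_ge0 ?energy_ge0 // ltW. Qed.

Lemma rayleigh_inf : has_inf rayleigh.
Proof.
split; last by exists 0; exact: rayleigh_lb.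
by have [v Av v0] := A_nz; exists (energy v / ip v v), v.
Qed.

Lemma rayleigh_bottom_ge0 : 0 <= rayleigh_bottom.
Proof. by apply: lb_le_inf; [exact: rayleigh_inf.1 | exact: rayleigh_lb]. Qed.

Lemma rayleigh_bottom_le v : A v -> rayleigh_bottom * ip v v <= energy v.
Proof.
move=> Av; have := ip_ge0 mu D v; rewrite le_eqVlt => /orP[/eqP <-|v0].
  by rewrite mulr0 energy_ge0.
rewrite -ler_pdivlMr//; apply: ge_inf; first by case: rayleigh_inf.
by exists v.
Qed.

(** The closure of [A] for the graph norm, with [(g1, g2)] the gradient of
[u]. *)
Definition limit_pt u g1 g2 := [/\ sqint u, sqint g1, sqint g2 &
  forall e : R, 0 < e -> exists v, [/\ A v,
    ip (fun x => v x - u x) (fun x => v x - u x) <= e,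
    ip (fun x => d1 v x - g1 x) (fun x => d1 v x - g1 x) <= e &
    ip (fun x => d2 v x - g2 x) (fun x => d2 v x - g2 x) <= e]].

(** Both sides are continuous for the graph norm. *)
Lemma limit_pt_bottom u g1 g2 : limit_pt u g1 g2 ->
  rayleigh_bottom * ip u u <= ip g1 g1 + ip g2 g2.
Proof.
move=> [su s1 s2 H].
pose C := rayleigh_bottom * (ip u u + ip u u + 2) + (ip g1 g1 + ip g1 g1 + 2) + (ip g2 g2 + ip g2 g2 + 2).
have C0 : 0 <= C.
  by rewrite /C !(addr_ge0, mulr_ge0) ?ip_ge0 ?rayleigh_bottom_ge0.
apply: (ler_addMeps C0) => e e0 e1.
have [v [Av h hd1 hd2]] := H (e ^+ 2) (exprn_gt0 _ e0).
have [sv sv1 sv2] := A_sq Av.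
have := ip_near mD e0 e1 su su sv sv h h.
have := ip_near mD e0 e1 s1 s1 sv1 sv1 hd1 hd1.
have := ip_near mD e0 e1 s2 s2 sv2 sv2 hd2 hd2.
have := rayleigh_bottom_le Av; rewrite /energy !ler_norml.
move=> ? /andP[_ ?] /andP[_ ?] /andP[? _].
have : rayleigh_bottom * (- (e * (ip u u + ip u u + 2))) <= rayleigh_bottom * (ip v v - ip u u).
  by rewrite ler_wpM2l// rayleigh_bottom_ge0.
rewrite /C; lra.
Qed.

Lemma ip_sqD_le f g : sqint f -> sqint g ->
  ip (fun x => f x + g x) (fun x => f x + g x) <= 2 * ip f f + 2 * ip g g.
Proof.
move=> sf sg; have := ip_ge0 mu D (fun x => f x - g x); rewrite ip_sqB//.
have -> : ip (fun x => f x + g x) (fun x => f x + g x) =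
          ip (fun x => 1 * f x + 1 * g x) (fun x => 1 * f x + 1 * g x).
  by apply: eq_ip => x _; ring.
rewrite ip_quad//; lra.
Qed.

Lemma lin_near f g f' g' (t e : R) : sqint f -> sqint g -> sqint f' -> sqint g' ->
  ip (fun x => f' x - f x) (fun x => f' x - f x) <= e ->
  ip (fun x => g' x - g x) (fun x => g' x - g x) <= e ->
  ip (fun x => (1 * f' x + t * g' x) - (1 * f x + t * g x))
     (fun x => (1 * f' x + t * g' x) - (1 * f x + t * g x)) <= (2 + 2 * t ^+ 2) * e.
Proof.
move=> sf sg sf' sg' h1 h2.
have sF := sqintB mD sf' sf; have sG := sqintB mD sg' sg.
set F := (fun x => f' x - f x) in h1 sF.
set G := (fun x => g' x - g x) in h2 sG.
have stG : sqint (fun x => t * G x).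
  have := sqint_lin mD 0 t sF sG; by under eq_fun do rewrite mul0r add0r.
have : ip (fun x => t * G x) (fun x => t * G x) = t ^+ 2 * ip G G.
  have := ip_quad mD 0 t sF sG; rewrite expr0n /= mul0r mulr0 !mul0r !add0r => <-.
  by apply: eq_ip => x _; ring.
have := ip_sqD_le sF stG.
have -> : ip (fun x => F x + t * G x) (fun x => F x + t * G x) =
  ip (fun x => (1 * f' x + t * g' x) - (1 * f x + t * g x))
     (fun x => (1 * f' x + t * g' x) - (1 * f x + t * g x)).
  by apply: eq_ip => x _; rewrite /F /G; ring.
have := sqr_ge0 t; nra.
Qed.

Lemma limit_pt_lin u g1 g2 w h1 h2 (t : R) : limit_pt u g1 g2 -> limit_pt w h1 h2 ->
  limit_pt (fun x => 1 * u x + t * w x) (fun x => 1 * g1 x + t * h1 x)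
    (fun x => 1 * g2 x + t * h2 x).
Proof.
move=> [su s1 s2 H] [sw r1 r2 K]; split; [exact: sqint_lin..|].
move=> e e0.
have c0 : 0 < 2 + 2 * t ^+ 2 by have := sqr_ge0 t; lra.
have [v [Av a b c]] := H _ (divr_gt0 e0 c0).
have [z [Az a' b' c']] := K _ (divr_gt0 e0 c0).
have [sv sv1 sv2] := A_sq Av; have [sz sz1 sz2] := A_sq Az.
exists (fun x => 1 * v x + t * z x); rewrite d1_lin// d2_lin//.
split; first exact: A_lin.
- by apply: le_trans (lin_near t su sw sv sz a a') _; rewrite mulrC divfK ?gt_eqF.
- by apply: le_trans (lin_near t s1 r1 sv1 sz1 b b') _; rewrite mulrC divfK ?gt_eqF.
- by apply: le_trans (lin_near t s2 r2 sv2 sz2 c c') _; rewrite mulrC divfK ?gt_eqF.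
Qed.

(** The energy minus [rayleigh_bottom] times the squared norm is a nonnegative
quadratic form; where it vanishes, [quad_discr] makes its polar form vanish
too. *)
Lemma euler_lagrange u g1 g2 : limit_pt u g1 g2 ->
  ip g1 g1 + ip g2 g2 = rayleigh_bottom * ip u u ->
  forall w h1 h2, limit_pt w h1 h2 ->
    ip g1 h1 + ip g2 h2 = rayleigh_bottom * ip u w.
Proof.
move=> Lu Eu w h1 h2 Lw; have Bw := limit_pt_bottom Lw.
case: (Lu) => su s1 s2 _; case: (Lw) => sw r1 r2 _.
have := @quad_discr R 0 (ip g1 h1 + ip g2 h2 - rayleigh_bottom * ip u w)
   (ip h1 h1 + ip h2 h2 - rayleigh_bottom * ip w w) (lexx _).
rewrite subr_ge0 mul0r => /(_ Bw) Q; apply/eqP; rewrite -subr_eq0 -sqrf_eq0.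
rewrite eq_le sqr_ge0 andbT; apply: Q => t.
have := limit_pt_bottom (limit_pt_lin t Lu Lw); rewrite !ip_quad// -subr_ge0.
by congr (_ <= _); move: Eu; lra.
Qed.

Lemma unit_minimizing (e : R) : 0 < e ->
  exists v, [/\ A v, ip v v = 1 & energy v <= rayleigh_bottom + e].
Proof.
move=> e0; have [r [v [Av v0 ->]] re] := inf_adherent e0 rayleigh_inf.
pose s := (Num.sqrt (ip v v))^-1.
have s2 : s ^+ 2 = (ip v v)^-1 by rewrite /s exprVn sqr_sqrtr ?ltW.
have [sv sv1 sv2] := A_sq Av.
exists (fun x => s * v x + 0 * v x); split; first exact: A_lin.
  rewrite ip_quad// s2 expr0n /= mulr0 !mul0r !addr0 mulVf ?gt_eqF//.
rewrite /energy d1_lin// d2_lin// !ip_quad// s2 expr0n /= !mulr0 !mul0r !addr0.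
rewrite -mulrDr mulrC -/(energy v); exact: ltW.
Qed.

(** An ultrafilter makes every bounded real sequence Cauchy, so all the
coefficients of a minimizing sequence are handled at once, with no diagonal
extraction. *)
Lemma ultra_cauchy (G : set_system nat) (a : nat -> R) (M : R) : UltraFilter G ->
  (forall n, a n ^+ 2 <= M) -> forall e : R, 0 < e ->
  exists2 P : set nat, G P & forall n m, P n -> P m -> (a n - a m) ^+ 2 <= e.
Proof.
move=> GU aM e e0.
have GF : ProperFilter G by exact: ultra_proper.
have M0 : 0 <= M by apply: le_trans (aM 0%N); exact: sqr_ge0.
have ab n : a n \in `[- (M + 1), M + 1].
  by rewrite in_itv/= -ler_norml -(@ler_pXn2r _ 2) ?nnegrE ?addr_ge0//
    real_normK ?num_real//; apply: le_trans (aM n) _; nra.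
have cK := @segment_compact R (- (M + 1)) (M + 1).
have aG : G (a @^-1` [set` `[- (M + 1), M + 1]]).
  by apply: (@filterE _ G) => n; exact: ab.
have [l [_ cl]] := cK (a @ G) _ aG.
pose h := Num.min 1 (e / 4).
have h0 : 0 < h by rewrite lt_min ltr01 divr_gt0.
have : G [set n | `|l - a n| < h].
  have [//|nG] := in_ultra_setVsetC [set n | `|l - a n| < h] GU.
  have aC : (a @ G) [set a n | n in ~` [set n | `|l - a n| < h]].
    by apply: (@filterS _ G _ _ _ _ nG) => n nn; exists n.
  by have [_ [[n nn <-] /nn]] := cl _ _ aC (nbhsx_ballx l h h0).
exists [set n | `|l - a n| < h] => // n m /=.
have h1 : h <= 1 by rewrite ge_min lexx.
have h4 : h <= e / 4 by rewrite ge_min lexx orbT.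
move=> hn hm; have nm : `|a n - a m| <= 2 * h.
  rewrite (_ : a n - a m = (l - a m) - (l - a n)); last by ring.
  by apply: le_trans (ler_normB _ _) _; lra.
have hh : h * h <= h by rewrite -[leRHS]mulr1 (ler_wpM2l (ltW h0)).
rewrite -(real_normK (num_real _)) expr2.
have : `|a n - a m| * `|a n - a m| <= (2 * h) * (2 * h) by apply: ler_pM.
lra.
Qed.

(** The direct method. For a normalized minimizing sequence the parallelogram
law bounds the energy of [v n - v m] by [rayleigh_bottom] times its squared norm
up to small terms, and [A_compact] makes that norm small along an ultrafilter.
So a subsequence is Cauchy for the graph norm, at the rate [L2_complete] asks
for. *)
Theorem minimizer_exists : exists u g1 g2,
  [/\ limit_pt u g1 g2, ip u u = 1 & ip g1 g1 + ip g2 g2 = rayleigh_bottom].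
Proof.
pose r (n : nat) : R := n.+1%:R^-1.
have invn0 n : 0 < r n by rewrite invr_gt0.
have /choice[v Hv] := fun n => unit_minimizing (invn0 n).
have [G [GU sG]] := ultraFilterLemma (@eventually_filter).
have GF : ProperFilter G by exact: ultra_proper.
have Av n : A (v n) by case: (Hv n).
have Nv n : ip (v n) (v n) = 1 by case: (Hv n).
have Ev n : energy (v n) <= rayleigh_bottom + r n by case: (Hv n).
have inv1 n : r n <= 1 by rewrite /r invf_le1// ler1n.
pose dv n m x := 1 * v n x + (-1) * v m x.
have Adv n m : A (dv n m) by exact: A_lin.
have parallelogram n m : energy (dv n m) + energy (fun x => 1 * v n x + 1 * v m x) =
    2 * energy (v n) + 2 * energy (v m).
  have [_ sn1 sn2] := A_sq (Av n); have [_ sm1 sm2] := A_sq (Av m).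
  by rewrite /energy !d1_lin// !d2_lin// !ip_quad//; ring.
have parN n m : ip (dv n m) (dv n m) +
    ip (fun x => 1 * v n x + 1 * v m x) (fun x => 1 * v n x + 1 * v m x) = 4.
  have [sn _ _] := A_sq (Av n); have [sm _ _] := A_sq (Av m).
  by rewrite /dv !ip_quad// !Nv; ring.
have En n m : energy (dv n m) <= rayleigh_bottom * ip (dv n m) (dv n m) + 2 * r n + 2 * r m.
  have := parallelogram n m; have := parN n m.
  have := rayleigh_bottom_le (A_lin 1 1 (Av n) (Av m)).
  have := Ev n; have := Ev m.
  set X := ip (dv n m) (dv n m).
  set Y := ip (fun x => 1 * v n x + 1 * v m x) (fun x => 1 * v n x + 1 * v m x).
  move=> ? ? h e4; have : rayleigh_bottom * Y = rayleigh_bottom * 4 - rayleigh_bottom * X by rewrite -e4; ring.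
  lra.
have En4 n m : energy (dv n m) <= 4 * (rayleigh_bottom + 1).
  have := parallelogram n m; have := energy_ge0 (fun x => 1 * v n x + 1 * v m x).
  have := Ev n; have := Ev m; have := inv1 n; have := inv1 m; lra.
have cauchy0 (e : R) : 0 < e -> exists2 P : set nat, G P &
    forall n m, P n -> P m -> ip (dv n m) (dv n m) <= e.
  move=> e0; have b1 : 0 < 8 * (rayleigh_bottom + 1) by have := rayleigh_bottom_ge0; lra.
  have [I [psi [spsi Hpsi]]] := A_compact (divr_gt0 e0 b1).
  pose N := #|I|.
  have N0 : 0 < (2 * N.+1%:R : R) by rewrite mulr_gt0.
  have ex i : exists2 P : set nat, G P & forall n m, P n -> P m ->
      (ip (v n) (psi i) - ip (v m) (psi i)) ^+ 2 <= e / (2 * N.+1%:R).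
    apply: (@ultra_cauchy G _ (ip (psi i) (psi i))); [|exact: divr_gt0].
    move=> n; have [sn _ _] := A_sq (Av n).
    by have := ip_CauchySchwarz mD sn (spsi i); rewrite Nv mul1r.
  have /choice[P HP] : forall i, exists P : set nat, G P /\ forall n m, P n -> P m ->
      (ip (v n) (psi i) - ip (v m) (psi i)) ^+ 2 <= e / (2 * N.+1%:R).
    by move=> i; have [P ? ?] := ex i; exists P.
  exists [set n | forall i, P i n].
    by apply: filter_forall => i; case: (HP i).
  move=> n m Pn Pm; apply: le_trans (Hpsi _ (Adv n m)) _.
  have [sn _ _] := A_sq (Av n); have [sm _ _] := A_sq (Av m).
  apply: (@le_trans _ _ (\sum_(i : I) (e / (2 * N.+1%:R)) + e / (8 * (rayleigh_bottom + 1)) * (4 * (rayleigh_bottom + 1)))).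
    apply: lerD; last by rewrite ler_wpM2l// divr_ge0// ltW.
    apply: ler_sum => i _; rewrite /dv ip_linl// mul1r mulN1r.
    by apply: (HP i).2.
  rewrite sumr_const -/N -[_ *+ N]mulr_natr.
  have -> : e / (8 * (rayleigh_bottom + 1)) * (4 * (rayleigh_bottom + 1)) = e / 2.
    by field; lra.
  have : e / (2 * N.+1%:R) * N%:R <= e / 2.
    rewrite invfM mulrA -mulrA ger_pMr ?divr_gt0// mulrC ler_pdivrMr//.
    by rewrite mul1r ler_nat.
  move: (e / (2 * N.+1%:R) * N%:R) => p; lra.
pose q k := (8^-1 : R) ^+ k.
have p8 k : 0 < q k by rewrite exprn_gt0// invr_gt0.
have cauchy1 k : exists P : set nat, [/\ G P,
    forall n, P n -> r n <= 8^-1 ^+ k &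
    forall n m, P n -> P m -> ip (dv n m) (dv n m) <= 8^-1 ^+ k /\
       energy (dv n m) <= 8^-1 ^+ k].
  pose e := (8^-1 : R) ^+ k / (2 * (rayleigh_bottom + 1)).
  have b0 := rayleigh_bottom_ge0.
  have b1 : 0 < 2 * (rayleigh_bottom + 1) by lra.
  have e0 : 0 < e by rewrite divr_gt0.
  have e1 : e <= 8^-1 ^+ k by rewrite ler_pdivrMr// ler_peMr ?ltW//; lra.
  have [P GP HP] := cauchy0 e e0.
  have [n0 _ Hn0] : \forall n \near \oo, r n <= 8^-1 ^+ k / 8.
    near=> n; apply: ltW; near: n.
    by apply: (near_infty_natSinv_lt (PosNum (divr_gt0 (p8 k) (ltr0n _ 8)))).
  exists (P `&` [set n | (n0 <= n)%N]); split.
  - by apply: filterI => //; apply: sG; exists n0.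
  - move=> n [_ /Hn0] /= h; apply: le_trans h _.
    by rewrite ler_pdivrMr// ler_peMr ?ltW//; lra.
  - move=> n m [Pn /Hn0/= hn] [Pm /Hn0/= hm]; have h := HP _ _ Pn Pm.
    split; first exact: le_trans h e1.
    apply: le_trans (En n m) _.
    have : rayleigh_bottom * ip (dv n m) (dv n m) <= rayleigh_bottom * e by rewrite ler_wpM2l.
    have : (rayleigh_bottom + 1) * e = 8^-1 ^+ k / 2 by rewrite /e; field; lra.
    have := ltW e0; lra.
have /choice[P HP] := cauchy1.
pose B k := [set n | forall i, (i <= k)%N -> P i n].
have GB k : G (B k).
  elim: k => [|k IH].
    have [g0 _ _] := HP 0%N; apply: filterS g0 => n Pn i.
    by rewrite leqn0 => /eqP ->.
  have [g _ _] := HP k.+1; apply: filterS2 IH g => n Bn Pn i.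
  by rewrite leq_eqVlt => /orP[/eqP -> //|]; exact: Bn.
have /choice[s Hs] : forall k, exists n, B k n by move=> k; exact: (filter_ex (GB k)).
have Ps k l : (k <= l)%N -> P k (s l) by move=> kl; apply: Hs.
have C k l : (k <= l)%N -> ip (dv (s k) (s l)) (dv (s k) (s l)) <= 8^-1 ^+ k /\
    energy (dv (s k) (s l)) <= 8^-1 ^+ k.
  by move=> kl; have [_ _ h] := HP k; apply: h; apply: Ps.
have C0 k l : (k <= l)%N -> ip (fun x => v (s k) x - v (s l) x) (fun x => v (s k) x - v (s l) x) <= 8^-1 ^+ k.
  move=> kl; have [h _] := C _ _ kl; apply: le_trans h.
  by rewrite le_eqVlt; apply/orP; left; apply/eqP/eq_ip => x _; rewrite /dv; ring.
have C1 k l : (k <= l)%N -> ip (fun x => d1 (v (s k)) x - d1 (v (s l)) x) (fun x => d1 (v (s k)) x - d1 (v (s l)) x) <= 8^-1 ^+ k.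
  move=> kl; have [_ h] := C _ _ kl; apply: le_trans h.
  rewrite /energy d1_lin// -[leLHS]addr0 lerD ?ip_ge0//.
  by rewrite le_eqVlt; apply/orP; left; apply/eqP/eq_ip => x _; ring.
have C2 k l : (k <= l)%N -> ip (fun x => d2 (v (s k)) x - d2 (v (s l)) x) (fun x => d2 (v (s k)) x - d2 (v (s l)) x) <= 8^-1 ^+ k.
  move=> kl; have [_ h] := C _ _ kl; apply: le_trans h.
  rewrite /energy d2_lin// -[leLHS]add0r lerD ?ip_ge0//.
  by rewrite le_eqVlt; apply/orP; left; apply/eqP/eq_ip => x _; ring.
have S k := A_sq (Av (s k)).
have [u [su Lu]] := L2_complete mD (fun k => let: And3 a _ _ := S k in a) C0.
have [g1 [s1 L1]] := L2_complete mD (fun k => let: And3 _ a _ := S k in a) C1.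
have [g2 [s2 L2]] := L2_complete mD (fun k => let: And3 _ _ a := S k in a) C2.
have small (e : R) : 0 < e -> exists k, 8^-1 ^+ k <= e ^+ 2 /\ (8^-1 : R) ^+ k <= e.
  move=> e0; have m0 : 0 < Num.min (e ^+ 2) e by rewrite lt_min e0 exprn_gt0.
  have : \forall k \near \oo, `|(8^-1 : R) ^+ k| < Num.min (e ^+ 2) e.
    have : (8^-1 : R) ^+ k @[k --> \oo] --> 0.
      by apply: cvg_expr; rewrite gtr0_norm ?invr_gt0// invf_lt1// ltr1n.
    by move=> /cvgr0Pnorm_lt; apply.
  move=> /filter_ex[k]; rewrite gtr0_norm// lt_min => /andP[/ltW a /ltW b].
  by exists k.
have Lp : limit_pt u g1 g2.
  split=> // e e0; have [k [_ hk]] := small e e0; exists (v (s k)).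
  by split=> //; apply: le_trans hk.
have uu : ip u u = 1.
  apply/eqP; rewrite -subr_eq0 -normr_le0.
  have c0 : 0 <= ip u u + ip u u + 2 by rewrite !addr_ge0 ?ip_ge0.
  apply: (ler_addMeps c0) => e e0 e1; have [k [hk _]] := small e e0.
  have [sk _ _] := S k; have hh := le_trans (Lu k) hk.
  by have := ip_near mD e0 e1 su su sk sk hh hh; rewrite Nv distrC add0r.
exists u, g1, g2; split=> //.
apply/eqP; rewrite eq_le; apply/andP; split; last first.
  by have := limit_pt_bottom Lp; rewrite uu mulr1.
pose c := 1 + (ip g1 g1 + ip g1 g1 + 2) + (ip g2 g2 + ip g2 g2 + 2).
have c0 : 0 <= c by rewrite !addr_ge0 ?ip_ge0.
apply: (ler_addMeps c0) => e e0 e1; have [k [hk hk']] := small e e0.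
have [_ sk1 sk2] := S k.
have h1 := le_trans (L1 k) hk; have h2 := le_trans (L2 k) hk.
have := ip_near mD e0 e1 s1 s1 sk1 sk1 h1 h1.
have := ip_near mD e0 e1 s2 s2 sk2 sk2 h2 h2.
rewrite !ler_norml => /andP[? _] /andP[? _].
have : r (s k) <= e.
  by have [_ h _] := HP k; apply: le_trans (h _ (Ps _ _ (leqnn k))) hk'.
have := Ev (s k); rewrite /energy /c; lra.
Unshelve. all: end_near.
Qed.

End Minimizer.

(** * The Bessel function of order one and its first zero *)

Section Bessel.
Context {R : realType}.
Implicit Types (s x : R) (n m j : nat).

Definition clif_coef j m : R := (-1) ^+ (m + j) / (m`! * (m + j).+1`!)%:R.

(** The Bessel--Clifford functions: [clif j] is the [j]-th derivative of
[clif 0], and [J_1(x) = x / 2 * clif 0 (x ^+ 2 / 4)]. Written with them,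
[J_1(c r) cos theta] is visibly a smooth function of the Cartesian
coordinates. *)
Definition clif j s : R := limn (pseries (clif_coef j) s).

Lemma factR_neq0 n : (n`!%:R : R) != 0.
Proof. by rewrite pnatr_eq0 -lt0n fact_gt0. Qed.

Lemma clif_coef_diffs j : pseries_diffs (clif_coef j) = clif_coef j.+1.
Proof.
apply/funext => m; rewrite /pseries_diffs /clif_coef addSn addnS.
move: (factR_neq0 (m + j).+2) => F0.
rewrite [(m.+1)`!]factS natrM [(m.+1 * _)%:R]natrM [in RHS]natrM.
have h (k a b e : R) : k != 0 -> a != 0 -> b != 0 -> k * (e / (k * a * b)) = e / (a * b).
  by move=> *; field; apply/and3P.
by rewrite h ?factR_neq0 ?pnatr_eq0.
Qed.

Lemma clif_cvg j s : cvgn (pseries (clif_coef j) s).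
Proof.
apply: normed_cvg.
apply: (@series_le_cvg _ _ (exp_coeff `|s|)) => [n|n|n|].
- exact: normr_ge0.
- by rewrite /exp_coeff /= divr_ge0 ?exprn_ge0.
- rewrite /= /clif_coef /exp_coeff /= normrM normrX normf_div normrX normrN1 expr1n.
  rewrite mulrC ler_wpM2l ?exprn_ge0// mul1r normr_nat lef_pV2 ?posrE ?ltr0n ?muln_gt0 ?fact_gt0//.
  by rewrite ler_nat leq_pmulr// fact_gt0.
- exact: is_cvg_series_exp_coeff.
Qed.

Lemma clif_derive j s : is_derive s (1 : R) (clif j) (clif j.+1 s).
Proof.
rewrite /clif -clif_coef_diffs.
apply: (@pseries_snd_diffs _ _ (`|s| + 1)); rewrite ?clif_coef_diffs; try exact: clif_cvg.
by rewrite [ltRHS]ger0_norm ?ltrDl// addr_ge0.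
Qed.

Lemma clif_continuous j : continuous (clif j).
Proof.
move=> s; apply: differentiable_continuous; apply/derivable1_diffP.
by have [] := clif_derive j s.
Qed.

(** Clifford's form of Bessel's equation of order one. It already holds between
partial sums, the number of terms being shifted by one. *)
Lemma clif_ode s : s * clif 2 s + 2 * clif 1 s + clif 0 s = 0.
Proof.
pose S j n := series (fun m => clif_coef j m * s ^+ m) n.
have key n : s * S 2 n + 2 * S 1 n.+1 + S 0 n.+1 = 0.
  rewrite /S; elim: n => [|n IH].
    rewrite /series /= big_geq// !big_nat1 /clif_coef !expr0 /= !addn0 !add0n !mulr1 mulr0 add0r.
    by rewrite expr1 !factS fact0; field.
  rewrite [series _ n.+1]seriesSr ![series _ n.+2]seriesSr.
  have -> (a b c x y z : R) : s * (a + x) + 2 * (b + y) + (c + z) =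
     (s * a + 2 * b + c) + (s * x + 2 * y + z) by ring.
  rewrite IH add0r /= /clif_coef addn0 addn1 addn2 [(n.+1)`!]factS !exprS.
  rewrite [(n.+3)`!]factS [(n.+2)`!]factS [(n.+1)`!]factS !natrM.
  have := factR_neq0 n; have := ler0n R n.
  rewrite -[n.+3%:R]natr1 -[n.+2%:R]natr1 -[n.+1%:R]natr1.
  move: (n`!%:R) (n%:R) => F k k0 F0.
  by field; rewrite F0 /= ?andbT; apply/and3P; split; apply: lt0r_neq0; lra.
have c0 := @clif_cvg 0 s; have c1 := @clif_cvg 1 s; have c2 := @clif_cvg 2 s.
have : s * S 2 n + 2 * S 1 n.+1 + S 0 n.+1 @[n --> \oo] --> s * clif 2 s + 2 * clif 1 s + clif 0 s.
  apply: cvgD; [apply: cvgD; (apply: cvgM; [exact: cvg_cst|])|].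
  - exact: c2.
  - by rewrite -(cvg_shiftS (S 1)) in c1 *; exact: c1.
  - by rewrite -(cvg_shiftS (S 0)) in c0 *; exact: c0.
under eq_fun do rewrite key.
move=> h; apply/esym; apply: (cvg_unique _ _ h) => //; exact: cvg_cst.
Qed.

Lemma clif0_0 : clif 0 0 = 1.
Proof.
apply/cvg_lim => //; rewrite -cvg_shiftS.
apply: cvg_near_cst; apply: nearW => n.
rewrite /pseries /series /= big_nat_recl//= big1 => [|i _].
  by rewrite expr0 mulr1 addr0 /clif_coef /= expr0 divr1.
by rewrite exprS mul0r mulr0.
Qed.

(** From rank 5 on, the alternating series at 4 groups into pairs of constant
sign. *)
Lemma clif0_4_pair k : odd k -> (5 <= k)%N ->
  0 < - (clif_coef 0 k * 4 ^+ k) + - (clif_coef 0 k.+1 * 4 ^+ k.+1).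
Proof.
move=> ok; rewrite -(ler_nat R) => k5.
rewrite /clif_coef !addn0 exprS -signr_odd ok expr1.
rewrite [(k.+2)`!]factS [(k.+1)`!]factS !natrM exprS.
have f0 : 0 < (k`!%:R : R) by rewrite ltr0n fact_gt0.
have p0 : 0 < (4 : R) ^+ k by rewrite exprn_gt0.
set F := k`!%:R in f0 *; set P := 4 ^+ k in p0 *.
rewrite -[k.+2%:R]natr1 -[k.+1%:R]natr1; move: (k%:R : R) k5 => K k5.
have -> : - (-1 / (F * ((K + 1) * F)) * P) -
   (-1 * -1 / ((K + 1) * F * ((K + 1 + 1) * ((K + 1) * F))) * (4 * P)) =
   P / (F * ((K + 1) * F)) * (1 - 4 / ((K + 1) * (K + 1 + 1))).
  by field; rewrite !lt0r_neq0 //=; lra.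
apply: mulr_gt0; first by rewrite divr_gt0// !mulr_gt0//; lra.
rewrite subr_gt0 ltr_pdivrMr; first nra.
by rewrite mulr_gt0//; lra.
Qed.

(** This sign change gives a positive zero of [J_1], at most 4: the sum of the
first five terms is negative and the remaining pairs lower it further. *)
Lemma clif0_4_lt0 : clif 0 4 < 0.
Proof.
rewrite -oppr_gt0 /clif -limN; last exact: clif_cvg.
have -> : - pseries (clif_coef 0) 4 = series (fun m => - (clif_coef 0 m * 4 ^+ m)).
  by rewrite -seriesN; apply/funext.
apply: (@lt_trans _ _ (\sum_(0 <= i < 5) - (clif_coef 0 i * 4 ^+ i))).
  rewrite !big_nat_recr//= big_nil /clif_coef !addn0 !factS fact0; lra.
apply: lt_sum_lim_series.
  by rewrite seriesN; apply: is_cvgN; exact: clif_cvg.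
move=> d; have -> : (5 + d.*2.+1 = (5 + d.*2).+1)%N by rewrite addnS.
by apply: clif0_4_pair; rewrite ?leq_addr// oddD odd_double.
Qed.

Lemma besselJ1E x : besselJ 1 x = x / 2 * clif 0 (x ^+ 2 / 4).
Proof.
rewrite /besselJ /clif; apply/cvg_lim => //.
have : x / 2 * pseries (clif_coef 0) (x ^+ 2 / 4) n @[n --> \oo] -->
    x / 2 * limn (pseries (clif_coef 0) (x ^+ 2 / 4)).
  by apply: cvgM; [exact: cvg_cst|exact: clif_cvg].
apply: cvg_trans; apply: near_eq_cvg; apply: nearW => n.
rewrite /pseries /series /= mulr_sumr; apply: eq_bigr => m _.
rewrite /clif_coef addn0 addn1.
have -> : x ^+ 2 / 4 = (x / 2) ^+ 2 by field.
rewrite -exprM mul2n addn1 exprS; ring.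
Qed.

Let j11 : R := besselJ_zero R 1 1.

Let Z := [set x : R | 0 < x /\ besselJ 1 x = 0].

Lemma besselJ1_eq0 x : 0 < x -> (besselJ 1 x = 0) <-> (clif 0 (x ^+ 2 / 4) = 0).
Proof.
move=> x0; rewrite besselJ1E; split=> [/eqP|->]; last by rewrite mulr0.
by rewrite mulf_eq0 gt_eqF ?divr_gt0//= => /eqP.
Qed.

Lemma clif0_root (a b : R) : a <= b -> 0 < clif 0 a -> clif 0 b <= 0 ->
  exists2 c, a < c <= b & clif 0 c = 0.
Proof.
move=> ab a0 b0.
have /IVT[] : Num.min (clif 0 a) (clif 0 b) <= (0 : R) <= Num.max (clif 0 a) (clif 0 b).
- by rewrite ge_min b0 orbT le_max (ltW a0).
- exact: ab.
- by apply/continuous_subspaceT => ?; exact: clif_continuous.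
move=> c; rewrite in_itv /= => /andP[ac cb] c0; exists c => //.
rewrite cb andbT lt_neqAle ac andbT; apply/eqP => e.
by move: a0; rewrite e c0 ltxx.
Qed.

Lemma besselJ1_zeros_neq0 : Z !=set0.
Proof.
have [|||c /andP[c0 c4] cz] := @clif0_root 0 4.
- by [].
- by rewrite clif0_0.
- exact: ltW clif0_4_lt0.
have s0 : 0 < 2 * Num.sqrt c by rewrite mulr_gt0// sqrtr_gt0.
exists (2 * Num.sqrt c); split => //; apply/besselJ1_eq0 => //.
by rewrite exprMn sqr_sqrtr ?ltW// (_ : 2 ^+ 2 * c / 4 = c) //; field.
Qed.

Lemma besselJ_zero11_has_inf : has_inf Z.
Proof. by split; [exact: besselJ1_zeros_neq0|exists 0 => x [/ltW]]. Qed.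

(** The zeros stay away from 0 because [clif 0 0 = 1]. *)
Lemma besselJ_zero11_gt0 : 0 < j11.
Proof.
have : clif 0 x @[x --> 0] --> clif 0 0 by exact: clif_continuous.
rewrite clif0_0 => /cvgr_gt /(_ 0 ltr01) [/= r /= r0 H].
have : Num.min 1 r <= j11.
  apply: lb_le_inf; first exact: besselJ1_zeros_neq0.
  move=> x [x0 /(besselJ1_eq0 x0) xz]; rewrite leNgt; apply/negP.
  rewrite lt_min => /andP[x1 xr].
  have : 0 < clif 0 (x ^+ 2 / 4).
    apply: H => /=; rewrite sub0r normrN ger0_norm ?divr_ge0 ?sqr_ge0//; nra.
  by rewrite xz ltxx.
by apply: lt_le_trans; rewrite lt_min ltr01.
Qed.

Lemma clif0_gt0 s : 0 <= s -> s < j11 ^+ 2 / 4 -> 0 < clif 0 s.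
Proof.
move=> s0 sj; rewrite ltNge; apply/negP => sn.
have [||c /andP[c0 cs] cz] := @clif0_root 0 s _ _ sn => //.
  by rewrite clif0_0.
have q0 : 0 < 2 * Num.sqrt c by rewrite mulr_gt0// sqrtr_gt0.
have : j11 <= 2 * Num.sqrt c.
  apply: ge_inf; first exact: besselJ_zero11_has_inf.2.
  split => //; apply/besselJ1_eq0 => //.
  by rewrite exprMn sqr_sqrtr ?ltW// (_ : 2 ^+ 2 * c / 4 = c) //; field.
move=> hj; have : j11 ^+ 2 <= (2 * Num.sqrt c) ^+ 2.
  by rewrite ler_pXn2r ?nnegrE ?(ltW q0)// (ltW besselJ_zero11_gt0).
rewrite exprMn sqr_sqrtr ?(ltW c0)//; lra.
Qed.

(** An infimum of zeros is a zero: a positive value would be positive on a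
neighbourhood, which contains zeros; a negative value would be negative slightly
to the left, where [clif0_gt0] forbids it. *)
Lemma clif0_j11 : clif 0 (j11 ^+ 2 / 4) = 0.
Proof.
have j0 := besselJ_zero11_gt0.
have cf : continuous (fun x : R => clif 0 (x ^+ 2 / 4)).
  move=> x; apply: continuous_comp; last exact: clif_continuous.
  apply: cvgMl; exact: exprn_continuous.
apply/eqP; rewrite eq_le; apply/andP; split; rewrite leNgt; apply/negP => h.
- have := cf j11 => /cvgr_gt /(_ 0 h) [/= r /= r0 H].
  have [x [x0 xz] xr] := inf_adherent r0 besselJ_zero11_has_inf.
  have jx : j11 <= x by apply: ge_inf => //; exact: besselJ_zero11_has_inf.2.
  have : 0 < clif 0 (x ^+ 2 / 4).
    by apply: H => /=; rewrite distrC ger0_norm ?subr_ge0// ltrBlDl.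
  by rewrite ((besselJ1_eq0 x0).1 xz) ltxx.
- have := cf j11 => /cvgr_lt /(_ 0 h) [/= r /= r0 H].
  pose x := j11 - Num.min (r / 2) (j11 / 2).
  have m0 : 0 < Num.min (r / 2) (j11 / 2) by rewrite lt_min !divr_gt0.
  have m1 : Num.min (r / 2) (j11 / 2) <= r / 2 by rewrite ge_min lexx.
  have m2 : Num.min (r / 2) (j11 / 2) <= j11 / 2 by rewrite ge_min lexx orbT.
  have : clif 0 (x ^+ 2 / 4) < 0.
    apply: H => /=; rewrite /x opprB addrC subrK gtr0_norm//; lra.
  apply/negP; rewrite -leNgt ltW// clif0_gt0//; rewrite /x.
    by rewrite divr_ge0// sqr_ge0.
  set y := Num.min _ _ in m0 m1 m2 *; nra.
Qed.

End Bessel.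

(** * Measure and integration in the plane *)

Section Plane.
Context {R : realType}.
Local Notation leb := (@lebesgue_measure R).
Local Notation leb2 := (@lebesgue2 R).

Lemma measurable_rect (A B : set R) : measurable A -> measurable B ->
  measurable (A `*` B : set (mplane R)).
Proof. by move=> mA mB; exact: measurableX. Qed.

(** An open set is a countable union of boxes with rational corners. *)
Lemma open_measurable2 (U : set (R * R)) : open U -> measurable (U : set (mplane R)).
Proof.
move=> oU.
pose box (q : rat * rat * (rat * rat)) : set (R * R) :=
  `]ratr q.1.1, ratr q.1.2[%classic `*` `]ratr q.2.1, ratr q.2.2[%classic.
have -> : U = \bigcup_(q in [set q | box q `<=` U]) box q.
  apply/seteqP; split; last by move=> p [q qU]; exact: qU.
  move=> p Up; have := open_nbhs_nbhs (conj oU Up).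
  move=> /nbhs_ballP [e /= e0 He].
  have ex (x : R) : exists ab : rat * rat, x - e < ratr ab.1 < x /\ x < ratr ab.2 < x + e.
    have [|a] := @rat_in_itvoo R (x - e) x; first by rewrite ltrBlDr ltrDl.
    have [|b] := @rat_in_itvoo R x (x + e); first by rewrite ltrDl.
    by rewrite !in_itv /= => hb ha; exists (a, b).
  have [q1 [/andP[a1 a2] /andP[b1 b2]]] := ex p.1.
  have [q2 [/andP[c1 c2] /andP[d1 d2]]] := ex p.2.
  exists (q1, q2); last by split; rewrite /= in_itv /= ?a2 ?b1 ?c2 ?d1.
  move=> [x y] [] /=; rewrite !in_itv /= => /andP[x1 x2] /andP[y1 y2].
  apply: He; split => /=; rewrite /ball /= ltr_norml; apply/andP; split; lra.
rewrite bigcup_mkcond; apply: countable_bigcupT_measurable => // q.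
case: ifP => // _; apply: measurable_rect; exact: measurable_itv.
Qed.

Lemma continuous_measurable2 (f : R * R -> R) (D : set (mplane R)) : continuous f ->
  measurable D -> measurable_fun D (f : mplane R -> R).
Proof.
move=> cf mD; apply: measurable_funTS.
apply: (measurability _ (RGenOpens.measurableE R)) => _ [_ [a [b ->]] <-].
rewrite setTI; apply: open_measurable2.
by apply: open_comp => // x _; exact: cf.
Qed.

Lemma lebesgue2_rect (A B : set R) : measurable A -> measurable B ->
  leb2 (A `*` B) = (leb A * leb B)%E.
Proof. by move=> mA mB; exact: product_measure1E. Qed.

Lemma integral_sections_x (D : set (mplane R)) (f : mplane R -> \bar R) :
  measurable D -> leb2.-integrable D f ->
  (\int[leb2]_(p in D) f p =
   \int[leb]_y \int[leb]_(x in [set x | D (x, y)]) f (x, y))%E.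
Proof.
move=> mD /(integrable_mkcond _ mD) If; rewrite integral_mkcond.
rewrite -[LHS](@integral21_prod_meas1 _ _ _ _ R leb leb (f \_ D) If).
by apply: eq_integral => y _; rewrite [RHS]integral_mkcond; apply: eq_integral => x _.
Qed.

Lemma integral_sections_y (D : set (mplane R)) (f : mplane R -> \bar R) :
  measurable D -> leb2.-integrable D f ->
  (\int[leb2]_(p in D) f p =
   \int[leb]_x \int[leb]_(y in [set y | D (x, y)]) f (x, y))%E.
Proof.
move=> mD /(integrable_mkcond _ mD) If; rewrite integral_mkcond.
rewrite -[LHS](@integral12_prod_meas1 _ _ _ _ R leb leb (f \_ D) If).
by apply: eq_integral => y _; rewrite [RHS]integral_mkcond; apply: eq_integral => x _.
Qed.

Lemma integral_rect_x (I J : set R) (f : mplane R -> \bar R) :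
  measurable I -> measurable J -> measurable_fun setT f -> (forall p, 0 <= f p)%E ->
  (\int[leb2]_(p in I `*` J) f p = \int[leb]_(y in J) \int[leb]_(x in I) f (x, y))%E.
Proof.
move=> mI mJ mf f0; have mIJ := measurable_rect mI mJ.
rewrite integral_mkcond.
have mfD : measurable_fun setT (f \_ (I `*` J)).
  by apply/(measurable_restrictT _ _).1 => //; apply: measurable_funTS.
have fD0 p : (0 <= (f \_ (I `*` J)) p)%E by apply: erestrict_ge0.
rewrite [LHS](@fubini_tonelli2 _ _ _ _ R leb leb (f \_ (I `*` J)) mfD fD0).
rewrite [RHS]integral_mkcond; apply: eq_integral => y _.
rewrite /fubini_G /patch; case: ifPn => [|yJ].
  rewrite inE => Jy; rewrite [RHS]integral_mkcond; apply: eq_integral => x _.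
  rewrite /patch; congr (if _ then _ else _).
  by apply/idP/idP; rewrite !inE /=; [case|split].
apply: integral0_eq => x _; case: ifPn => //; rewrite inE => -[_ /= Jy].
by move: yJ; rewrite notin_setE.
Qed.

Lemma integral_rect_y (I J : set R) (f : mplane R -> \bar R) :
  measurable I -> measurable J -> measurable_fun setT f -> (forall p, 0 <= f p)%E ->
  (\int[leb2]_(p in I `*` J) f p = \int[leb]_(x in I) \int[leb]_(y in J) f (x, y))%E.
Proof.
move=> mI mJ mf f0; have mIJ := measurable_rect mI mJ.
rewrite integral_mkcond.
have mfD : measurable_fun setT (f \_ (I `*` J)).
  by apply/(measurable_restrictT _ _).1 => //; apply: measurable_funTS.
have fD0 p : (0 <= (f \_ (I `*` J)) p)%E by apply: erestrict_ge0.
rewrite [LHS](@fubini_tonelli1 _ _ _ _ R leb leb (f \_ (I `*` J)) mfD fD0).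
rewrite [RHS]integral_mkcond; apply: eq_integral => x _.
rewrite /fubini_F /patch; case: ifPn => [|yJ].
  rewrite inE => Jx; rewrite [RHS]integral_mkcond; apply: eq_integral => y _.
  rewrite /patch; congr (if _ then _ else _).
  by apply/idP/idP; rewrite !inE /=; [case|split].
apply: integral0_eq => y _; case: ifPn => //; rewrite inE => -[/= Jx _].
by move: yJ; rewrite notin_setE.
Qed.

Lemma slice_measurable1 (f : R * R -> R) (y : R) (I : set R) :
  measurable_fun setT (f : mplane R -> R) -> measurable_fun I (fun x => f (x, y)).
Proof. move=> mg; apply: measurable_funTS; exact: (measurableT_comp mg (measurable_pair2 y)). Qed.

Lemma slice_measurable2 (f : R * R -> R) (x : R) (I : set R) :
  measurable_fun setT (f : mplane R -> R) -> measurable_fun I (fun y => f (x, y)).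
Proof. move=> mg; apply: measurable_funTS; exact: (measurableT_comp mg (measurable_pair1 x)). Qed.

End Plane.

(** * Poincare's inequality on a square *)

Section CellPoincare.
Context {R : realType}.
Local Notation leb := (@lebesgue_measure R).
Local Notation leb2 := (@lebesgue2 R).

Lemma ip1E d (T : measurableType d) (mu : {measure set T -> \bar R}) (D : set T)
  (f : T -> R) : ip mu D f (cst 1) = \int[mu]_(x in D) f x.
Proof. by apply: eq_Rintegral => x _ /=; rewrite mulr1. Qed.

Definition slice_x (I : set R) (g : mplane R -> R) (y : R) : R :=
  \int[leb]_(x in I) g (x, y).
Definition slice_y (J : set R) (g : mplane R -> R) (x : R) : R :=
  \int[leb]_(y in J) g (x, y).

Lemma measurable_slice_x (I : set R) (g : mplane R -> R) : measurable I ->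
  measurable_fun setT g -> (forall p, 0 <= g p) ->
  measurable_fun setT (slice_x I g).
Proof.
move=> mI mg g0; rewrite /slice_x /Rintegral.
have mIT := measurable_rect mI (@measurableT _ (measurableTypeR R)).
pose f := (fun p : mplane R => (g p)%:E) \_ (I `*` setT).
have mf : measurable_fun setT f.
  apply/(measurable_restrictT _ _).1 => //; apply: measurable_funTS.
  exact/measurable_EFinP.
have f0 p : (0 <= f p)%E by apply: erestrict_ge0 => q _; rewrite lee_fin.
have := @measurable_fun_fubini_tonelli_G _ _ _ _ R leb f mf f0.
move=> mG; apply: (eq_measurable_fun (fun y => fine (fubini_G leb f y))).
  move=> y _; congr fine; rewrite /fubini_G [RHS]integral_mkcond.
  apply: eq_integral => x _; rewrite /f /patch; congr (if _ then _ else _).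
  by apply/idP/idP; rewrite !inE /=; [case|].
by apply: measurableT_comp mG.
Qed.

Lemma measurable_slice_y (J : set R) (g : mplane R -> R) : measurable J ->
  measurable_fun setT g -> (forall p, 0 <= g p) ->
  measurable_fun setT (slice_y J g).
Proof.
move=> mJ mg g0; rewrite /slice_y /Rintegral.
have mIT := measurable_rect (@measurableT _ (measurableTypeR R)) mJ.
pose f := (fun p : mplane R => (g p)%:E) \_ (setT `*` J).
have mf : measurable_fun setT f.
  apply/(measurable_restrictT _ _).1 => //; apply: measurable_funTS.
  exact/measurable_EFinP.
have f0 p : (0 <= f p)%E by apply: erestrict_ge0 => q _; rewrite lee_fin.
have := @measurable_fun_fubini_tonelli_F _ _ _ _ R leb f mf f0.
move=> mG; apply: (eq_measurable_fun (fun x => fine (fubini_F leb f x))).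
  move=> x _; congr fine; rewrite /fubini_F [RHS]integral_mkcond.
  apply: eq_integral => y _; rewrite /f /patch; congr (if _ then _ else _).
  by apply/idP/idP; rewrite !inE /=; [case|].
by apply: measurableT_comp mG.
Qed.

Section Bounded.
Variables (I J : set R) (h : R).
Hypotheses (mI : measurable I) (mJ : measurable J) (h0 : 0 < h).
Hypotheses (lI : leb I = h%:E) (lJ : leb J = h%:E).
Let q : set (mplane R) := I `*` J.

Let mq : measurable q. Proof. exact: measurable_rect. Qed.
Let lq : leb2 q = (h * h)%:E. Proof. by rewrite lebesgue2_rect// lI lJ. Qed.

Let sq (f : mplane R -> R) (M : R) : measurable_fun setT f -> (forall p, `|f p| <= M) -> sqint leb2 q f.
Proof.
move=> mf bf; have fq : (leb2 q < +oo)%E by rewrite lq ltry.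
exact: (bounded_sqint mq fq (measurable_funTS mf) (fun p _ => bf p)).
Qed.

Let bounded_int1 (K : set R) (g : R -> R) (M : R) : measurable K -> leb K = h%:E ->
  measurable_fun K g -> (forall x, `|g x| <= M) -> leb.-integrable K (EFin \o g).
Proof.
move=> mK lK mg bg; have fK : (leb K < +oo)%E by rewrite lK ltry.
exact: (@bounded_integrable _ _ R leb _ mK _ M fK mg (fun x _ => bg x)).
Qed.

Let int1_bound (K : set R) (g : R -> R) (M : R) : measurable K -> leb K = h%:E ->
  measurable_fun K g -> (forall x, 0 <= g x <= M) -> 0 <= \int[leb]_(x in K) g x <= M * h.
Proof.
move=> mK lK mg bg; rewrite Rintegral_ge0/=; last by move=> x _; case/andP: (bg x).
have i1 := @bounded_int1 K g M mK lK mg.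
have -> : M * h = \int[leb]_(x in K) (fun=> M) x.
  by rewrite Rintegral_cst//; congr (_ * _); exact: (esym (congr1 fine lK)).
apply: le_Rintegral => //.
- by apply: i1 => x; case/andP: (bg x) => ? ?; rewrite ger0_norm.
- apply: (@bounded_int1 K _ `|M|) => //.
- by move=> x _; case/andP: (bg x).
Qed.

Lemma slice_x_bound (g : mplane R -> R) (M : R) : measurable_fun setT g -> (forall p, 0 <= g p <= M) ->
  forall y, 0 <= slice_x I g y <= M * h.
Proof. by move=> mg bg y; apply: int1_bound => //; exact: slice_measurable1. Qed.

Lemma slice_y_bound (g : mplane R -> R) (M : R) : measurable_fun setT g -> (forall p, 0 <= g p <= M) ->
  forall x, 0 <= slice_y J g x <= M * h.
Proof. by move=> mg bg y; apply: int1_bound => //; exact: slice_measurable2. Qed.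

Lemma integral_slice_x (g : mplane R -> R) (M : R) : measurable_fun setT g -> (forall p, 0 <= g p <= M) ->
  ip leb2 q (fun p => slice_x I g p.2) (cst 1) = h * ip leb2 q g (cst 1).
Proof.
move=> mg bg; have g0 p : 0 <= g p by case/andP: (bg p).
have mA := measurable_slice_x mI mg g0.
have A0 y : 0 <= slice_x I g y by case/andP: (slice_x_bound mg bg y).
rewrite !ip1E.
rewrite /Rintegral integral_rect_x//; last 2 first.
- by apply/measurable_EFinP; exact: (measurableT_comp mA measurable_snd).
- by move=> p; rewrite lee_fin.
rewrite /=; under eq_integral do rewrite integral_cst// [X in (_ * X)%E](_ : _ = h%:E)// muleC.
rewrite (ge0_integralZl_EFin leb mJ _ _ (ltW h0)); [|by move=> y _; rewrite lee_fin|].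
  2: by apply/measurable_EFinP; exact: measurable_funTS.
rewrite integral_rect_x//; last exact/measurable_EFinP.
have -> : (\int[leb]_(y in J) \int[leb]_(x in I) (g (x, y))%:E =
    \int[leb]_(y in J) (slice_x I g y)%:E)%E.
  apply: eq_integral => y _; rewrite /slice_x /Rintegral fineK//.
  apply: integrable_fin_num => //; apply: (@bounded_int1 I _ M) => //; first exact: slice_measurable1.
  by move=> x; case/andP: (bg (x, y)) => ? ?; rewrite ger0_norm.
rewrite fineM// integrable_fin_num//.
apply: (@bounded_int1 J _ (M * h)) => //; first exact: measurable_funTS.
by move=> y; case/andP: (slice_x_bound mg bg y) => ? ?; rewrite ger0_norm.
Qed.

Lemma integral_slice_y (g : mplane R -> R) (M : R) : measurable_fun setT g -> (forall p, 0 <= g p <= M) ->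
  ip leb2 q (fun p => slice_y J g p.1) (cst 1) = h * ip leb2 q g (cst 1).
Proof.
move=> mg bg; have g0 p : 0 <= g p by case/andP: (bg p).
have mA := measurable_slice_y mJ mg g0.
have A0 y : 0 <= slice_y J g y by case/andP: (slice_y_bound mg bg y).
rewrite !ip1E.
rewrite /Rintegral integral_rect_y//; last 2 first.
- by apply/measurable_EFinP; exact: (measurableT_comp mA measurable_fst).
- by move=> p; rewrite lee_fin.
rewrite /=; under eq_integral do rewrite integral_cst// [X in (_ * X)%E](_ : _ = h%:E)// muleC.
rewrite (ge0_integralZl_EFin leb mI _ _ (ltW h0)); [|by move=> y _; rewrite lee_fin|].
  2: by apply/measurable_EFinP; exact: measurable_funTS.
rewrite integral_rect_y//; last exact/measurable_EFinP.
have -> : (\int[leb]_(x in I) \int[leb]_(y in J) (g (x, y))%:E =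
    \int[leb]_(x in I) (slice_y J g x)%:E)%E.
  apply: eq_integral => x _; rewrite /slice_y /Rintegral fineK//.
  apply: integrable_fin_num => //; apply: (@bounded_int1 J _ M) => //; first exact: slice_measurable2.
  by move=> y; case/andP: (bg (x, y)) => ? ?; rewrite ger0_norm.
rewrite fineM// integrable_fin_num//.
apply: (@bounded_int1 I _ (M * h)) => //; first exact: measurable_funTS.
by move=> y; case/andP: (slice_y_bound mg bg y) => ? ?; rewrite ger0_norm.
Qed.

Let ip11 : ip leb2 q (cst 1) (cst 1) = h * h.
Proof.
rewrite ip1E.
by rewrite Rintegral_cst// mul1r; exact: (congr1 fine lq).
Qed.

Let ip_le f g : sqint leb2 q f -> sqint leb2 q g -> (forall p, q p -> f p <= g p) ->
  ip leb2 q f (cst 1) <= ip leb2 q g (cst 1).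
Proof.
move=> sf sg fg; have s1 := @sq (cst 1) 1 (measurable_cst _) (fun=> ltac:(by rewrite normr1)).
rewrite /ip; apply: le_Rintegral => //; try exact: sqint_mul.
by move=> p qp; rewrite !mulr1 fg.
Qed.

(** Two points [p] and [p'] of the square are joined by a horizontal and a
vertical segment, so [V p - V p'] is controlled by the slice integrals at the
two segments. Squaring and integrating in [p'], then in [p], gives the
inequality: a slice integral in one variable does not depend on that variable,
which costs a factor [h] only. The control of the increments is a hypothesis so
that [V] may be irregular across curves, as long as it is regular along
segments of the square. *)
Lemma cell_poincare (V Vx Vy : mplane R -> R) (M : R) :
  measurable_fun setT V -> measurable_fun setT Vx -> measurable_fun setT Vy ->
  (forall p, `|V p| <= M) -> (forall p, `|Vx p| <= M) -> (forall p, `|Vy p| <= M) ->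
  (forall y x x', J y -> I x -> I x' ->
     (V (x, y) - V (x', y)) ^+ 2 <= h * slice_x I (fun p => Vx p ^+ 2) y) ->
  (forall x y y', I x -> J y -> J y' ->
     (V (x, y) - V (x, y')) ^+ 2 <= h * slice_y J (fun p => Vy p ^+ 2) x) ->
  ip leb2 q V V <= (h^-1 * ip leb2 q V (cst 1)) ^+ 2 +
     h ^+ 2 * (ip leb2 q Vx Vx + ip leb2 q Vy Vy).
Proof.
move=> mV mVx mVy bV bVx bVy HX HY.
have sqb (f : mplane R -> R) : (forall p, `|f p| <= M) -> forall p, 0 <= f p ^+ 2 <= M ^+ 2.
  by move=> bf p; rewrite sqr_ge0 -(real_normK (num_real (f p))) ler_pXn2r ?nnegrE//;
    apply: le_trans (bf p).
have s1 := @sq (cst 1) 1 (measurable_cst _) (fun=> ltac:(by rewrite normr1)).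
have sV := sq mV bV; have sVx := sq mVx bVx; have sVy := sq mVy bVy.
have mVx2 : measurable_fun setT (fun p => Vx p ^+ 2) by exact: measurable_funX.
have mVy2 : measurable_fun setT (fun p => Vy p ^+ 2) by exact: measurable_funX.
pose A (p : mplane R) := slice_x I (fun p => Vx p ^+ 2) p.2.
pose B (p : mplane R) := slice_y J (fun p => Vy p ^+ 2) p.1.
have sA : sqint leb2 q A.
  apply: (@sq _ (M ^+ 2 * h)).
    by apply: (measurableT_comp _ measurable_snd); apply: measurable_slice_x => // p; exact: sqr_ge0.
  by move=> p; case/andP: (slice_x_bound mVx2 (sqb _ bVx) p.2) => ? ?; rewrite ger0_norm.
have sB : sqint leb2 q B.
  apply: (@sq _ (M ^+ 2 * h)).
    by apply: (measurableT_comp _ measurable_fst); apply: measurable_slice_y => // p; exact: sqr_ge0.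
  by move=> p; case/andP: (slice_y_bound mVy2 (sqb _ bVy) p.1) => ? ?; rewrite ger0_norm.
have iA : ip leb2 q A (cst 1) = h * ip leb2 q Vx Vx.
  by rewrite (integral_slice_x mVx2 (sqb _ bVx)); congr (_ * _); apply: eq_ip => p _; rewrite mulr1.
have iB : ip leb2 q B (cst 1) = h * ip leb2 q Vy Vy.
  by rewrite (integral_slice_y mVy2 (sqb _ bVy)); congr (_ * _); apply: eq_ip => p _; rewrite mulr1.
set N := ip leb2 q V V; set S := ip leb2 q V (cst 1).
set X := ip leb2 q Vx Vx in iA *; set Y := ip leb2 q Vy Vy in iB *.
have sVV : sqint leb2 q (fun p => V p ^+ 2).
  apply: (@sq _ (M ^+ 2)); first exact: measurable_funX.
  by move=> p; rewrite normrX; case/andP: (sqb _ bV p) => _; rewrite -(real_normK (num_real (V p))).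
(* Integration in [p'], the point [p] being fixed. *)
have step1 p : q p -> h * h * V p ^+ 2 + (- 2 * S) * V p + N <= (2 * h ^+ 3) * A p + 2 * h ^+ 2 * Y.
  move=> [/= Ip Jp].
  have -> : h * h * V p ^+ 2 + (- 2 * S) * V p + N =
     ip leb2 q (fun z => V p * cst 1 z + (-1) * V z) (fun z => V p * cst 1 z + (-1) * V z).
    by rewrite ip_quad// ip11 (ipC _ _ (cst 1)) -/S -/N; ring.
  have -> : (2 * h ^+ 3) * A p + 2 * h ^+ 2 * Y =
     ip leb2 q (fun z => (2 * h * A p) * cst 1 z + (2 * h) * B z) (cst 1).
    by rewrite ip_linl// ip11 iB; ring.
  have sd : sqint leb2 q (fun z => V p * cst 1 z + (-1) * V z) by exact: sqint_lin.
  have -> : ip leb2 q (fun z => V p * cst 1 z + (-1) * V z) (fun z => V p * cst 1 z + (-1) * V z) =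
    ip leb2 q (fun z => (V p * cst 1 z + (-1) * V z) ^+ 2) (cst 1).
    by apply: eq_ip => z _ /=; ring.
  apply: ip_le; last 1 first.
  - move=> [x' y'] [/= Ix Jy]; case: p Ip Jp sd => x y /= Ip Jp _.
    have hx := HX y x x' Jp Ip Ix; have hy := HY x' y y' Ix Jp Jy.
    rewrite -/(A (x, y)) in hx; rewrite -/(B (x', y')) in hy.
    rewrite mulr1 mulN1r mulr1.
    have -> : V (x, y) - V (x', y') = (V (x, y) - V (x', y)) + (V (x', y) - V (x', y')) by ring.
    have := sqr_ge0 ((V (x, y) - V (x', y)) - (V (x', y) - V (x', y'))).
    move: (V (x, y) - V (x', y)) (V (x', y) - V (x', y')) hx hy => a b; nra.
  - apply: (@sq _ ((M + M) ^+ 2)).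
      by apply: measurable_funX; apply: measurable_funD => //; apply: measurable_funM.
    have M0 : 0 <= M by apply: le_trans (bV p).
    move=> z; rewrite normrX ler_pXn2r ?nnegrE ?addr_ge0//.
    by rewrite /= mulr1 mulN1r; apply: le_trans (ler_normB _ _) _; exact: lerD.
  - exact: sqint_lin.
have : ip leb2 q (fun p => 1 * ((h * h) * V p ^+ 2 + (- 2 * S) * V p) + N * cst 1 p) (cst 1) <=
       ip leb2 q (fun p => (2 * h ^+ 3) * A p + (2 * h ^+ 2 * Y) * cst 1 p) (cst 1).
  apply: ip_le; [|exact: sqint_lin|by move=> p qp /=; rewrite !mulr1 mul1r; exact: step1].
  by apply: sqint_lin => //; exact: sqint_lin.
have s3 := sqint_lin mq (h * h) (- 2 * S) sVV sV.
rewrite (ip_linl mq _ _ s3 s1 s1) (ip_linl mq _ _ sVV sV s1) (ip_linl mq _ _ sA s1 s1) ip11 iA -/S.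
have -> : ip leb2 q (fun p => V p ^+ 2) (cst 1) = N.
  by apply: eq_ip => p _; rewrite mulr1 expr2.
move=> H; have hh : 0 < 2 * h ^+ 2 by rewrite mulr_gt0 ?exprn_gt0.
rewrite -(ler_pM2l hh).
have -> : 2 * h ^+ 2 * ((h^-1 * S) ^+ 2 + h ^+ 2 * (X + Y)) = 2 * S ^+ 2 + 2 * h ^+ 4 * (X + Y).
  by field; rewrite gt_eqF.
move: H; lra.
Qed.

End Bounded.
End CellPoincare.

(** * Continuity and partial derivatives *)

Section Continuity.
Context {R : realType} {T : topologicalType}.
Implicit Types f g : T -> R.

Lemma cts_cst (c : R) : continuous (fun _ : T => c).
Proof. by move=> x; exact: cvg_cst. Qed.

Lemma cts_fst : continuous (fun p : R * R => p.1).
Proof. by move=> p; exact: cvg_fst. Qed.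

Lemma cts_snd : continuous (fun p : R * R => p.2).
Proof. by move=> p; exact: cvg_snd. Qed.

Lemma ctsD f g : continuous f -> continuous g -> continuous (fun x => f x + g x).
Proof. by move=> cf cg x; apply: cvgD; [exact: cf|exact: cg]. Qed.

Lemma ctsN f : continuous f -> continuous (fun x => - f x).
Proof. by move=> cf x; apply: cvgN; exact: cf. Qed.

Lemma ctsM f g : continuous f -> continuous g -> continuous (fun x => f x * g x).
Proof. by move=> cf cg x; apply: cvgM; [exact: cf|exact: cg]. Qed.

Lemma ctsX f n : continuous f -> continuous (fun x => f x ^+ n).
Proof.
move=> cf; elim: n => [|n IH].
  by under eq_fun do rewrite expr0; exact: cts_cst.
by under eq_fun do rewrite exprS; exact: ctsM.
Qed.

Lemma ctsV f : (forall x, f x != 0) -> continuous f -> continuous (fun x => (f x)^-1).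
Proof. by move=> f0 cf x; apply: cvgV; [exact: f0|exact: cf]. Qed.

Lemma cts_comp (h : R -> R) f : continuous h -> continuous f -> continuous (fun x => h (f x)).
Proof. by move=> ch cf x; apply: continuous_comp; [exact: cf|exact: ch]. Qed.

Lemma cts_max f g : continuous f -> continuous g -> continuous (fun x => Num.max (f x) (g x)).
Proof. by move=> cf cg x; apply: continuous_max; [exact: cf|exact: cg]. Qed.

End Continuity.

(** Continuity of polynomial expressions, directed by the head operation; it
leaves the atoms. *)
Ltac cts := lazymatch goal with
  | |- continuous (fun _ => ?c) => exact: cts_cst
  | |- continuous (fun p => p.1) => exact: cts_fst
  | |- continuous (fun p => p.2) => exact: cts_snd
  | |- continuous (fun p => @?f p + @?g p) => refine (@ctsD _ _ f g _ _); cts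
  | |- continuous (fun p => - @?f p) => refine (@ctsN _ _ f _); cts
  | |- continuous (fun p => @?f p * @?g p) => refine (@ctsM _ _ f g _ _); cts
  | |- continuous (fun p => @?f p ^+ ?n) => refine (@ctsX _ _ f n _); cts
  | |- continuous (fun p => Num.max (@?f p) (@?g p)) => refine (@cts_max _ _ f g _ _); cts
  | |- _ => first [ assumption | idtac ]
  end.

Section Calculus.
Context {R : realType}.

Lemma cts_slice1 (f : R * R -> R) (y : R) : continuous f -> continuous (fun x : R => f (x,y)).
Proof.
move=> cf x A /cf [[B C] /= [hB hC] H].
by apply: filterS hB => z Bz; apply: (H (z, y)); split => //=; exact: nbhs_singleton hC.
Qed.

Lemma cts_slice2 (f : R * R -> R) (x : R) : continuous f -> continuous (fun y : R => f (x,y)).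
Proof.
move=> cf y A /cf [[B C] /= [hB hC] H].
by apply: filterS hC => z Cz; apply: (H (x, z)); split => //=; exact: nbhs_singleton hB.
Qed.

(** The direction is fixed to [1] and the statement is an ordinary proposition,
so that the rules below can be composed as terms. *)
Definition has_deriv (f : R -> R) (x a : R) : Prop := is_derive x (1 : R) f a.

Lemma has_deriv_eq f x a b : has_deriv f x a -> a = b -> has_deriv f x b.
Proof. by move=> h <-. Qed.

Lemma has_deriv_cst c x : has_deriv (fun=> c) x 0.
Proof. exact: is_derive_cst. Qed.

Lemma has_deriv_id x : has_deriv (fun t => t) x 1.
Proof. exact: is_derive_id. Qed.

Lemma has_derivD f g x a b : has_deriv f x a -> has_deriv g x b ->
  has_deriv (fun t => f t + g t) x (a + b).
Proof. by move=> hf hg; exact: is_deriveD. Qed.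

Lemma has_derivN f x a : has_deriv f x a -> has_deriv (fun t => - f t) x (- a).
Proof. by move=> hf; exact: is_deriveN. Qed.

Lemma has_derivM f g x a b : has_deriv f x a -> has_deriv g x b ->
  has_deriv (fun t => f t * g t) x (a * g x + f x * b).
Proof.
move=> hf hg; have := is_deriveM hf hg; rewrite /has_deriv => h.
by apply: is_derive_eq h _; rewrite /GRing.scale /= addrC mulrC.
Qed.

Lemma has_deriv_comp (f g : R -> R) x a b : has_deriv g x b -> has_deriv f (g x) a ->
  has_deriv (fun t => f (g t)) x (a * b).
Proof.
move=> hg hf; have := @is_derive1_comp _ f g x a b hf hg.
by move=> h; apply: is_derive_eq h _; rewrite mulrC.
Qed.

Lemma has_deriv_continuous f x a : has_deriv f x a -> {for x, continuous f}.
Proof. by move=> [h _]; apply: differentiable_continuous; exact/derivable1_diffP. Qed.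

Lemma has_derivV f x a : f x != 0 -> has_deriv f x a ->
  has_deriv (fun t => (f t)^-1) x (- a / f x ^+ 2).
Proof.
move=> f0 hf; have := is_deriveV f0 hf => h.
by apply: is_derive_eq h _; rewrite /GRing.scale /=; field.
Qed.

Lemma has_deriv_near f g x a : (\forall t \near x, f t = g t) ->
  has_deriv f x a -> has_deriv g x a.
Proof. by move=> e h; apply: near_eq_is_derive e h. Qed.

Lemma has_deriv_unique f x a b : has_deriv f x a -> has_deriv f x b -> a = b.
Proof. by move=> [_ <-] [_ <-]. Qed.

Lemma has_derivX2 f x a : has_deriv f x a -> has_deriv (fun t => f t ^+ 2) x (2 * f x * a).
Proof.
move=> h; have := has_derivM h h; move/has_deriv_eq; apply; ring.
Qed.

(** The sections of the fields to be integrated are differentiable inside the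
quarter disc only. *)
Lemma FTC2_open (F f : R -> R) (a b : R) : a < b ->
  {within `[a, b], continuous f} -> {within `[a, b], continuous F} ->
  (forall x, a < x < b -> has_deriv F x (f x)) ->
  (\int[@lebesgue_measure R]_(x in `[a, b]) (f x)%:E = (F b - F a)%:E)%E.
Proof.
move=> ab cf cF dF; rewrite EFinB; apply: continuous_FTC2 => //.
  have /(continuous_within_itvP _ ab)[_ ca cb] := cF; split => //.
  by move=> x; rewrite in_itv/= => /dF [].
by move=> x; rewrite in_itv/= => /dF [_ <-]; rewrite derive1E.
Qed.

Lemma C1_partial1 (v : R * R -> R) (p : R * R) : C1 v ->
  has_deriv (fun t => v (t, p.2)) p.1 (partial1 v p).
Proof. by move=> [h _ _ _]; rewrite /partial1 derive1E; exact: derivableP. Qed.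

Lemma C1_partial2 (v : R * R -> R) (p : R * R) : C1 v ->
  has_deriv (fun t => v (p.1, t)) p.2 (partial2 v p).
Proof. by move=> [_ h _ _]; rewrite /partial2 derive1E; exact: derivableP. Qed.

Lemma C1_of_partials (v a b : R * R -> R) :
  (forall p, has_deriv (fun t => v (t, p.2)) p.1 (a p)) ->
  (forall p, has_deriv (fun t => v (p.1, t)) p.2 (b p)) ->
  continuous a -> continuous b ->
  [/\ C1 v, partial1 v = a & partial2 v = b].
Proof.
move=> ha hb ca cb.
have e1 : partial1 v = a.
  by apply/funext => p; rewrite /partial1 derive1E; case: (ha p).
have e2 : partial2 v = b.
  by apply/funext => p; rewrite /partial2 derive1E; case: (hb p).
by split => //; split; rewrite ?e1 ?e2// => p; [case: (ha p)|case: (hb p)].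
Qed.

Lemma mean_value (F f : R -> R) (x y M : R) :
  (forall t, Num.min x y <= t <= Num.max x y -> has_deriv F t (f t)) ->
  (forall t, Num.min x y <= t <= Num.max x y -> `|f t| <= M) ->
  `|F y - F x| <= M * `|y - x|.
Proof.
wlog xy : x y / x <= y => [W|].
  have [xy|yx] : x <= y \/ y <= x by apply/orP; exact: le_total.
    exact: W.
  move=> dF bf; rewrite distrC (distrC y); apply: W => // t.
    by rewrite minC maxC; exact: dF.
  by rewrite minC maxC; exact: bf.
rewrite (min_idPl xy) (max_idPr xy) => dF bf.
case: (@MVT_segment R F f x y xy).
- by move=> t; rewrite in_itv/= => /andP[xt ty]; apply: dF; rewrite !ltW.
- apply: continuous_in_subspaceT => t; rewrite inE /= in_itv/= => txy.
  exact: has_deriv_continuous (dF t txy).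
move=> c; rewrite in_itv/= => xc ->; rewrite normrM ler_wpM2r//; exact: bf.
Qed.

Lemma near_pair (p : R * R) (e : R) : 0 < e ->
  \forall q \near p, `|p.1 - q.1| < e /\ `|p.2 - q.2| < e.
Proof. by move=> e0; apply/nbhs_ballP; exists e => // q []. Qed.

Lemma segment_dist (x y t : R) : Num.min y x <= t <= Num.max y x -> `|x - t| <= `|x - y|.
Proof.
rewrite ge_min le_max => /andP[/orP[a|a] /orP[b|b]]; first [
  by rewrite (@le_anti _ _ t y) ?a ?b | by rewrite (@le_anti _ _ t x) ?a ?b // subrr normr0 |
  by rewrite !ler0_norm; lra | by rewrite !ger0_norm; lra ].
Qed.

(** The partial derivatives are locally bounded, and two nearby points are
joined by two segments parallel to the axes, on which the mean value inequality
applies. *)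
Lemma C1_continuous (v : R * R -> R) : C1 v -> continuous v.
Proof.
move=> Cv p; have [_ _ c1 c2] := Cv.
have hb (f : R * R -> R) : continuous f -> exists M e : R, [/\ 0 < M, 0 < e &
    forall q, `|p.1 - q.1| < e -> `|p.2 - q.2| < e -> `|f q| <= M].
  move=> cf; have : \forall q \near p, `|f p - f q| < 1.
    by have /cvgrPdist_lt := cf p; apply.
  move=> /nbhs_ballP[e /= e0 H]; exists (`|f p| + 1), e; split => //.
  move=> q q1 q2; have /= := H q (conj q1 q2); rewrite distrC => h.
  by rewrite -(subrK (f p) (f q)) (le_trans (ler_normD _ _))// addrC lerD2l ltW.
have [M1 [e1 [M10 e10 H1]]] := hb _ c1.
have [M2 [e2 [M20 e20 H2]]] := hb _ c2.
apply/cvgrPdist_le => e e0.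
near=> q.
have q1 : `|p.1 - q.1| < Num.min e1 e2.
  near: q; have m0 : 0 < Num.min e1 e2 by rewrite lt_min e10.
  by apply: filterS (near_pair p m0) => q [].
have q2 : `|p.2 - q.2| < Num.min e1 e2.
  near: q; have m0 : 0 < Num.min e1 e2 by rewrite lt_min e10.
  by apply: filterS (near_pair p m0) => q [].
have q3 : `|p.1 - q.1| < e / (M1 + M2) /\ `|p.2 - q.2| < e / (M1 + M2).
  by near: q; apply: near_pair; rewrite divr_gt0// addr_gt0.
move: q1 q2; rewrite !lt_min => /andP[q11 q12] /andP[q21 q22].
have A : `|v (p.1, q.2) - v (q.1, q.2)| <= M1 * `|p.1 - q.1|.
  apply: (mean_value (F := fun t => v (t, q.2)) (f := fun t => partial1 v (t, q.2))) => t.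
    by move=> _; exact: (C1_partial1 (t, q.2) Cv).
  by move=> /segment_dist h; apply: H1 => //=; exact: le_lt_trans h q11.
have B : `|v (p.1, p.2) - v (p.1, q.2)| <= M2 * `|p.2 - q.2|.
  apply: (mean_value (F := fun t => v (p.1, t)) (f := fun t => partial2 v (p.1, t))) => t.
    by move=> _; exact: (C1_partial2 (p.1, t) Cv).
  move=> /segment_dist h; apply: H2 => //=; first by rewrite subrr normr0.
  exact: le_lt_trans h q22.
have -> : v p - v q = (v (p.1, p.2) - v (p.1, q.2)) + (v (p.1, q.2) - v (q.1, q.2)).
  by rewrite addrA subrK -!surjective_pairing.
apply: le_trans (ler_normD _ _) _; apply: le_trans (lerD B A) _.
have M0 : 0 < M1 + M2 by rewrite addr_gt0.
move: q3 => [/ltW q31 /ltW q32].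
apply: (@le_trans _ _ (M2 * (e / (M1 + M2)) + M1 * (e / (M1 + M2)))).
  by apply: lerD; rewrite ler_wpM2l// ltW.
by rewrite -mulrDl addrC mulrCA mulfV ?mulr1// gt_eqF.
Unshelve. all: end_near.
Qed.

Lemma C1_lin (f g : R * R -> R) (a b : R) : C1 f -> C1 g ->
  [/\ C1 (fun x => a * f x + b * g x),
   partial1 (fun x => a * f x + b * g x) = (fun x => a * partial1 f x + b * partial1 g x) &
   partial2 (fun x => a * f x + b * g x) = (fun x => a * partial2 f x + b * partial2 g x)].
Proof.
move=> Cf Cg; have [_ _ f1 f2] := Cf; have [_ _ g1 g2] := Cg.
apply: C1_of_partials => p.
- apply: (has_deriv_eq (has_derivD (has_derivM (has_deriv_cst a _) (C1_partial1 p Cf))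
    (has_derivM (has_deriv_cst b _) (C1_partial1 p Cg)))); ring.
- apply: (has_deriv_eq (has_derivD (has_derivM (has_deriv_cst a _) (C1_partial2 p Cf))
    (has_derivM (has_deriv_cst b _) (C1_partial2 p Cg)))); ring.
- by apply: cvgD; apply: cvgM; try exact: cvg_cst; [exact: f1|exact: g1].
- by apply: cvgD; apply: cvgM; try exact: cvg_cst; [exact: f2|exact: g2].
Qed.

Lemma near_slice1 (P : R * R -> Prop) (p : R * R) : (\forall q \near p, P q) ->
  \forall t \near p.1, P (t, p.2).
Proof.
case=> -[A B] /= [nA nB] H; apply: filterS nA => t At; apply: (H (t, p.2)).
by split => //=; exact: nbhs_singleton nB.
Qed.

Lemma near_slice2 (P : R * R -> Prop) (p : R * R) : (\forall q \near p, P q) ->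
  \forall t \near p.2, P (p.1, t).
Proof.
case=> -[A B] /= [nA nB] H; apply: filterS nB => t At; apply: (H (p.1, t)).
by split => //=; exact: nbhs_singleton nA.
Qed.

Lemma partials_near0 (v : R * R -> R) (p : R * R) : C1 v ->
  (\forall q \near p, v q = 0) -> [/\ v p = 0, partial1 v p = 0 & partial2 v p = 0].
Proof.
move=> Cv n; split; first exact: nbhs_singleton n.
- apply: has_deriv_unique (C1_partial1 p Cv) _.
  apply: has_deriv_near (has_deriv_cst 0 _).
  by apply: filterS (near_slice1 n) => t ->.
- apply: has_deriv_unique (C1_partial2 p Cv) _.
  apply: has_deriv_near (has_deriv_cst 0 _).
  by apply: filterS (near_slice2 n) => t ->.
Qed.

End Calculus.

(** * The quarter disc and the crack in Cartesian coordinates *)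

Section Quarter.
Context {R : realType}.
Variable R2 : R.
Hypothesis R20 : 0 < R2.

Definition sqn (p : R * R) : R := p.1 ^+ 2 + p.2 ^+ 2.

Definition quarter : set (R * R) := [set p | [/\ 0 < p.1, 0 < p.2 & sqn p < R2 ^+ 2]].
Definition cquarter : set (R * R) := [set p | [/\ 0 <= p.1, 0 <= p.2 & sqn p <= R2 ^+ 2]].

Lemma sqn_continuous : continuous sqn.
Proof. by rewrite /sqn; cts. Qed.

Lemma open_fun_gt (f : R * R -> R) a : continuous f -> open [set p | a < f p].
Proof. by move=> cf; apply: (@open_comp _ _ f [set x | a < x]) => [p _|]; [exact: cf|exact: open_gt]. Qed.

Lemma open_fun_lt (f : R * R -> R) a : continuous f -> open [set p | f p < a].
Proof. by move=> cf; apply: (@open_comp _ _ f [set x | x < a]) => [p _|]; [exact: cf|exact: open_lt]. Qed.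

Lemma closed_fun_le (f : R * R -> R) a : continuous f -> closed [set p | f p <= a].
Proof. by move=> cf; apply: (@closed_comp _ _ f [set x | x <= a]) => [p _|]; [exact: cf|exact: closed_le]. Qed.

Lemma closed_fun_ge (f : R * R -> R) a : continuous f -> closed [set p | a <= f p].
Proof. by move=> cf; apply: (@closed_comp _ _ f [set x | a <= x]) => [p _|]; [exact: cf|exact: closed_ge]. Qed.

Let c_fst : continuous (fun p : R * R => p.1). Proof. exact: cts_fst. Qed.
Let c_snd : continuous (fun p : R * R => p.2). Proof. exact: cts_snd. Qed.

Lemma open_quarter : open quarter.
Proof.
have -> : quarter = [set p | 0 < p.1] `&` [set p | 0 < p.2] `&` [set p | sqn p < R2 ^+ 2].
  by apply/seteqP; split => p; [case|case => -[]].
apply: openI; first apply: openI; [exact: open_fun_gt..|].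
by apply: open_fun_lt; exact: sqn_continuous.
Qed.

Lemma closed_cquarter : closed cquarter.
Proof.
have -> : cquarter = [set p | 0 <= p.1] `&` [set p | 0 <= p.2] `&` [set p | sqn p <= R2 ^+ 2].
  by apply/seteqP; split => p; [case|case => -[]].
apply: closedI; first apply: closedI; [exact: closed_fun_ge..|].
by apply: closed_fun_le; exact: sqn_continuous.
Qed.

Lemma quarter_sub : quarter `<=` cquarter.
Proof. by move=> p [a b c]; split; exact: ltW. Qed.

Lemma cquarter_bound p : cquarter p -> [/\ 0 <= p.1 <= R2 & 0 <= p.2 <= R2].
Proof.
case=> x0 y0; rewrite /sqn => s; rewrite x0 y0 /=; split.
  by rewrite -(@ler_pXn2r _ 2) ?nnegrE ?(ltW R20)//; have := sqr_ge0 p.2; lra.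
by rewrite -(@ler_pXn2r _ 2) ?nnegrE ?(ltW R20)//; have := sqr_ge0 p.1; lra.
Qed.

Lemma compact_cquarter : compact cquarter.
Proof.
apply: (@subclosed_compact _ _ (`[0, R2] `*` `[0, R2])).
- exact: closed_cquarter.
- by apply: compact_setX; exact: segment_compact.
- by move=> p /cquarter_bound[a b]; split; rewrite /= in_itv.
Qed.

End Quarter.

Section Geometry.
Context {R : realType}.
Variables (R1 R2 eps : R).
Hypotheses (hR1 : 0 < R1) (hR12 : R1 < R2) (he0 : 0 < eps) (he1 : eps < pi / 2).

(** The end point of the crack on the axis [theta = pi / 2] is included, so that
this set is closed; the quarter disc removes it again. *)
Definition crack : set (R * R) := [set p | sqn p = R1 ^+ 2 /\ R1 * sin eps <= p.2].

Local Notation quarter := (quarter R2).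
Local Notation cquarter := (cquarter R2).
Local Notation Om := (cracked_sector R1 R2 eps).
Local Notation D := (boundary Om `\` neumann_radius R2).

Let R20 : 0 < R2. Proof. exact: lt_trans hR12. Qed.
Let ph0 : 0 < pi / 2 :> R. Proof. by rewrite divr_gt0// pi_gt0. Qed.

Let c_fst : continuous (fun p : R * R => p.1). Proof. exact: cts_fst. Qed.
Let c_snd : continuous (fun p : R * R => p.2). Proof. exact: cts_snd. Qed.

Lemma sqn_polar (rt : R * R) : sqn (polar rt) = rt.1 ^+ 2.
Proof. by rewrite /sqn /polar /= !exprMn -mulrDr cos2Dsin2 mulr1. Qed.

Lemma polar_coord (p : R * R) : 0 < p.1 -> 0 < p.2 -> exists r t : R,
  [/\ 0 < r, r ^+ 2 = sqn p, 0 < t < pi / 2 & polar (r, t) = p].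
Proof.
case: p => x y /= x0 y0.
have s0 : 0 < sqn (x, y) by rewrite /sqn /= addr_gt0 ?exprn_gt0.
pose r := Num.sqrt (sqn (x, y)).
have r0 : 0 < r by rewrite sqrtr_gt0.
have r2 : r ^+ 2 = x ^+ 2 + y ^+ 2 by rewrite sqr_sqrtr ?ltW.
have yr : y < r.
  by rewrite -(@ltr_pXn2r _ 2) ?nnegrE ?(ltW y0) ?(ltW r0)// r2 ltrDr exprn_gt0.
have q0 : 0 < y / r by rewrite divr_gt0.
have q1 : y / r < 1 by rewrite ltr_pdivrMr// mul1r.
have qI : -1 <= y / r <= 1 by apply/andP; split; lra.
have sa : sin (asin (y / r)) = y / r by apply: asinK; rewrite in_itv.
have ca : cos (asin (y / r)) = x / r.
  rewrite cos_asin//; have -> : 1 - (y / r) ^+ 2 = (x / r) ^+ 2.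
    rewrite !exprMn exprVn r2; field; rewrite -r2; exact: lt0r_neq0 (exprn_gt0 _ r0).
  by rewrite sqrtr_sqr ger0_norm// divr_ge0// ltW.
exists r, (asin (y / r)); split=> //.
  have ph := ph0; rewrite asin_ltpi2 ?andbT; last by case/andP: qI => ->.
  rewrite -ltr_sin ?sin0 ?sa// in_itv /= ?asin_geNpi2 ?asin_lepi2//.
  by apply/andP; split; lra.
by rewrite /polar /= sa ca; congr pair; rewrite mulrCA mulfV ?mulr1// gt_eqF.
Qed.

Let sin_lt (a b : R) : 0 < a < pi / 2 -> 0 < b < pi / 2 -> (sin a < sin b) = (a < b).
Proof.
have ph := ph0; move=> /andP[a0 a1] /andP[b0 b1].
by rewrite ltr_sin// in_itv/=; apply/andP; split; lra.
Qed.

(** Sine is increasing on the quarter circle, so [eps <= theta] reads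
[R1 * sin eps <= p.2] on the circle of radius [R1]. *)
Lemma OmE p : Om p <-> quarter p /\ ~ crack p.
Proof.
have ph := ph0.
split=> [[[r t]] [/= [/andP[r0 rR] /andP[t0 t1]] nc <-]|[[x0 y0 s] nc]].
  have ct : 0 < cos t by rewrite cos_gt0_pihalf//; apply/andP; split; lra.
  have st : 0 < sin t by rewrite sin_gt0_pihalf// t0.
  split; first split; rewrite /= ?mulr_gt0//.
    by rewrite sqn_polar /= ltr_pXn2r ?nnegrE ?(ltW r0) ?(ltW R20).
  move=> []; rewrite sqn_polar /= => /eqP.
  rewrite eqrXn2 ?(ltW r0) ?(ltW hR1)// => /eqP re; rewrite re ler_pM2l// => ht.
  apply: nc; split => //; apply/andP; split=> //; rewrite leNgt; apply/negP => te.
  by move: ht; rewrite leNgt sin_lt ?te ?t0 ?t1 ?he0.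
have [r [t [r0 r2 /andP[t0 t1] pe]]] := polar_coord x0 y0.
exists (r, t) => //; split.
  split; rewrite /= ?r0 ?t0 ?t1 ?andbT//=.
  by rewrite -(@ltr_pXn2r _ 2) ?nnegrE ?(ltW r0) ?(ltW R20)// r2.
move=> [/= re /andP[et _]]; apply: nc; split; first by rewrite -r2 re.
rewrite -pe /= re ler_pM2l//.
by rewrite leNgt sin_lt -?leNgt ?t0 ?he0.
Qed.

Lemma neumannE (p : R * R) : neumann_radius R2 p <-> 0 < p.1 < R2 /\ p.2 = 0.
Proof.
rewrite /neumann_radius /polar; split=> [[[r t] /= [rR ->] <-]|[pR p2]].
  by rewrite cos0 sin0 mulr1 mulr0.
by exists p => //=; rewrite p2 cos0 sin0 mulr1 mulr0 -p2 -surjective_pairing.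
Qed.

Lemma closed_crack : closed crack.
Proof.
have -> : crack = [set p | sqn p <= R1 ^+ 2] `&` [set p | R1 ^+ 2 <= sqn p] `&` [set p | R1 * sin eps <= p.2].
  apply/seteqP; split => p /=; first by move=> [-> ?]; rewrite lexx.
  by move=> [[a b] c]; split=> //; apply/eqP; rewrite eq_le a.
apply: closedI; first apply: closedI.
- by apply: closed_fun_le; exact: sqn_continuous.
- by apply: closed_fun_ge; exact: sqn_continuous.
- exact: closed_fun_ge.
Qed.

Lemma Om_setE : Om = quarter `\` crack.
Proof. by apply/seteqP; split => p /OmE. Qed.

Lemma open_Om : open Om.
Proof. by rewrite Om_setE setDE; apply: openI; [exact: open_quarter|exact: closed_openC closed_crack]. Qed.

(** A point of the closed quarter disc is moved slightly towards the interior,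
and then, if it has reached the crack, slightly towards the origin. *)
Lemma cquarter_closure : cquarter `<=` closure Om.
Proof.
move=> p Kp B /nbhs_ballP[e /= e0 He].
have [/andP[x0 xR] /andP[y0 yR]] := cquarter_bound R20 Kp; case: Kp => _ _ pR.
pose s := Num.min (1 / 2) (e / (4 * R2)).
have s0 : 0 < s by rewrite lt_min !divr_gt0// mulr_gt0.
have s1 : s <= 1 / 2 by rewrite ge_min lexx.
have s2 : s * (4 * R2) <= e.
  by rewrite -ler_pdivlMr ?mulr_gt0// ge_min lexx orbT.
pose q := ((1 - s) * p.1 + s * (R2 / 4), (1 - s) * p.2 + s * (R2 / 4)).
have sR : 0 < s * R2 by rewrite mulr_gt0.
have q10 : 0 < q.1 by rewrite /= ltr_wpDl ?mulr_ge0//; nra.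
have q20 : 0 < q.2 by rewrite /= ltr_wpDl ?mulr_ge0//; nra.
have q1R : q.1 <= R2 by rewrite /=; nra.
have q2R : q.2 <= R2 by rewrite /=; nra.
have qR : sqn q < R2 ^+ 2.
  rewrite /sqn /=; move: pR; rewrite /sqn => pR.
  have h1 : (1 - s) ^+ 2 * (p.1 ^+ 2 + p.2 ^+ 2) <= (1 - s) ^+ 2 * R2 ^+ 2.
    by rewrite ler_wpM2l ?sqr_ge0.
  have h2 : s * (1 - s) * R2 * (p.1 + p.2) <= s * (1 - s) * R2 * (2 * R2).
    by rewrite ler_wpM2l ?mulr_ge0//; lra.
  have h3 : 0 < s * (s * R2 ^+ 2) by rewrite !mulr_gt0// exprn_gt0.
  have h4 : s * (s * R2 ^+ 2) <= 1 / 2 * (s * R2 ^+ 2).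
    by rewrite ler_wpM2r// mulr_ge0 ?(ltW s0)// sqr_ge0.
  lra.
have dq : `|p.1 - q.1| <= s * R2 /\ `|p.2 - q.2| <= s * R2.
  by split; rewrite ler_norml /=; apply/andP; split; nra.
have [qc|qc] := pselect (crack q); last first.
  exists q; split; first exact/OmE.
  by apply: He; split => /=; [apply: le_lt_trans dq.1 _|apply: le_lt_trans dq.2 _]; lra.
clearbody q s.
pose q' := ((1 - s) * q.1, (1 - s) * q.2).
have s'0 : 0 < 1 - s by lra.
have e' : sqn q' = (1 - s) ^+ 2 * R1 ^+ 2.
  by rewrite -qc.1 /sqn /=; ring.
have lt' : sqn q' < R1 ^+ 2.
  rewrite e' gtr_pMl ?exprn_gt0// expr_lt1//; lra.
exists q'; split.
  apply/OmE; split; last by move=> [h _]; rewrite h ltxx in lt'.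
  by split; rewrite /= ?mulr_gt0//; apply: lt_trans lt' _; rewrite ltr_pXn2r ?nnegrE ?(ltW hR1) ?(ltW R20).
case: dq; rewrite !ler_norml => /andP[? ?] /andP[? ?].
have sq1 : s * q.1 <= s * R2 by rewrite ler_wpM2l// ltW.
have sq2 : s * q.2 <= s * R2 by rewrite ler_wpM2l// ltW.
have sq3 : 0 <= s * q.1 by rewrite mulr_ge0// ltW.
have sq4 : 0 <= s * q.2 by rewrite mulr_ge0// ltW.
by apply: He; split => /=; rewrite /ball /= ltr_norml; apply/andP; split; lra.
Qed.

Lemma closure_Om_sub : closure Om `<=` cquarter.
Proof.
have /closure_id -> := @closed_cquarter R R2.
by apply: closureS => p /OmE[h _]; exact: quarter_sub.
Qed.

(** The Neumann radius is open at both ends, so the rest of the boundary is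
closed: it consists of the radius [p.1 = 0] with the origin, of the closed arc
and of the closed crack. *)
Lemma DE p : D p <-> cquarter p /\ (p.1 = 0 \/ sqn p = R2 ^+ 2 \/ crack p).
Proof.
split=> [[[/closure_Om_sub Kp nI] nN]|[Kp h]].
  split=> //; have [x0 y0 s] := Kp.
  have [->|xn] := eqVneq p.1 0; [by left|right].
  have xp : 0 < p.1 by rewrite lt_neqAle eq_sym xn.
  have [->|sn] := eqVneq (sqn p) (R2 ^+ 2); [by left|right].
  have sp : sqn p < R2 ^+ 2 by rewrite lt_neqAle sn.
  apply: contrapT => nc.
  have [y00|yn] := eqVneq p.2 0.
    apply: nN; apply/neumannE; split=> //; rewrite xp /=.
    by rewrite -(@ltr_pXn2r _ 2) ?nnegrE ?(ltW R20)//; move: sp; rewrite /sqn y00 expr0n addr0.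
  apply: nI; have -> : Om° = Om by apply/interior_id; exact: open_Om.
  by apply/OmE; split=> //; split=> //; rewrite lt_neqAle eq_sym yn.
split; last first.
  move=> /neumannE[/andP[x0 xR] y0]; case: h => [x|[s|[_ c]]].
  - by rewrite x ltxx in x0.
  - move: s; rewrite /sqn y0 expr0n addr0 => /eqP.
    by rewrite eqrXn2 ?(ltW x0) ?(ltW R20)// => /eqP xe; rewrite xe ltxx in xR.
  - have : 0 < sin eps by rewrite sin_gt0_pihalf// he0.
    by move=> /(mulr_gt0 hR1); rewrite ltNge -y0 c.
split; first exact: cquarter_closure.
move=> /interior_subset /OmE[[x0 _ s] nc]; case: h => [x|[s'|//]].
- by rewrite x ltxx in x0.
- by rewrite s' ltxx in s.
Qed.

(** A chord is shorter than its arc: the crack has length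
[R1 * (pi / 2 - eps)] and ends at [(0, R1)]. *)
Lemma crack_near p : crack p -> 0 <= p.1 ->
  p.1 ^+ 2 + (p.2 - R1) ^+ 2 <= R1 ^+ 2 * (pi / 2 - eps) ^+ 2.
Proof.
move=> [s y] x0; have -> : p.1 ^+ 2 + (p.2 - R1) ^+ 2 = sqn p - 2 * R1 * p.2 + R1 ^+ 2.
  by rewrite /sqn; ring.
rewrite s; set d := pi / 2 - eps.
have d0 : 0 < d by rewrite /d subr_gt0.
have e : sin eps = cos d.
  by rewrite /d cosB cos_pihalf sin_pihalf mul0r add0r mul1r.
rewrite e in y.
have sd : `|sin (d / 2) - sin 0| <= 1 * `|d / 2 - 0|.
  apply: (mean_value (f := cos)) => t _; last exact: cos_max.
  exact: is_derive_sin.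
have s2 : sin (d / 2) ^+ 2 <= (d / 2) ^+ 2.
  rewrite sin0 !subr0 mul1r in sd.
  rewrite -(real_normK (num_real (sin _))) -(real_normK (num_real (d / 2))).
  by rewrite ler_pXn2r ?nnegrE.
have cd : cos d = 1 - 2 * sin (d / 2) ^+ 2.
  rewrite {1}(_ : d = (d / 2) *+ 2); last by rewrite -mulr_natr divfK.
  by rewrite cos_mulr2n cos2sin2 -mulr_natr; ring.
have h : R1 * (R1 * cos d) <= R1 * p.2 by rewrite ler_pM2l.
have h2 : R1 ^+ 2 * sin (d / 2) ^+ 2 <= R1 ^+ 2 * (d / 2) ^+ 2.
  by rewrite ler_wpM2l// sqr_ge0.
move: h; rewrite cd; lra.
Qed.

End Geometry.

(** * Integrals over the quarter disc *)

Section Bounded.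
Context {R : realType}.
Variable R2 : R.
Hypothesis R20 : 0 < R2.
Local Notation leb := (@lebesgue_measure R).
Local Notation leb2 := (@lebesgue2 R).
Local Notation Q := (quarter R2 : set (mplane R)).

Lemma measurable_quarter : measurable Q.
Proof. by apply: open_measurable2; exact: open_quarter. Qed.

Lemma quarter_finite : (leb2 Q < +oo)%E.
Proof.
apply: (@le_lt_trans _ _ (leb2 (`[0, R2] `*` `[0, R2]))).
  apply: le_measure; rewrite ?inE.
  - exact: measurable_quarter.
  - by apply: measurable_rect; exact: measurable_itv.
  - move=> p /quarter_sub /(cquarter_bound R20)[a b].
    by split; rewrite /= in_itv /=.
rewrite lebesgue2_rect//.
by rewrite lebesgue_measure_itv /= lte_fin R20 -EFinD -EFinM ltry.
Qed.

Lemma cquarter_bounded (f : R * R -> R) : continuous f ->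
  exists M : R, forall p, cquarter R2 p -> `|f p| <= M.
Proof.
move=> cf; have : compact (f @` cquarter R2).
  apply: continuous_compact; last exact: compact_cquarter.
  exact: continuous_subspaceT.
move=> /compact_bounded[M [_ HM]]; exists (M + 1) => p Kp.
by apply: (HM (M + 1)); [rewrite ltrDl|exists p].
Qed.

Lemma continuous_sqint (D : set (mplane R)) (f : R * R -> R) :
  measurable D -> D `<=` quarter R2 -> continuous f -> sqint leb2 D f.
Proof.
move=> mD sD cf; have [M HM] := cquarter_bounded cf.
apply: (@bounded_sqint _ _ _ _ _ _ _ M) => //.
- apply: le_lt_trans quarter_finite; apply: le_measure; rewrite ?inE //.
  exact: measurable_quarter.
- exact: continuous_measurable2.
- by move=> p /sD /quarter_sub; exact: HM.
Qed.

Lemma continuous_integrable (D : set (mplane R)) (f : R * R -> R) :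
  measurable D -> D `<=` quarter R2 -> continuous f ->
  leb2.-integrable D (EFin \o (f : mplane R -> R)).
Proof.
move=> mD sD cf; have [M HM] := cquarter_bounded cf.
apply: (@bounded_integrable _ _ _ _ _ _ _ M) => //.
- apply: le_lt_trans quarter_finite; apply: le_measure; rewrite ?inE //.
  exact: measurable_quarter.
- exact: continuous_measurable2.
- by move=> p /sD /quarter_sub; exact: HM.
Qed.

Let lift (y : R) : R := Num.sqrt (R2 ^+ 2 - y ^+ 2).

Let lift_gt0 (y : R) : 0 < y < R2 -> 0 < lift y.
Proof.
move=> /andP[y0 yR]; rewrite sqrtr_gt0 subr_gt0.
by rewrite ltr_pXn2r ?nnegrE ?(ltW y0) ?(ltW R20).
Qed.

Let lift_sq (y : R) : 0 < y < R2 -> lift y ^+ 2 = R2 ^+ 2 - y ^+ 2.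
Proof. by move=> h; rewrite sqr_sqrtr//; have := lift_gt0 h; rewrite sqrtr_gt0 => /ltW. Qed.

Let section_lift (x y : R) : 0 < y < R2 -> (0 < x /\ x ^+ 2 + y ^+ 2 < R2 ^+ 2) <-> 0 < x < lift y.
Proof.
move=> h; have l0 := lift_gt0 h; split=> [[x0 hx]|/andP[x0 xl]].
  rewrite x0 /= -(@ltr_pXn2r _ 2) ?nnegrE ?(ltW x0) ?(ltW l0)// lift_sq//; lra.
split=> //; move: xl; rewrite -(@ltr_pXn2r _ 2) ?nnegrE ?(ltW x0) ?(ltW l0)// lift_sq//; lra.
Qed.

Let FTC_section (F f : R -> R) (a : R) : 0 < a -> continuous f -> continuous F ->
  (forall x, 0 < x < a -> has_deriv F x (f x)) -> F a = F 0 ->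
  (\int[leb]_(x in [set x : R | (0 < x < a)%R]) (f x)%:E = 0)%E.
Proof.
move=> a0 cf cF dF e.
have -> : [set x : R | 0 < x < a] = `]0, a[%classic by apply/seteqP; split => x /=; rewrite in_itv.
rewrite -(@integral_itv_bndoo _ 0 a _ true false); last first.
  apply/measurable_EFinP; apply: measurable_funTS; exact: continuous_measurable_fun.
rewrite (@FTC2_open _ F f 0 a)//; first by rewrite e subrr.
- exact: continuous_subspaceT.
- exact: continuous_subspaceT.
Qed.

(** The divergence theorem for a field without flux through the boundary, one
component at a time: by Fubini it reduces to the fundamental theorem of calculus
on the horizontal sections, and for [integral_dy] on the vertical ones. *)
Lemma integral_dx (F f : R * R -> R) : continuous F -> continuous f ->
  (forall p, Q p -> has_deriv (fun t => F (t, p.2)) p.1 (f p)) ->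
  (forall p, cquarter R2 p -> p.1 = 0 \/ sqn p = R2 ^+ 2 -> F p = 0) ->
  \int[leb2]_(p in Q) f p = 0.
Proof.
move=> cF cf dF F0; rewrite /Rintegral.
rewrite (@integral_sections_x _ _ (EFin \o f)); last 2 first.
- exact: measurable_quarter.
- by apply: continuous_integrable => //; exact: measurable_quarter.
rewrite integral0_eq// => y _ /=.
have [yR|nyR] := boolP (0 < y < R2); last first.
  have -> : [set x | quarter R2 (x, y)] = set0; last by rewrite integral_set0.
  apply/seteqP; split => // x h /=; move: nyR; apply/negP; rewrite negbK.
  case: (h) => _ /= y0 _; rewrite y0 /=; case: h => /= x0 _; rewrite /sqn /= => h.
  by rewrite -(@ltr_pXn2r _ 2) ?nnegrE ?(ltW y0) ?(ltW R20)//; have := sqr_ge0 x; lra.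
have y0 : 0 < y by case/andP: yR.
have -> : [set x | quarter R2 (x, y)] = [set x | 0 < x < lift y].
  apply/seteqP; split => x /=.
    by move=> [/= x0 _ h]; apply/section_lift.
  by move=> /section_lift -/(_ yR)[]; split.
apply: (@FTC_section (fun x => F (x, y))); first exact: lift_gt0.
- exact: cts_slice1.
- exact: cts_slice1.
- by move=> x /section_lift -/(_ yR)[x0 h]; apply: (dF (x, y)).
- rewrite !F0//.
  + by split => //=; [exact: ltW|rewrite /sqn /= expr0n add0r; move: yR => /andP[_ yR]; rewrite ltW// ltr_pXn2r ?nnegrE ?(ltW y0) ?(ltW R20)].
  + by left.
  + by split => /=; [exact: ltW (lift_gt0 yR)|exact: ltW|rewrite /sqn /= lift_sq// subrK].
  + by right; rewrite /sqn /= lift_sq// subrK.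
Qed.

Lemma integral_dy (F f : R * R -> R) : continuous F -> continuous f ->
  (forall p, Q p -> has_deriv (fun t => F (p.1, t)) p.2 (f p)) ->
  (forall p, cquarter R2 p -> p.2 = 0 \/ sqn p = R2 ^+ 2 -> F p = 0) ->
  \int[leb2]_(p in Q) f p = 0.
Proof.
move=> cF cf dF F0; rewrite /Rintegral.
rewrite (@integral_sections_y _ _ (EFin \o f)); last 2 first.
- exact: measurable_quarter.
- by apply: continuous_integrable => //; exact: measurable_quarter.
rewrite integral0_eq// => x _ /=.
have [xR|nxR] := boolP (0 < x < R2); last first.
  have -> : [set y | quarter R2 (x, y)] = set0; last by rewrite integral_set0.
  apply/seteqP; split => // y h /=; move: nxR; apply/negP; rewrite negbK.
  case: (h) => /= x0 _ _; rewrite x0 /=; case: h => /= _ y0; rewrite /sqn /= => h.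
  by rewrite -(@ltr_pXn2r _ 2) ?nnegrE ?(ltW x0) ?(ltW R20)//; have := sqr_ge0 y; lra.
have x0 : 0 < x by case/andP: xR.
have -> : [set y | quarter R2 (x, y)] = [set y | 0 < y < lift x].
  apply/seteqP; split => y /=.
    by move=> [/= _ y0 h]; apply/section_lift => //; split => //; rewrite addrC.
  by move=> /section_lift -/(_ xR)[]; rewrite addrC; split.
apply: (@FTC_section (fun y => F (x, y))); first exact: lift_gt0.
- exact: cts_slice2.
- exact: cts_slice2.
- by move=> y /section_lift -/(_ xR)[y0]; rewrite addrC => h; apply: (dF (x, y)).
- rewrite !F0//.
  + by split => //=; [exact: ltW|rewrite /sqn /= expr0n addr0; move: xR => /andP[_ xR]; rewrite ltW// ltr_pXn2r ?nnegrE ?(ltW x0) ?(ltW R20)].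
  + by left.
  + by split => /=; [exact: ltW|exact: ltW (lift_gt0 xR)|rewrite /sqn /= lift_sq// addrC subrK].
  + by right; rewrite /sqn /= lift_sq// addrC subrK.
Qed.

End Bounded.

(** * Jacobi's identity *)

Section Balance.
Context {d : measure_display} {T : measurableType d} {R : realType}.
Variables (nu : {measure set T -> \bar R}) (D : set T) (mu : R).
Hypothesis mD : measurable D.
Local Notation sq := (sqint nu D).

Lemma balance (a b c l k f g one : T -> R) :
  sq a -> sq b -> sq c -> sq l -> sq k -> sq f -> sq g -> sq one ->
  (forall p, D p -> a p + b p = mu * c p + (l p + k p) + f p + g p) ->
  ip nu D a one + ip nu D b one = mu * ip nu D c one +
    (ip nu D l one + ip nu D k one) + ip nu D f one + ip nu D g one.
Proof.
move=> sa sb sc sl sk sf sg s1 H.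
have : ip nu D (fun p => 1 * a p + 1 * b p) one =
  ip nu D (fun p => 1 * (1 * (mu * c p + 1 * (1 * l p + 1 * k p)) + 1 * f p) + 1 * g p) one.
  by apply: eq_ip => p Dp; rewrite !mul1r H// addrA.
have slk := sqint_lin mD 1 1 sl sk; have sclk := sqint_lin mD mu 1 sc slk.
have sclkf := sqint_lin mD 1 1 sclk sf.
rewrite (ip_linl mD _ _ sa sb s1) (ip_linl mD _ _ sclkf sg s1) (ip_linl mD _ _ sclk sf s1).
by rewrite (ip_linl mD _ _ sc slk s1) (ip_linl mD _ _ sl sk s1) !mul1r.
Qed.

End Balance.

Section Jacobi.
Context {R : realType}.
Variables (R2 : R) (mu : R) (phi phi1 phi2 phi11 phi22 : R * R -> R).
Hypothesis R20 : 0 < R2.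
Local Notation Q := (quarter R2).
Local Notation ipQ := (ip (@lebesgue2 R) (quarter R2)).

Hypotheses (c0 : continuous phi) (c1 : continuous phi1) (c2 : continuous phi2)
  (c11 : continuous phi11) (c22 : continuous phi22).
Hypothesis d1 : forall p, has_deriv (fun t => phi (t, p.2)) p.1 (phi1 p).
Hypothesis d2 : forall p, has_deriv (fun t => phi (p.1, t)) p.2 (phi2 p).
Hypothesis d11 : forall p, has_deriv (fun t => phi1 (t, p.2)) p.1 (phi11 p).
Hypothesis d22 : forall p, has_deriv (fun t => phi2 (p.1, t)) p.2 (phi22 p).
Hypothesis eigen : forall p, phi11 p + phi22 p = - mu * phi p.
Hypothesis phi_gt0 : forall p, Q p -> 0 < phi p.
Hypothesis phi_D : forall p, cquarter R2 p -> p.1 = 0 \/ sqn p = R2 ^+ 2 -> phi p = 0.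
Hypothesis phi_N : forall p, p.2 = 0 -> phi2 p = 0.

Variables (v : R * R -> R) (e : R).
Hypotheses (Cv : C1 v) (e0 : 0 < e).
Hypothesis v0 : forall p, cquarter R2 p -> phi p <= e -> v p = 0.

Let m p := Num.max (phi p) e.
Let m_gt0 p : 0 < m p. Proof. by rewrite lt_max e0 orbT. Qed.
Let m_neq0 p : m p != 0. Proof. by rewrite gt_eqF. Qed.
Let cm : continuous (fun p => (m p)^-1).
Proof. by apply: ctsV m_neq0 _; apply: cts_max => //; exact: cts_cst. Qed.
Let cv : continuous v. Proof. exact: C1_continuous. Qed.
Let cv1 : continuous (partial1 v). Proof. by case: Cv. Qed.
Let cv2 : continuous (partial2 v). Proof. by case: Cv. Qed.

(** The components of [grad v - (v / phi) * grad phi]. Since [v] vanishes where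
[phi <= e], the denominator may be replaced by [Num.max phi e], which makes the
expression continuous up to the boundary. *)
Definition log_defect1 p := partial1 v p - v p * phi1 p * (Num.max (phi p) e)^-1.
Definition log_defect2 p := partial2 v p - v p * phi2 p * (Num.max (phi p) e)^-1.

Let dQ p : Q p -> \forall q \near p, Q q.
Proof. by move=> Qp; apply: open_nbhs_nbhs; split => //; exact: open_quarter. Qed.

Let near_zero p : Q p -> phi p < e -> \forall q \near p, v q = 0.
Proof.
move=> Qp pe; have : \forall q \near p, phi q < e by have := @c0 p => /cvgr_lt; apply.
by apply: filterS2 (dQ Qp) => q Qq qe; apply: v0; [exact: quarter_sub|exact: ltW].
Qed.

Let zero p : Q p -> phi p < e -> [/\ v p = 0, partial1 v p = 0 & partial2 v p = 0].
Proof.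
by move=> Qp pe; exact: partials_near0 Cv (near_zero Qp pe).
Qed.

Let m_phi p : Q p -> phi p >= e -> m p = phi p.
Proof. by move=> _ pe; rewrite /m; apply/max_idPl. Qed.

Let flux (a : R * R -> R) p := v p ^+ 2 * a p * (m p)^-1.
Let flux' (va a a' : R * R -> R) p :=
  2 * v p * va p * a p * (m p)^-1 + v p ^+ 2 * a' p * (m p)^-1
  - v p ^+ 2 * a p ^+ 2 * (m p)^-1 ^+ 2.

Let c_flux a : continuous a -> continuous (flux a).
Proof. by move=> ca; rewrite /flux; cts. Qed.

Let c_flux' va a a' : continuous va -> continuous a -> continuous a' -> continuous (flux' va a a').
Proof. by move=> cva ca ca'; rewrite /flux'; cts. Qed.

Let fluxE a p : Q p -> v p ^+ 2 * a p * (phi p)^-1 = flux a p.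
Proof.
move=> Qp; rewrite /flux; have [pe|pe] := ltP (phi p) e; last by rewrite m_phi.
by have [-> _ _] := zero Qp pe; rewrite expr0n /= !mul0r.
Qed.

Let quotient_rule (V A P : R -> R) (x va a' pa : R) : P x != 0 ->
  has_deriv V x va -> has_deriv A x a' -> has_deriv P x pa ->
  has_deriv (fun t => V t ^+ 2 * A t * (P t)^-1) x
    (2 * V x * va * A x * (P x)^-1 + V x ^+ 2 * a' * (P x)^-1 - V x ^+ 2 * A x * pa * (P x)^-1 ^+ 2).
Proof.
move=> P0 dV dA dP.
apply: (has_deriv_eq (has_derivM (has_derivM (has_derivX2 dV) dA) (has_derivV P0 dP))).
by field.
Qed.

Let d_flux1 p : Q p -> has_deriv (fun t => flux phi1 (t, p.2)) p.1 (flux' (partial1 v) phi1 phi11 p).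
Proof.
move=> Qp; have pn : phi p != 0 by rewrite gt_eqF// phi_gt0.
have := @quotient_rule (fun t => v (t, p.2)) (fun t => phi1 (t, p.2)) (fun t => phi (t, p.2)) p.1
   _ _ _ _ (C1_partial1 p Cv) (d11 p) (d1 p).
rewrite -surjective_pairing => /(_ pn) h.
apply: has_deriv_eq; first apply: has_deriv_near h.
  by apply: filterS (near_slice1 (dQ Qp)) => t Qt; rewrite fluxE.
rewrite /flux'; have [pe|pe] := ltP (phi p) e.
  by have [-> -> _] := zero Qp pe; ring.
by rewrite m_phi//; ring.
Qed.

Let d_flux2 p : Q p -> has_deriv (fun t => flux phi2 (p.1, t)) p.2 (flux' (partial2 v) phi2 phi22 p).
Proof.
move=> Qp; have pn : phi p != 0 by rewrite gt_eqF// phi_gt0.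
have := @quotient_rule (fun t => v (p.1, t)) (fun t => phi2 (p.1, t)) (fun t => phi (p.1, t)) p.2
   _ _ _ _ (C1_partial2 p Cv) (d22 p) (d2 p).
rewrite -surjective_pairing => /(_ pn) h.
apply: has_deriv_eq; first apply: has_deriv_near h.
  by apply: filterS (near_slice2 (dQ Qp)) => t Qt; rewrite fluxE.
rewrite /flux'; have [pe|pe] := ltP (phi p) e.
  by have [-> _ ->] := zero Qp pe; ring.
by rewrite m_phi//; ring.
Qed.

Let v_D p : cquarter R2 p -> p.1 = 0 \/ sqn p = R2 ^+ 2 -> v p = 0.
Proof. by move=> Kp h; apply: v0 => //; rewrite phi_D// ltW. Qed.

(** Where [phi > 0], the equation satisfied by [phi] gives
[|grad v|^2 - mu v^2 = |grad v - (v / phi) grad phi|^2 + div ((v^2 / phi) grad phi)],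
and the field under the divergence has no flux through the boundary: [v]
vanishes on the Dirichlet part, and the normal derivative of [phi] on the
Neumann radius. *)
Lemma jacobi_identity :
  ipQ (partial1 v) (partial1 v) + ipQ (partial2 v) (partial2 v) =
  mu * ipQ v v + (ipQ log_defect1 log_defect1 + ipQ log_defect2 log_defect2).
Proof.
have mQ := @measurable_quarter R R2.
have sq (f : R * R -> R) : continuous f -> sqint (@lebesgue2 R) Q f.
  by move=> cf; apply: (continuous_sqint R20 mQ) => // p.
have cst1 : continuous (fun _ : R * R => 1 : R) by exact: cts_cst.
pose one := fun _ : R * R => 1 : R.
have toip (f g : R * R -> R) : ipQ f g = ipQ (fun p => f p * g p) one.
  by apply: eq_ip => p _; rewrite mulr1.
have F1 : ipQ (flux' (partial1 v) phi1 phi11) one = 0.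
  rewrite /ip /one; under eq_Rintegral => p _ do rewrite mulr1.
  apply: (integral_dx R20 (c_flux c1)); [exact: c_flux'|exact: d_flux1|].
  by move=> p Kp h; rewrite /flux v_D// expr0n /= !mul0r.
have F2 : ipQ (flux' (partial2 v) phi2 phi22) one = 0.
  rewrite /ip /one; under eq_Rintegral => p _ do rewrite mulr1.
  apply: (integral_dy R20 (c_flux c2)); [exact: c_flux'|exact: d_flux2|].
  move=> p Kp [h|h]; first by rewrite /flux phi_N// mulr0 mul0r.
  by rewrite /flux v_D ?expr0n /= ?mul0r//; right.
have cl1 : continuous log_defect1 := ctsD cv1 (ctsN (ctsM (ctsM cv c1) cm)).
have cl2 : continuous log_defect2 := ctsD cv2 (ctsN (ctsM (ctsM cv c2) cm)).
rewrite (toip (partial1 v)) (toip (partial2 v)) (toip v) (toip log_defect1) (toip log_defect2).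
have cf1 := c_flux' cv1 c1 c11; have cf2 := c_flux' cv2 c2 c22.
have s1 := sq _ cst1; have sf1 := sq _ cf1; have sf2 := sq _ cf2.
have sl1 := sq _ (ctsM cl1 cl1); have sl2 := sq _ (ctsM cl2 cl2).
have sv := sq _ (ctsM cv cv); have sv1 := sq _ (ctsM cv1 cv1); have sv2 := sq _ (ctsM cv2 cv2).
have B := balance (mu := mu) mQ sv1 sv2 sv sl1 sl2 sf1 sf2 s1.
rewrite B; first by rewrite F1 F2 !addr0.
move=> p Qp {B}.
rewrite /log_defect1 /log_defect2 /flux' -/(m p).
have [pe|pe] := ltP (phi p) e.
  by have [-> -> ->] := zero Qp pe; ring.
rewrite m_phi//; have pn : phi p != 0 by rewrite gt_eqF// phi_gt0.
have -> : phi22 p = - mu * phi p - phi11 p by rewrite -eigen; ring.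
by field.
Qed.

End Jacobi.

(** * The ground state of the quarter disc *)

Section Ground.
Context {R : realType}.
Variable R2 : R.
Hypothesis R20 : 0 < R2.
Local Notation Q := (quarter R2).
Local Notation j11 := (besselJ_zero R 1 1).

Definition kap : R := j11 ^+ 2 / (4 * R2 ^+ 2).

Let kap0 : 0 < kap.
Proof. by rewrite divr_gt0 ?exprn_gt0 ?besselJ_zero11_gt0// mulr_gt0// exprn_gt0. Qed.

Let kapR : kap * R2 ^+ 2 = j11 ^+ 2 / 4.
Proof. by rewrite /kap; field; exact: lt0r_neq0. Qed.

(** Up to a constant factor, [J_1(j_{1,1} r / R2) cos theta]: it is positive in
the quarter disc and vanishes on the Dirichlet part of its boundary. *)
Definition phi (p : R * R) := p.1 * clif 0 (kap * sqn p).
Definition phi1 (p : R * R) := clif 0 (kap * sqn p) + 2 * kap * p.1 ^+ 2 * clif 1 (kap * sqn p).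
Definition phi2 (p : R * R) := 2 * kap * p.1 * p.2 * clif 1 (kap * sqn p).
Definition phi11 (p : R * R) := 6 * kap * p.1 * clif 1 (kap * sqn p)
  + 4 * kap ^+ 2 * p.1 ^+ 3 * clif 2 (kap * sqn p).
Definition phi22 (p : R * R) := 2 * kap * p.1 * clif 1 (kap * sqn p)
  + 4 * kap ^+ 2 * p.1 * p.2 ^+ 2 * clif 2 (kap * sqn p).

Let c_clif j : continuous (fun p : R * R => clif j (kap * sqn p)).
Proof.
apply: cts_comp; first exact: clif_continuous.
by apply: ctsM; [exact: cts_cst|exact: sqn_continuous].
Qed.

Lemma continuous_phi : continuous phi. Proof. by rewrite /phi; cts; exact: c_clif. Qed.
Lemma continuous_phi1 : continuous phi1. Proof. by rewrite /phi1; cts; exact: c_clif. Qed.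
Lemma continuous_phi2 : continuous phi2. Proof. by rewrite /phi2; cts; exact: c_clif. Qed.
Lemma continuous_phi11 : continuous phi11. Proof. by rewrite /phi11; cts; exact: c_clif. Qed.
Lemma continuous_phi22 : continuous phi22. Proof. by rewrite /phi22; cts; exact: c_clif. Qed.

Let d_clif1 j (p : R * R) :
  has_deriv (fun t => clif j (kap * sqn (t, p.2))) p.1 (2 * kap * p.1 * clif j.+1 (kap * sqn p)).
Proof.
have h : has_deriv (fun t : R => kap * sqn (t, p.2)) p.1 (2 * kap * p.1).
  rewrite /sqn /=; apply: (has_deriv_eq (has_derivM (has_deriv_cst _ _)
    (has_derivD (has_derivX2 (has_deriv_id _)) (has_deriv_cst _ _)))); ring.
have := has_deriv_comp h (clif_derive j _); rewrite -surjective_pairing mulrC; exact.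
Qed.

Let d_clif2 j (p : R * R) :
  has_deriv (fun t => clif j (kap * sqn (p.1, t))) p.2 (2 * kap * p.2 * clif j.+1 (kap * sqn p)).
Proof.
have h : has_deriv (fun t : R => kap * sqn (p.1, t)) p.2 (2 * kap * p.2).
  rewrite /sqn /=; apply: (has_deriv_eq (has_derivM (has_deriv_cst _ _)
    (has_derivD (has_deriv_cst _ _) (has_derivX2 (has_deriv_id _))))); ring.
have := has_deriv_comp h (clif_derive j _); rewrite -surjective_pairing mulrC; exact.
Qed.

Let sp (p : R * R) : (p.1, p.2) = p. Proof. by rewrite -surjective_pairing. Qed.

Lemma deriv_phi1 p : has_deriv (fun t => phi (t, p.2)) p.1 (phi1 p).
Proof.
apply: (has_deriv_eq (has_derivM (has_deriv_id _) (d_clif1 0 p))); rewrite sp /phi1; ring.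
Qed.

Lemma deriv_phi2 p : has_deriv (fun t => phi (p.1, t)) p.2 (phi2 p).
Proof.
apply: (has_deriv_eq (has_derivM (has_deriv_cst p.1 _) (d_clif2 0 p))); rewrite sp /phi2; ring.
Qed.

Lemma deriv_phi11 p : has_deriv (fun t => phi1 (t, p.2)) p.1 (phi11 p).
Proof.
apply: (has_deriv_eq (has_derivD (d_clif1 0 p) (has_derivM (has_derivM (has_deriv_cst (2 * kap) _)
  (has_derivX2 (has_deriv_id _))) (d_clif1 1 p)))); rewrite sp /phi11; ring.
Qed.

Lemma deriv_phi22 p : has_deriv (fun t => phi2 (p.1, t)) p.2 (phi22 p).
Proof.
apply: (has_deriv_eq (has_derivM (has_derivM (has_deriv_cst (2 * kap * p.1) _)
  (has_deriv_id _)) (d_clif2 1 p))); rewrite sp /phi22; ring.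
Qed.

(** Bessel's equation in the form [clif_ode], as [4 * kap = j_{1,1}^2 / R2^2]. *)
Lemma phi_eigen p : phi11 p + phi22 p = - (j11 ^+ 2 / R2 ^+ 2) * phi p.
Proof.
have -> : j11 ^+ 2 / R2 ^+ 2 = 4 * kap by rewrite /kap; field; exact: lt0r_neq0.
have := clif_ode (kap * sqn p); rewrite /phi11 /phi22 /phi.
set a := clif 0 _; set b := clif 1 _; set c := clif 2 _ => h.
have -> : a = - (kap * sqn p * c + 2 * b) by apply/eqP; rewrite -subr_eq0; apply/eqP; rewrite -h; ring.
by rewrite /sqn; ring.
Qed.

Lemma clif_pos p : sqn p < R2 ^+ 2 -> 0 < clif 0 (kap * sqn p).
Proof.
move=> h; apply: clif0_gt0; last by rewrite -kapR ltr_pM2l.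
by rewrite mulr_ge0 ?(ltW kap0)// addr_ge0 ?sqr_ge0.
Qed.

Lemma phi_gt0 p : Q p -> 0 < phi p.
Proof. by move=> [x0 y0 h]; rewrite mulr_gt0// clif_pos. Qed.

Lemma clif_arc p : sqn p = R2 ^+ 2 -> clif 0 (kap * sqn p) = 0.
Proof. by move=> ->; rewrite kapR clif0_j11. Qed.

Lemma phi_D p : cquarter R2 p -> p.1 = 0 \/ sqn p = R2 ^+ 2 -> phi p = 0.
Proof. by move=> _ [h|h]; rewrite /phi ?h ?mul0r// -h clif_arc// mulr0. Qed.

Lemma phi_N p : p.2 = 0 -> phi2 p = 0.
Proof. by rewrite /phi2 => ->; rewrite mulr0 mul0r. Qed.

Lemma phi_pos_or p : cquarter R2 p -> 0 < phi p \/ (p.1 = 0 \/ sqn p = R2 ^+ 2).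
Proof.
move=> [x0 y0 s]; have [->|xn] := eqVneq p.1 0; first by right; left.
have [e|sn] := eqVneq (sqn p) (R2 ^+ 2); first by right; right.
left; rewrite mulr_gt0 ?clif_pos//; first by rewrite lt_neqAle eq_sym xn.
by rewrite lt_neqAle sn.
Qed.

End Ground.

(** * Admissible functions and the lower bound *)

Section Admissible.
Context {R : realType}.
Variables (R1 R2 eps : R).
Hypotheses (hR1 : 0 < R1) (hR12 : R1 < R2) (he0 : 0 < eps) (he1 : eps < pi / 2).
Local Notation Om := (cracked_sector R1 R2 eps).
Local Notation D := (boundary Om `\` neumann_radius R2).
Local Notation Q := (quarter R2).
Local Notation leb2 := (@lebesgue2 R).
Local Notation j11 := (besselJ_zero R 1 1).
Local Notation phi := (phi R2).
Local Notation phi1 := (phi1 R2).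
Local Notation phi2 := (phi2 R2).
Let R20 : 0 < R2. Proof. exact: lt_trans hR12. Qed.

Definition adm (v : R * R -> R) : Prop :=
  C1 v /\ forall p, D p -> \forall q \near p, v q = 0.

Lemma measurable_Om : measurable (Om : set (mplane R)).
Proof. by apply: open_measurable2; exact: open_Om. Qed.

Lemma Om_sub : Om `<=` Q.
Proof. by move=> p /OmE -/(_ hR1 hR12 he0 he1)[]. Qed.

(** By compactness of the closed quarter disc: at each of its points either
[phi] is positive, hence bounded below nearby, or [v] vanishes nearby. *)
Lemma adm_near_D v : adm v ->
  exists2 e, 0 < e & forall p, cquarter R2 p -> phi p <= e -> v p = 0.
Proof.
move=> [_ vD].
have K : near_covering (cquarter R2) by apply/compact_near_coveringP; exact: compact_cquarter.
have := K R (0 : R)^'+ (fun e p => phi p <= e -> v p = 0) _ _.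
case.
  move=> p Kp; have [pp|pD] := phi_pos_or R20 Kp.
    exists ([set q | phi p / 2 < phi q], [set e | e < phi p / 2]) => /=.
      split; last by apply: nbhs_right_lt; rewrite divr_gt0.
      by have := @continuous_phi R R2 p => /cvgr_gt; apply; rewrite ltr_pdivrMr// ltr_pMr// ltr1n.
    by move=> [q e] /= [a b] c; have := lt_trans b a; rewrite ltNge c.
  have Dp : D p by apply/(DE hR1 hR12 he0 he1); split=> //; case: pD => h; [left|right; left].
  exists ([set q | v q = 0], setT) => /=; first by split; [exact: vD|exact: filterT].
  by move=> [q e] /= [].
move=> d /= d0 H; exists (d / 2); first by rewrite divr_gt0.
move=> p Kp; apply: (H (d / 2)) => //=; last by rewrite divr_gt0.
by rewrite sub0r normrN gtr0_norm ?divr_gt0// ltr_pdivrMr// ltr_pMr// ltr1n.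
Qed.

(** Admissible functions vanish near the crack, so integrals over the cracked
domain are integrals over the quarter disc, where [jacobi_identity] applies. *)
Lemma adm_crack v p : adm v -> Q p -> ~ Om p -> [/\ v p = 0, partial1 v p = 0 & partial2 v p = 0].
Proof.
move=> [Cv vD] Qp nO; have cp : crack R1 eps p.
  by apply: contrapT => nc; apply: nO; apply/OmE.
apply: partials_near0 Cv _; apply: vD; apply/(DE hR1 hR12 he0 he1).
by split; [exact: quarter_sub|right; right].
Qed.

Lemma ip_Om (f g : R * R -> R) : (forall p, Q p -> ~ Om p -> f p * g p = 0) ->
  ip leb2 Om f g = ip leb2 Q f g.
Proof.
move=> H; rewrite /ip Rintegral_mkcond [RHS]Rintegral_mkcond.
apply: eq_Rintegral => p _; rewrite /patch.
case: ifPn => [|pO]; first by rewrite inE => Op; rewrite mem_set//; exact: Om_sub.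
case: ifPn => //; rewrite inE => Qp; rewrite H//.
by move: pO; rewrite notin_setE.
Qed.

Lemma adm_ip v : adm v -> [/\ ip leb2 Om v v = ip leb2 Q v v,
  ip leb2 Om (partial1 v) (partial1 v) = ip leb2 Q (partial1 v) (partial1 v) &
  ip leb2 Om (partial2 v) (partial2 v) = ip leb2 Q (partial2 v) (partial2 v)].
Proof.
move=> av; split; apply: ip_Om => p Qp nO; have [a b c] := adm_crack av Qp nO.
- by rewrite a mul0r.
- by rewrite b mul0r.
- by rewrite c mul0r.
Qed.

Lemma adm_sqint v : adm v -> [/\ sqint leb2 Om v, sqint leb2 Om (partial1 v) & sqint leb2 Om (partial2 v)].
Proof.
move=> [Cv _]; have [_ _ c1 c2] := Cv; have c0 := C1_continuous Cv.
by split; apply: (continuous_sqint R20 measurable_Om Om_sub).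
Qed.

Lemma adm_lin f g a b : adm f -> adm g -> adm (fun x => a * f x + b * g x).
Proof.
move=> [Cf Df] [Cg Dg]; have [C _ _] := C1_lin a b Cf Cg; split => // p Dp.
by apply: filterS2 (Df p Dp) (Dg p Dp) => q -> ->; rewrite !mulr0 addr0.
Qed.

Lemma adm_jacobi v e : adm v -> 0 < e ->
  (forall p, cquarter R2 p -> phi p <= e -> v p = 0) ->
  ip leb2 Om (partial1 v) (partial1 v) + ip leb2 Om (partial2 v) (partial2 v) =
  j11 ^+ 2 / R2 ^+ 2 * ip leb2 Om v v +
    (ip leb2 Q (log_defect1 phi phi1 v e) (log_defect1 phi phi1 v e) +
     ip leb2 Q (log_defect2 phi phi2 v e) (log_defect2 phi phi2 v e)).
Proof.
move=> av e0 ve; have [-> -> ->] := adm_ip av; have [Cv _] := av.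
exact: (jacobi_identity R20 (@continuous_phi _ R2) (@continuous_phi1 _ R2)
  (@continuous_phi2 _ R2) (@continuous_phi11 _ R2) (@continuous_phi22 _ R2)
  (@deriv_phi1 _ R2) (@deriv_phi2 _ R2) (@deriv_phi11 _ R2) (@deriv_phi22 _ R2)
  (phi_eigen R20) (phi_gt0 R20) (phi_D R20) (@phi_N _ R2) Cv e0 ve).
Qed.

(** The right-hand side of [adm_jacobi] contains a sum of two squares. *)
Lemma adm_lower v : adm v -> j11 ^+ 2 / R2 ^+ 2 * ip leb2 Om v v <=
  ip leb2 Om (partial1 v) (partial1 v) + ip leb2 Om (partial2 v) (partial2 v).
Proof.
move=> av; have [e e0 ve] := adm_near_D av.
by rewrite (adm_jacobi av e0 ve) lerDl addr_ge0// ip_ge0.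
Qed.

End Admissible.

(** * Friedrichs' inequality *)

Section Increment.
Context {R : realType}.
Local Notation leb := (@lebesgue_measure R).

(** The fundamental theorem of calculus and the Cauchy--Schwarz inequality. *)
Lemma increment_sqr (F f : R -> R) (I : set R) (h M x x' : R) :
  measurable I -> leb I = h%:E -> measurable_fun I f ->
  (forall t, `|f t| <= M) -> x < x' -> I x -> I x' -> `[x, x'] `<=` I ->
  (forall t, I t -> has_deriv F t (f t)) -> (forall t, I t -> {for t, continuous f}) ->
  (F x' - F x) ^+ 2 <= h * \int[leb]_(t in I) (f t ^+ 2).
Proof.
move=> mI lI mf bf xx' Ix Ix' sI dF cf.
have cS (g : R -> R) : (forall t, I t -> {for t, continuous g}) -> {within `[x, x'], continuous g}.
  move=> H; apply: continuous_in_subspaceT => t; rewrite inE => /sI; exact: H.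
have mS : measurable (`[x, x'] : set R) by exact: measurable_itv.
have lS : leb `[x, x'] = (x' - x)%:E.
  by rewrite lebesgue_measure_itv /= lte_fin xx' EFinB.
have xh : x' - x <= h.
  rewrite -lee_fin -lS -lI; apply: le_measure; rewrite ?inE //.
have mfS : measurable_fun `[x, x'] f by apply: measurable_funS mf.
have fS : (leb `[x, x'] < +oo)%E by rewrite lS ltry.
have fI : (leb I < +oo)%E by rewrite lI ltry.
have b2 t : I t -> `|f t ^+ 2| <= M ^+ 2.
  by rewrite normrX ler_pXn2r ?nnegrE//; apply: le_trans (bf t).
have e : F x' - F x = ip leb `[x, x'] f (cst 1).
  rewrite ip1E /Rintegral (@FTC2_open _ F f x x')//.
  - exact: cS cf.
  - by apply: cS => t It; exact: has_deriv_continuous (dF t It).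
  - by move=> t /andP[/ltW a /ltW b]; apply: dF; apply: sI; rewrite /= in_itv /= a b.
have s1 := @bounded_sqint _ _ R leb _ mS (cst 1) 1 fS (measurable_cst _) (fun _ _ => ltac:(by rewrite normr1)).
have sf := @bounded_sqint _ _ R leb _ mS f M fS mfS (fun t _ => bf t).
rewrite e; apply: le_trans (@ip_CauchySchwarz _ _ R leb _ mS _ _ sf s1) _.
have -> : ip leb `[x, x'] (cst 1) (cst 1) = x' - x.
  by rewrite ip1E Rintegral_cst// mul1r; exact: (congr1 fine lS).
have le1 : ip leb `[x, x'] f f <= \int[leb]_(t in I) (f t ^+ 2).
  rewrite -lee_fin -ip_sqE// /Rintegral fineK; last first.
    by apply: integrable_fin_num => //; exact: (@bounded_integrable _ _ R leb _ mI _ (M ^+ 2) fI (measurable_funX 2 mf) b2).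
  apply: ge0_subset_integral => //.
  - by apply/measurable_EFinP; exact: measurable_funX.
  - by move=> t _; rewrite lee_fin sqr_ge0.
rewrite mulrC; apply: ler_pM => //; first by rewrite subr_ge0 ltW.
exact: ip_ge0.
Qed.

End Increment.

Section Cells.
Context {R : realType}.
Variables (N : nat) (h : R).
Hypothesis h0 : 0 < h.
Local Notation leb2 := (@lebesgue2 R).

Definition strip (i : nat) : set R := `]i%:R * h, i.+1%:R * h]%classic.
Definition cell (ij : 'I_N * 'I_N) : set (mplane R) := strip ij.1 `*` strip ij.2.

Lemma measurable_strip i : measurable (strip i). Proof. exact: measurable_itv. Qed.
Lemma measurable_cell ij : measurable (cell ij).
Proof. by apply: measurable_rect; exact: measurable_strip. Qed.

Lemma strip_measure i : @lebesgue_measure R (strip i) = h%:E.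
Proof.
rewrite /strip lebesgue_measure_itv /= lte_fin ltr_pM2r// ltr_nat ltnSn -EFinD.
by rewrite -natr1; congr EFin; ring.
Qed.

Lemma cell_finite ij : (leb2 (cell ij) < +oo)%E.
Proof.
by rewrite lebesgue2_rect ?strip_measure; [rewrite -EFinM ltry|exact: measurable_strip..].
Qed.

Lemma strip_inj i k x : strip i x -> strip k x -> i = k.
Proof.
suff W a b : strip a x -> strip b x -> (a <= b)%N by move=> A B; apply/eqP; rewrite eqn_leq !W.
rewrite /strip /= !in_itv /= => /andP[A _] /andP[_ B].
by have := lt_le_trans A B; rewrite ltr_pM2r// ltr_nat ltnS.
Qed.

Lemma strip_cover n x : 0 < x -> x <= n%:R * h -> exists2 i, (i < n)%N & strip i x.
Proof.
move=> x0; elim: n => [|n IH] xn; first by move: xn; rewrite mul0r leNgt x0.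
have [/IH[i i_n ix]|lt] := leP x (n%:R * h); first by exists i => //; exact: ltnW.
by exists n => //; rewrite /strip /= in_itv /= lt.
Qed.

Lemma ip_cells (V : mplane R -> R) (M : R) (E : set (mplane R)) :
  measurable E -> measurable_fun setT V -> (forall p, `|V p| <= M) ->
  (forall p, E p -> 0 < p.1 <= N%:R * h /\ 0 < p.2 <= N%:R * h) ->
  (forall p, ~ E p -> V p = 0) ->
  ip leb2 E V V = \sum_ij ip leb2 (cell ij) V V.
Proof.
move=> mE mV bV EN V0.
pose C := \big[setU/set0]_(ij <- enum {: 'I_N * 'I_N}) cell ij.
have CE p : C p <-> exists ij, cell ij p.
  rewrite /C -bigcup_seq; split=> [[ij _ c]|[ij c]]; exists ij => //=.
  by rewrite mem_enum.
have tc : trivIset [set` enum {: 'I_N * 'I_N}] cell.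
  move=> [i k] [i' k'] _ _ [p [[/= a b] [c d]]].
  by congr pair; apply/val_inj; [exact: strip_inj a c|exact: strip_inj b d].
have sc ij : sqint leb2 (cell ij) V.
  exact: (bounded_sqint (measurable_cell ij) (cell_finite ij) (measurable_funTS mV) (fun p _ => bV p)).
have mV2 : measurable_fun setT (fun p => (V p ^+ 2)%:E).
  by apply/measurable_EFinP; exact: measurable_funX.
have I1 : (\int[leb2]_(p in C) (V p ^+ 2)%:E = (\sum_ij ip leb2 (cell ij) V V)%:E)%E.
  rewrite ge0_integral_bigsetU//.
  - rewrite -sumEFin big_enum /=; apply: eq_bigr => ij _.
    by rewrite ip_sqE//; exact: measurable_cell.
  - exact: measurable_cell.
  - exact: enum_uniq.
  - exact: measurable_funTS.
  - by move=> p _; rewrite lee_fin sqr_ge0.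
rewrite /ip /Rintegral -[RHS]/(fine (\sum_ij ip leb2 (cell ij) V V)%:E) -I1; congr fine.
rewrite integral_mkcond [RHS]integral_mkcond; apply: eq_integral => p _.
rewrite /patch; have [pE|pE] := boolP (p \in E).
  rewrite inE in pE; rewrite mem_set ?expr2//.
  have [/andP[a b] /andP[c d]] := EN p pE.
  have [i iN ip] := strip_cover a b; have [k kN kp] := strip_cover c d.
  by apply/CE; exists (Ordinal iN, Ordinal kN).
by case: ifP => // _; rewrite V0 ?expr0n//; move: pE; rewrite notin_setE.
Qed.

End Cells.

Section Friedrichs.
Context {R : realType}.
Variables (R1 R2 eps : R).
Hypotheses (hR1 : 0 < R1) (hR12 : R1 < R2) (he0 : 0 < eps) (he1 : eps < pi / 2).
Local Notation Om := (cracked_sector R1 R2 eps).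
Local Notation D := (boundary Om `\` neumann_radius R2).
Local Notation Q := (quarter R2).
Local Notation leb := (@lebesgue_measure R).
Local Notation leb2 := (@lebesgue2 R).
Local Notation adm := (adm R1 R2 eps).
Let R20 : 0 < R2. Proof. exact: lt_trans hR12. Qed.

(** The squares of a grid stick out of the quarter disc across the arc. *)
Definition ext0 (f : R * R -> R) : R * R -> R := f \_ Q.

Lemma ext0_in f p : Q p -> ext0 f p = f p.
Proof. by move=> Qp; rewrite /ext0 patchE mem_set. Qed.

Lemma ext0_out f p : ~ Q p -> ext0 f p = 0.
Proof. by move=> Qp; rewrite /ext0 patchE memNset. Qed.

Lemma ext0_measurable f : continuous f -> measurable_fun setT (ext0 f : mplane R -> R).
Proof.
move=> cf; apply/(measurable_restrictT _ _).1; first exact: measurable_quarter.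
by apply: continuous_measurable2 => //; exact: measurable_quarter.
Qed.

Lemma ext0_bounded f : continuous f -> exists M : R, forall p, `|ext0 f p| <= M.
Proof.
move=> cf; have [M HM] := cquarter_bounded R20 cf; exists (Num.max M 0) => p.
have [Qp|nQ] := pselect (Q p).
  by rewrite ext0_in// le_max HM//; exact: quarter_sub.
by rewrite ext0_out// normr0 le_max lexx orbT.
Qed.

(** An admissible function vanishes near the arc, so its extension by zero is as
regular as itself in the open quadrant. *)
Lemma ext0_local v (p : R * R) : adm v -> 0 < p.1 -> 0 < p.2 ->
  (\forall q \near p, [/\ ext0 v q = v q, ext0 (partial1 v) q = partial1 v q &
     ext0 (partial2 v) q = partial2 v q]) \/
  (\forall q \near p, [/\ ext0 v q = 0, ext0 (partial1 v) q = 0 & ext0 (partial2 v) q = 0]).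
Proof.
move=> av p1 p2; have [Cv vD] := av.
have [lt|gt|e] := ltgtP (sqn p) (R2 ^+ 2).
- left; have : \forall q \near p, Q q by apply: open_nbhs_nbhs; split; [exact: open_quarter|].
  by apply: filterS => q Qq; rewrite !ext0_in.
- right; have : \forall q \near p, R2 ^+ 2 < sqn q.
    by have := @sqn_continuous R p => /cvgr_gt; apply.
  apply: filterS => q gq; have nQ : ~ Q q by move=> [_ _ /(lt_trans gq)]; rewrite ltxx.
  by rewrite !ext0_out.
- right; have Dp : D p.
    by apply/(DE hR1 hR12 he0 he1); split; [by split; [exact: ltW|exact: ltW|rewrite e]|by right; left].
  have /nbhs_interior n := vD p Dp.
  apply: filterS n => q n; have [vq d1 d2] := partials_near0 Cv n.
  have [Qq|nQ] := pselect (Q q); first by rewrite !ext0_in.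
  by rewrite !ext0_out.
Qed.

Lemma near_eq_C1 (F G f g : R -> R) (x : R) :
  (\forall t \near x, G t = F t /\ g t = f t) ->
  has_deriv F x (f x) -> {for x, continuous f} ->
  has_deriv G x (g x) /\ {for x, continuous g}.
Proof.
move=> n dF cf; have [_ e] := nbhs_singleton n; split.
  by rewrite e; apply: has_deriv_near dF; apply: filterS n => t [-> _].
rewrite /prop_for /continuous_at e; apply: cvg_trans cf; apply: near_eq_cvg.
by apply: filterS n => t [_ ->].
Qed.

Lemma ext0_deriv1 v (x y : R) : adm v -> 0 < x -> 0 < y ->
  has_deriv (fun t => ext0 v (t, y)) x (ext0 (partial1 v) (x, y)) /\
  {for x, continuous (fun t => ext0 (partial1 v) (t, y))}.
Proof.
move=> av x0 y0; have [Cv _] := av; have [_ _ c1 c2] := Cv.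
have [n|n] := @ext0_local v (x, y) av x0 y0.
- apply: (near_eq_C1 (F := fun t => v (t, y)) (f := fun t => partial1 v (t, y))).
  + by apply: filterS (near_slice1 n) => t [].
  + exact: C1_partial1 (x, y) Cv.
  + exact: (@cts_slice1 _ _ y c1 x).
- apply: (near_eq_C1 (F := fun=> 0) (f := fun=> 0)).
  + by apply: filterS (near_slice1 n) => t [].
  + exact: has_deriv_cst.
  + exact: cst_continuous.
Qed.

Lemma ext0_deriv2 v (x y : R) : adm v -> 0 < x -> 0 < y ->
  has_deriv (fun t => ext0 v (x, t)) y (ext0 (partial2 v) (x, y)) /\
  {for y, continuous (fun t => ext0 (partial2 v) (x, t))}.
Proof.
move=> av x0 y0; have [Cv _] := av; have [_ _ c1 c2] := Cv.
have [n|n] := @ext0_local v (x, y) av x0 y0.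
- apply: (near_eq_C1 (F := fun t => v (x, t)) (f := fun t => partial2 v (x, t))).
  + by apply: filterS (near_slice2 n) => t [].
  + exact: C1_partial2 (x, y) Cv.
  + exact: (@cts_slice2 _ _ x c2 y).
- apply: (near_eq_C1 (F := fun=> 0) (f := fun=> 0)).
  + by apply: filterS (near_slice2 n) => t [].
  + exact: has_deriv_cst.
  + exact: cst_continuous.
Qed.

Lemma strip_gt0 (h : R) i t : 0 < h -> strip h i t -> 0 < t.
Proof.
by move=> h0; rewrite /strip /= in_itv /= => /andP[a _]; apply: le_lt_trans a; rewrite mulr_ge0// ltW.
Qed.

Lemma strip_convex (h : R) i x x' : strip h i x -> strip h i x' -> `[x, x'] `<=` strip h i.
Proof.
rewrite /strip /= !in_itv /= => /andP[a _] /andP[_ b] t; rewrite /= !in_itv /= => /andP[c d].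
by rewrite (lt_le_trans a c) (le_trans d b).
Qed.

Lemma wlog_increment (P : R -> Prop) (F : R -> R) (B : R) : 0 <= B ->
  (forall x x', x < x' -> P x -> P x' -> (F x' - F x) ^+ 2 <= B) ->
  forall x x', P x -> P x' -> (F x - F x') ^+ 2 <= B.
Proof.
move=> B0 H x x' Px Px'; have [l|l|->] := ltgtP x x'.
- by rewrite -sqrrN opprB; exact: H.
- exact: H.
- by rewrite subrr expr0n.
Qed.

Lemma cell_friedrichs v (h : R) (i k : nat) (q : set (mplane R)) : adm v -> 0 < h ->
  q = strip h i `*` strip h k ->
  ip leb2 q (ext0 v) (ext0 v) <= (h^-1 * ip leb2 q (ext0 v) (cst 1)) ^+ 2 +
    h ^+ 2 * (ip leb2 q (ext0 (partial1 v)) (ext0 (partial1 v)) +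
              ip leb2 q (ext0 (partial2 v)) (ext0 (partial2 v))).
Proof.
move=> av h0 ->; have [Cv _] := av; have [_ _ c1 c2] := Cv; have c0 := C1_continuous Cv.
have [M0 b0] := ext0_bounded c0; have [M1 b1] := ext0_bounded c1; have [M2 b2] := ext0_bounded c2.
pose M := Num.max M0 (Num.max M1 M2).
have B0 p : `|ext0 v p| <= M by rewrite le_max b0.
have B1 p : `|ext0 (partial1 v) p| <= M by rewrite !le_max b1 ?orbT.
have B2 p : `|ext0 (partial2 v) p| <= M by rewrite !le_max b2 ?orbT.
have m0 := ext0_measurable c0; have m1 := ext0_measurable c1; have m2 := ext0_measurable c2.
have mS j := @measurable_strip R h j; have lS j := strip_measure h0 j.
apply: (cell_poincare (mS i) (mS k) h0 (lS i) (lS k) m0 m1 m2 B0 B1 B2).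
- move=> y x x' yk; apply: (wlog_increment (P := strip h i) (F := fun t => ext0 v (t, y))).
    by rewrite mulr_ge0 ?(ltW h0)//; apply: Rintegral_ge0 => t _; exact: sqr_ge0.
  move=> z z' zz' iz iz'; have y0 := strip_gt0 h0 yk.
  apply: (@increment_sqr R (fun t => ext0 v (t, y)) (fun t => ext0 (partial1 v) (t, y)) _ h M z z' (mS i) (lS i) _ (fun t => B1 (t, y)) zz' iz iz').
  - exact: slice_measurable1.
  - exact: strip_convex.
  - by move=> t it; case: (ext0_deriv1 av (strip_gt0 h0 it) y0).
  - by move=> t it; case: (ext0_deriv1 av (strip_gt0 h0 it) y0).
- move=> x y y' xi; apply: (wlog_increment (P := strip h k) (F := fun t => ext0 v (x, t))).
    by rewrite mulr_ge0 ?(ltW h0)//; apply: Rintegral_ge0 => t _; exact: sqr_ge0.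
  move=> z z' zz' iz iz'; have x0 := strip_gt0 h0 xi.
  apply: (@increment_sqr R (fun t => ext0 v (x, t)) (fun t => ext0 (partial2 v) (x, t)) _ h M z z' (mS k) (lS k) _ (fun t => B2 (x, t)) zz' iz iz').
  - exact: slice_measurable2.
  - exact: strip_convex.
  - by move=> t it; case: (ext0_deriv2 av x0 (strip_gt0 h0 it)).
  - by move=> t it; case: (ext0_deriv2 av x0 (strip_gt0 h0 it)).
Qed.

(** Sum of [cell_poincare] over a grid of squares of side [h] with
[h ^+ 2 <= e]; the finitely many functionals are the averages over these squares,
multiplied by [h]. *)
Lemma friedrichs (e : R) : 0 < e -> exists (I : finType) (psi : I -> mplane R -> R),
  (forall i, sqint leb2 Om (psi i)) /\
  forall v, adm v -> ip leb2 Om v v <= \sum_i (ip leb2 Om v (psi i)) ^+ 2 +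
    e * (ip leb2 Om (partial1 v) (partial1 v) + ip leb2 Om (partial2 v) (partial2 v)).
Proof.
(* [N] at least [R2 ^+ 2 / e] is enough because [N <= N ^+ 2]. *)
move=> e0; pose N := (Num.truncn (R2 ^+ 2 / e)).+1; pose h := R2 / N%:R.
have N0 : 0 < (N%:R : R) by rewrite ltr0n.
have h0 : 0 < h by rewrite divr_gt0.
have hN : N%:R * h = R2 by rewrite /h mulrCA mulfV ?mulr1// gt_eqF.
have h2 : h ^+ 2 <= e.
  have N1 : (1 : R) <= N%:R by rewrite ler1n.
  have Ne : R2 ^+ 2 <= e * N%:R.
    by rewrite mulrC -ler_pdivrMr// ltW// truncnS_gt.
  rewrite /h expr_div_n ler_pdivrMr ?exprn_gt0//; apply: le_trans Ne _.
  by rewrite ler_pM2l// expr2 ler_peMr// ltW.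
have mO := measurable_Om hR1 hR12 he0 he1.
have mQ := @measurable_quarter R R2.
have sOQ := Om_sub hR1 hR12 he0 he1.
have fO : (leb2 Om < +oo)%E.
  by apply: le_lt_trans (quarter_finite R20); apply: le_measure; rewrite ?inE.
exists ('I_N * 'I_N)%type, (fun ij p => h^-1 * \1_(cell h ij) p); split.
  move=> ij; apply: (bounded_sqint (M := h^-1) mO fO).
    by apply: measurable_funM => //; apply: measurable_indic; exact: measurable_cell.
  move=> p _; rewrite normrM gtr0_norm ?invr_gt0// ler_piMr ?invr_ge0 ?(ltW h0)//.
  by rewrite indicE; case: (_ \in _); rewrite ?normr1// normr0.
move=> v av; have [Cv _] := av; have [_ _ c1 c2] := Cv; have c0 := C1_continuous Cv.
have QN p : Q p -> 0 < p.1 <= N%:R * h /\ 0 < p.2 <= N%:R * h.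
  move=> Qp; have [/andP[_ a] /andP[_ b]] := cquarter_bound R20 (quarter_sub Qp).
  by case: Qp => x0 y0 _; rewrite hN x0 y0.
have cells (f : R * R -> R) : continuous f ->
    ip leb2 Q f f = \sum_ij ip leb2 (cell (N := N) h ij) (ext0 f) (ext0 f).
  move=> cf; have [M b] := ext0_bounded cf.
  rewrite -(@ip_cells _ N h h0 (ext0 f) M Q mQ (ext0_measurable cf) b QN (@ext0_out f)).
  by apply: eq_ip => p Qp; rewrite ext0_in.
have [-> -> ->] := adm_ip hR1 hR12 he0 he1 av.
rewrite !cells// -big_split /= mulr_sumr -big_split /=.
apply: ler_sum => -[i k] _; apply: le_trans (cell_friedrichs av h0 (erefl _ : cell h (i, k) = strip h i `*` strip h k)) _.
apply: lerD; last first.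
  by rewrite ler_wpM2r// addr_ge0 ?ip_ge0.
rewrite le_eqVlt; apply/orP; left; apply/eqP; congr (_ ^+ 2).
rewrite (ip_Om hR1 hR12 he0 he1); last first.
  by move=> p Qp nO; have [-> _ _] := adm_crack hR1 hR12 he0 he1 av Qp nO; rewrite mul0r.
have sq : sqint leb2 (cell (N := N) h (i, k)) (ext0 v).
  have [M b] := ext0_bounded c0.
  exact: (bounded_sqint (measurable_cell h (i, k)) (cell_finite h0 (i, k))
    (measurable_funTS (ext0_measurable c0)) (fun p _ => b p)).
have s1 : sqint leb2 (cell (N := N) h (i, k)) (cst 1).
  apply: (bounded_sqint (M := 1) (measurable_cell h (i, k)) (cell_finite h0 (i, k))) => //.
  by move=> p _; rewrite normr1.
have := ip_linl (measurable_cell h (i, k)) h^-1 0 sq sq s1; rewrite mul0r addr0 => <-.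
rewrite /ip Rintegral_mkcond [RHS]Rintegral_mkcond; apply: eq_Rintegral => p _.
rewrite /patch indicE; have [pQ|pQ] := boolP (p \in Q).
  case: ifP => _; rewrite /= ?mulr0// mulr1 mul0r addr0 mulr1 mulrC ext0_in//.
  by move: pQ; rewrite inE.
by case: ifP => // _; rewrite ext0_out ?mulr0 ?mul0r ?addr0 ?mul0r//; move: pQ; rewrite notin_setE.
Qed.

End Friedrichs.

(** * Cutoff functions *)

Section Pos2.
Context {R : realType}.
Implicit Types t x : R.

(** The simplest function of class C^1 that vanishes on a half line only; the
cutoffs are built from it. *)
Definition pos2 t : R := Num.max t 0 ^+ 2.

Lemma has_deriv_flat (f : R -> R) x : (forall t, `|f t - f x| <= (t - x) ^+ 2) ->
  has_deriv f x 0.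
Proof.
move=> H; rewrite /has_deriv.
have c : h^-1 *: (f (h *: 1 + x) - f x) @[h --> 0^'] --> (0 : R).
  apply/cvgr0Pnorm_le => e e0; near=> h.
  have hn : h != 0 by near: h; exact: nbhs_dnbhs_neq.
  have he : `|h| <= e.
    near: h; apply: dnbhs0_le; exact: e0.
  rewrite normrZ normfV /GRing.scale /= mulr1.
  rewrite ler_pdivrMl ?normr_gt0//; apply: le_trans (H _) _.
  by rewrite addrK -(real_normK (num_real h)) expr2 ler_wpM2l.
by split; [apply/cvg_ex; exists 0|apply/cvg_lim].
Unshelve. all: end_near.
Qed.

Lemma has_deriv_pos2 x : has_deriv pos2 x (2 * Num.max x 0).
Proof.
have [x0|x0|->] := ltgtP x 0.
- rewrite ?(max_idPr (ltW x0)) mulr0; apply: has_deriv_near (has_deriv_cst 0 x).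
  have := lt_nbhsl x0; apply: filterS => t t0.
  by rewrite /pos2 (max_idPr (ltW t0)) expr0n.
- rewrite ?(max_idPl (ltW x0)).
  have h : has_deriv (fun t => t ^+ 2) x (2 * x).
    by apply: has_deriv_eq (has_derivX2 (has_deriv_id x)) _; rewrite mulr1.
  apply: has_deriv_near h; have := lt_nbhsr x0; apply: filterS => t t0.
  by rewrite /pos2 (max_idPl (ltW t0)).
- rewrite ?maxxx mulr0; apply: has_deriv_flat => t.
  rewrite /pos2 maxxx expr0n /= !subr0 normrX ger0_norm ?le_max ?lexx ?orbT//.
  have [t0|t0] := leP t 0; first by rewrite expr0n sqr_ge0.
  by [].
Qed.

Lemma continuous_pos2 : continuous pos2.
Proof. by move=> x; exact: has_deriv_continuous (has_deriv_pos2 x). Qed.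

Lemma pos2_ge0 t : 0 <= pos2 t. Proof. exact: sqr_ge0. Qed.

Lemma pos2_le0 t : t <= 0 -> pos2 t = 0.
Proof. by move=> t0; rewrite /pos2 (max_idPr t0) expr0n. Qed.

Lemma pos2_ge0E t : 0 <= t -> pos2 t = t ^+ 2.
Proof. by move=> t0; rewrite /pos2 (max_idPl t0). Qed.

Lemma max0_le t (a : R) : 0 <= a -> t <= a -> 0 <= Num.max t 0 <= a.
Proof. by move=> a0 ta; rewrite le_max lexx orbT /= ge_max ta a0. Qed.

Lemma pos2_le t (a : R) : 0 <= a -> t <= a -> pos2 t <= a ^+ 2.
Proof.
by move=> a0 ta; have /andP[m0 ma] := max0_le a0 ta; rewrite /pos2 ler_pXn2r ?nnegrE.
Qed.

End Pos2.

Section Cutoff.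
Context {R : realType}.
Variables (R1 A : R).
Hypothesis A0 : 0 < A.

(** Scaled squared distance to the top end of the circle carrying the crack. *)
Definition rho (p : R * R) : R := (p.1 ^+ 2 + (p.2 - R1) ^+ 2) / A ^+ 2.
(** It is 0 where [rho <= 1] and 1 where [rho >= 2]. *)
Definition cutoff (p : R * R) : R := pos2 (1 - pos2 (2 - rho p)).
Definition cutoff' (p : R * R) : R :=
  2 * Num.max (1 - pos2 (2 - rho p)) 0 * (2 * Num.max (2 - rho p) 0).
Definition cutoff1 (p : R * R) : R := cutoff' p * (2 * p.1 / A ^+ 2).
Definition cutoff2 (p : R * R) : R := cutoff' p * (2 * (p.2 - R1) / A ^+ 2).

Let A2 : 0 < A ^+ 2. Proof. exact: exprn_gt0. Qed.

Lemma rho_ge0 p : 0 <= rho p.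
Proof. by rewrite divr_ge0 ?(ltW A2)// addr_ge0 ?sqr_ge0. Qed.

Lemma continuous_rho : continuous rho.
Proof. by rewrite /rho; cts. Qed.

Lemma continuous_cutoff : continuous cutoff.
Proof.
rewrite /cutoff; apply: cts_comp; first exact: continuous_pos2.
apply: ctsD; first exact: cts_cst.
apply: ctsN; apply: cts_comp; first exact: continuous_pos2.
by apply: ctsD; [exact: cts_cst|apply: ctsN; exact: continuous_rho].
Qed.

Let c' : continuous cutoff'.
Proof.
have c1 : continuous (fun p => 2 - rho p).
  by apply: ctsD; [exact: cts_cst|apply: ctsN; exact: continuous_rho].
have c2 : continuous (fun p => 1 - pos2 (2 - rho p)).
  by apply: ctsD; [exact: cts_cst|apply: ctsN; apply: cts_comp => //; exact: continuous_pos2].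
exact: (ctsM (ctsM (@cts_cst _ _ 2) (cts_max c2 (@cts_cst _ _ 0)))
  (ctsM (@cts_cst _ _ 2) (cts_max c1 (@cts_cst _ _ 0)))).
Qed.

Lemma continuous_cutoff1 : continuous cutoff1. Proof. by rewrite /cutoff1; cts. Qed.
Lemma continuous_cutoff2 : continuous cutoff2. Proof. by rewrite /cutoff2; cts. Qed.

Let chain (r : R -> R) (x r' : R) : has_deriv r x r' ->
  has_deriv (fun t => pos2 (1 - pos2 (2 - r t))) x
    (2 * Num.max (1 - pos2 (2 - r x)) 0 * (2 * Num.max (2 - r x) 0) * r').
Proof.
move=> hr.
have h1 : has_deriv (fun t => 2 - r t) x (- r').
  by apply: has_deriv_eq (has_derivD (has_deriv_cst 2 x) (has_derivN hr)) _; rewrite add0r.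
have h2 := has_deriv_comp h1 (has_deriv_pos2 (2 - r x)).
have h3 := has_derivD (has_deriv_cst 1 x) (has_derivN h2).
apply: has_deriv_eq (has_deriv_comp h3 (has_deriv_pos2 _)) _; ring.
Qed.

Lemma deriv_cutoff1 p : has_deriv (fun t => cutoff (t, p.2)) p.1 (cutoff1 p).
Proof.
have h : has_deriv (fun t => rho (t, p.2)) p.1 (2 * p.1 / A ^+ 2).
  rewrite /rho /=; apply: has_deriv_eq (has_derivM (has_derivD (has_derivX2 (has_deriv_id p.1))
    (has_deriv_cst _ _)) (has_deriv_cst _ _)) _; ring.
by have := chain h; rewrite -surjective_pairing.
Qed.

Lemma deriv_cutoff2 p : has_deriv (fun t => cutoff (p.1, t)) p.2 (cutoff2 p).
Proof.
have h : has_deriv (fun t => rho (p.1, t)) p.2 (2 * (p.2 - R1) / A ^+ 2).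
  rewrite /rho /=; apply: has_deriv_eq (has_derivM (has_derivD (has_deriv_cst _ _)
    (has_derivX2 (has_derivD (has_deriv_id p.2) (has_deriv_cst _ _)))) (has_deriv_cst _ _)) _; ring.
by have := chain h; rewrite -surjective_pairing.
Qed.

Lemma cutoff_ge0 p : 0 <= cutoff p. Proof. exact: pos2_ge0. Qed.

Lemma cutoff_le1 p : cutoff p <= 1.
Proof. by rewrite -[leRHS](expr1n _ 2); apply: pos2_le => //; rewrite gerBl pos2_ge0. Qed.

Lemma cutoff_in p : rho p <= 1 -> cutoff p = 0.
Proof.
move=> r1; apply: pos2_le0; rewrite subr_le0 pos2_ge0E; last lra.
by rewrite -[leLHS](expr1n _ 2) ler_pXn2r ?nnegrE//; lra.
Qed.

Lemma cutoff_out p : 2 <= rho p -> cutoff p = 1.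
Proof. by move=> r2; rewrite /cutoff (@pos2_le0 _ (2 - rho p)) ?subr0 ?pos2_ge0E ?expr1n// subr_le0. Qed.

Lemma cutoff'_bound p : 0 <= cutoff' p <= 8.
Proof.
have /andP[a0 a1] : 0 <= Num.max (1 - pos2 (2 - rho p)) 0 <= 1.
  by apply: max0_le => //; rewrite gerBl pos2_ge0.
have /andP[b0 b1] : 0 <= Num.max (2 - rho p) 0 <= 2.
  by apply: max0_le => //; rewrite gerBl rho_ge0.
rewrite /cutoff' !mulr_ge0//=; nra.
Qed.

Lemma cutoff'_out p : 2 <= rho p -> cutoff' p = 0.
Proof. by move=> r2; rewrite /cutoff' (@max_idPr _ _ (2 - rho p) 0 _) ?mulr0// subr_le0. Qed.

(** Since [x] is at most of the order of [A] where the gradient of the cutoff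
lives, its size [1 / A] is compensated. *)
Lemma cutoff_grad_bound p :
  p.1 ^+ 2 * cutoff1 p ^+ 2 <= 64 * 16 /\ p.1 ^+ 2 * cutoff2 p ^+ 2 <= 64 * 16.
Proof.
have [r2|r2] := leP 2 (rho p).
  rewrite /cutoff1 /cutoff2 cutoff'_out// !mul0r expr0n /= mulr0.
  by rewrite mulr_ge0.
have /andP[k0 k8] := cutoff'_bound p.
have xy : p.1 ^+ 2 + (p.2 - R1) ^+ 2 <= 2 * A ^+ 2.
  by move: r2; rewrite /rho ltr_pdivrMr// => /ltW.
have x2 := sqr_ge0 p.1; have y2 := sqr_ge0 (p.2 - R1).
have k2 : cutoff' p ^+ 2 <= 64.
  by rewrite (_ : 64 = 8 ^+ 2); [rewrite ler_pXn2r ?nnegrE|ring].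
have key z : 0 <= z ^+ 2 -> z ^+ 2 <= 2 * A ^+ 2 -> 
    p.1 ^+ 2 * (cutoff' p * (2 * z / A ^+ 2)) ^+ 2 <= 64 * 16.
  move=> z0 z2.
  have -> : p.1 ^+ 2 * (cutoff' p * (2 * z / A ^+ 2)) ^+ 2 =
     cutoff' p ^+ 2 * ((p.1 ^+ 2 * (4 * z ^+ 2)) / (A ^+ 2 * A ^+ 2)).
    by field; exact: lt0r_neq0.
  have h : p.1 ^+ 2 * (4 * z ^+ 2) / (A ^+ 2 * A ^+ 2) <= 16.
    rewrite ler_pdivrMr ?mulr_gt0//.
    have : p.1 ^+ 2 * (4 * z ^+ 2) <= (2 * A ^+ 2) * (4 * (2 * A ^+ 2)).
      by apply: ler_pM => //; lra.
    lra.
  have h0 : 0 <= p.1 ^+ 2 * (4 * z ^+ 2) / (A ^+ 2 * A ^+ 2).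
    apply: divr_ge0; apply: mulr_ge0; rewrite ?sqr_ge0//.
    by apply: mulr_ge0 => //; exact: sqr_ge0.
  by apply: ler_pM => //; exact: sqr_ge0.
by split; apply: key => //; lra.
Qed.

Lemma cutoff_grad_out p : 2 <= rho p -> cutoff1 p = 0 /\ cutoff2 p = 0.
Proof. by move=> r2; rewrite /cutoff1 /cutoff2 cutoff'_out// !mul0r. Qed.

End Cutoff.

Section Truncation.
Context {R : realType}.
Variable e : R.
Hypothesis e0 : 0 < e.
Implicit Types t : R.

(** [t * trunc t] vanishes for [t <= e] and tends to [t] as [e] tends to 0; its
derivative is [trunc t] up to [t * trunc' t], which stays bounded and tends to 0
for each [t]. *)
Definition trunc t : R := pos2 (t - e) / (t ^+ 2 + e ^+ 2).
Definition trunc' t : R := 2 * Num.max (t - e) 0 / (t ^+ 2 + e ^+ 2)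
  - pos2 (t - e) * (2 * t) / (t ^+ 2 + e ^+ 2) ^+ 2.

Lemma trunc_den t : 0 < t ^+ 2 + e ^+ 2.
Proof. by rewrite ltr_wpDl ?sqr_ge0// exprn_gt0. Qed.

Lemma deriv_trunc t : has_deriv trunc t (trunc' t).
Proof.
have h1 : has_deriv (fun t => t - e) t 1.
  by apply: has_deriv_eq (has_derivD (has_deriv_id t) (has_deriv_cst (- e) t)) _; rewrite addr0.
have h2 := has_deriv_comp h1 (has_deriv_pos2 (t - e)).
have h3 := has_derivD (has_derivX2 (has_deriv_id t)) (has_deriv_cst (e ^+ 2) t).
have n0 : t ^+ 2 + e ^+ 2 != 0 by rewrite gt_eqF// trunc_den.
have h4 := has_derivV (f := fun t => t ^+ 2 + e ^+ 2) n0 h3.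
apply: has_deriv_eq (has_derivM h2 h4) _; rewrite /trunc' /=.
by move: n0; set D := t ^+ 2 + e ^+ 2; move=> n0; field.
Qed.

Lemma continuous_trunc : continuous trunc.
Proof. by move=> t; exact: has_deriv_continuous (deriv_trunc t). Qed.

Lemma continuous_trunc' : continuous trunc'.
Proof.
have cd : continuous (fun t => (t ^+ 2 + e ^+ 2)^-1).
  apply: ctsV; first by move=> t; rewrite gt_eqF// trunc_den.
  by apply: ctsD; [apply: ctsX; move=> t; exact: cvg_id|exact: cts_cst].
have ci : continuous (fun t : R => t) by move=> t; exact: cvg_id.
have ct : continuous (fun t : R => t - e) by apply: ctsD => //; exact: cts_cst.
have cm : continuous (fun t : R => Num.max (t - e) 0) by apply: cts_max => //; exact: cts_cst.
have cp : continuous (fun t : R => pos2 (t - e)) by apply: cts_comp => //; exact: continuous_pos2.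
rewrite /trunc'; apply: ctsD.
  by apply: ctsM => //; apply: ctsM => //; exact: cts_cst.
apply: ctsN; apply: ctsM; first by apply: ctsM => //; apply: ctsM => //; exact: cts_cst.
by under eq_fun do rewrite -exprVn; exact: ctsX.
Qed.

Lemma trunc_small t : t <= e -> trunc t = 0 /\ trunc' t = 0.
Proof.
move=> te; have t0 : t - e <= 0 by rewrite subr_le0.
by rewrite /trunc /trunc' pos2_le0// (max_idPr t0) mulr0 !mul0r subr0.
Qed.

Lemma trunc_ge0 t : 0 <= trunc t.
Proof. by rewrite divr_ge0 ?pos2_ge0// ltW// trunc_den. Qed.

Lemma trunc_le1 t : 0 <= t -> trunc t <= 1.
Proof.
move=> t0; rewrite ler_pdivrMr ?trunc_den// mul1r.
have : pos2 (t - e) <= t ^+ 2 by apply: pos2_le => //; rewrite gerBl ltW.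
by move=> h; apply: le_trans h _; rewrite lerDl sqr_ge0.
Qed.

Lemma trunc_large t : 2 * e <= t -> 5^-1 <= trunc t.
Proof.
move=> te; have e0' := e0; rewrite ler_pdivlMr ?trunc_den// pos2_ge0E; last lra.
nra.
Qed.

(** A bound for [(t * trunc' t) ^+ 2] with a simple limit and a uniform
bound. *)
Definition trunc_err t : R := (2 * e * t / (t ^+ 2 + e ^+ 2)) ^+ 2.

Lemma trunc'_bound t : 0 <= t -> (t * trunc' t) ^+ 2 <= trunc_err t.
Proof.
move=> t0; have [te|te] := leP t e.
  by have [_ ->] := trunc_small te; rewrite mulr0 expr0n sqr_ge0.
have d0 := trunc_den t; set D := t ^+ 2 + e ^+ 2 in d0 *.
have -> : t * trunc' t = 2 * e * t * (t ^+ 2 - e ^+ 2) / D ^+ 2.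
  rewrite /trunc' pos2_ge0E ?subr_ge0 ?(ltW te)// (max_idPl _) ?subr_ge0 ?(ltW te)// -/D.
  have -> : 2 * (t - e) / D = 2 * (t - e) * D / D ^+ 2 by field; exact: lt0r_neq0.
  by rewrite {1}/D; field; exact: lt0r_neq0.
rewrite /trunc_err -/D.
have -> : 2 * e * t * (t ^+ 2 - e ^+ 2) / D ^+ 2 = (2 * e * t / D) * ((t ^+ 2 - e ^+ 2) / D).
  by field; exact: lt0r_neq0.
rewrite exprMn -[leRHS]mulr1 ler_wpM2l ?sqr_ge0//.
have h0 : 0 <= (t ^+ 2 - e ^+ 2) / D.
  by rewrite divr_ge0 ?(ltW d0)// subr_ge0 ler_pXn2r ?nnegrE ?(ltW e0)// ltW.
rewrite expr_le1// ler_pdivrMr// mul1r /D; have := sqr_ge0 e; lra.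
Qed.

Lemma trunc_err_le1 t : 0 <= t -> trunc_err t <= 1.
Proof.
move=> t0; have d0 := trunc_den t; rewrite /trunc_err expr_le1//; last first.
  by rewrite divr_ge0 ?(ltW d0)// !mulr_ge0// ltW.
by rewrite ler_pdivrMr// mul1r; have := sqr_ge0 (t - e); lra.
Qed.

Lemma trunc_err_ge0 t : 0 <= trunc_err t. Proof. exact: sqr_ge0. Qed.

Lemma trunc_err_small t : 0 < t -> trunc_err t <= e ^+ 2 * (2 / t) ^+ 2.
Proof.
move=> t0; have d0 := trunc_den t.
have et : 0 <= 2 * e * t by rewrite !mulr_ge0 ?(ltW e0) ?(ltW t0).
have h0 : 0 <= 2 * e * t / (t ^+ 2 + e ^+ 2) by rewrite divr_ge0 ?(ltW d0).
have h1 : 2 * e * t / (t ^+ 2 + e ^+ 2) <= e * (2 / t).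
  have -> : e * (2 / t) = 2 * e * t / t ^+ 2 by field; exact: lt0r_neq0.
  by rewrite ler_wpM2l// lef_pV2 ?posrE ?exprn_gt0// lerDl sqr_ge0.
by rewrite /trunc_err -exprMn ler_pXn2r ?nnegrE// (le_trans h0).
Qed.

Lemma continuous_trunc_err : continuous trunc_err.
Proof.
have cd : continuous (fun t => (t ^+ 2 + e ^+ 2)^-1).
  apply: ctsV; first by move=> t; rewrite gt_eqF// trunc_den.
  by apply: ctsD; [apply: ctsX; move=> t; exact: cvg_id|exact: cts_cst].
have ci : continuous (fun t : R => t) by move=> t; exact: cvg_id.
by apply: ctsX; apply: ctsM => //; apply: ctsM => //; exact: cts_cst.
Qed.

End Truncation.

(** * Trial functions *)

Section BoxEstimates.
Context {R : realType}.
Variable R2 : R.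
Hypothesis R20 : 0 < R2.
Local Notation Q := (quarter R2 : set (mplane R)).
Local Notation leb2 := (@lebesgue2 R).

Definition box (a b c d : R) : set (mplane R) := `[a, b] `*` `[c, d].

Lemma measurable_box a b c d : measurable (box a b c d).
Proof. by apply: measurable_rect; exact: measurable_itv. Qed.

Lemma box_area a b c d : a < b -> c < d -> leb2 (box a b c d) = ((b - a) * (d - c))%:E.
Proof.
move=> ab cd; rewrite /box lebesgue2_rect; [|exact: measurable_itv..].
by rewrite !lebesgue_measure_itv /= !lte_fin ab cd -!EFinD -EFinM.
Qed.

Lemma integral_le_box (f : R * R -> R) (K a b c d : R) : continuous f -> a < b -> c < d ->
  0 <= K -> (forall p, Q p -> f p <= K) -> (forall p, Q p -> ~ box a b c d p -> f p <= 0) ->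
  \int[leb2]_(p in Q) f p <= K * ((b - a) * (d - c)).
Proof.
move=> cf ab cd K0 fK f0.
have mQ := @measurable_quarter R R2; have mB := measurable_box a b c d.
have fB : (leb2 (box a b c d) < +oo)%E by rewrite box_area// ltry.
have mg (D : set (mplane R)) : measurable_fun D (fun p : mplane R => K * \1_(box a b c d) p).
  by apply: measurable_funM => //; exact: measurable_indic.
have bg p : `|K * \1_(box a b c d) p| <= K.
  rewrite normrM ger0_norm// ler_piMr//.
  by rewrite indicE; case: (_ \in _); rewrite ?normr1// normr0.
have ig : leb2.-integrable Q (EFin \o (fun p => K * \1_(box a b c d) p)).
  by apply: (bounded_integrable mQ (quarter_finite R20) (mg _)) => p _; exact: bg.
apply: (@le_trans _ _ (\int[leb2]_(p in Q) (K * \1_(box a b c d) p))).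
  apply: le_Rintegral => //; first exact: (continuous_integrable R20 mQ (fun _ h => h) cf).
  move=> p Qp; rewrite indicE; have [h|h] := boolP (p \in box a b c d).
    by rewrite mulr1 fK.
  by rewrite mulr0; apply: f0 => //; move: h; rewrite notin_setE.
rewrite -lee_fin /Rintegral fineK; last exact: integrable_fin_num.
rewrite EFinM -box_area// -[leRHS]integral_cst//.
rewrite integral_mkcond [leRHS]integral_mkcond; apply: ge0_le_integral => //.
- by move=> p _; apply: erestrict_ge0 => q _; rewrite lee_fin mulr_ge0// indicE; case: (_ \in _).
- by apply/(measurable_restrictT _ _).1 => //; apply/measurable_EFinP.
- by apply/(measurable_restrictT _ _).1.
- move=> p _; rewrite /patch indicE; have [pB|pB] := boolP (p \in box a b c d).
    by case: ifP => _; rewrite lee_fin ?mulr1.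
  by case: ifP => _; rewrite lee_fin ?mulr0.
Qed.

Lemma integral_ge_box (f : R * R -> R) (K a b c d : R) : continuous f -> a < b -> c < d ->
  0 <= K -> (forall p, Q p -> 0 <= f p) -> box a b c d `<=` Q ->
  (forall p, box a b c d p -> K <= f p) ->
  K * ((b - a) * (d - c)) <= \int[leb2]_(p in Q) f p.
Proof.
move=> cf ab cd K0 f0 BQ fK.
have mQ := @measurable_quarter R R2; have mB := measurable_box a b c d.
rewrite -lee_fin /Rintegral fineK; last first.
  by apply: integrable_fin_num => //; exact: (continuous_integrable R20 mQ (fun _ h => h) cf).
rewrite EFinM -box_area// -[leLHS]integral_cst//.
apply: (@le_trans _ _ (\int[leb2]_(p in box a b c d) (f p)%:E)%E).
  apply: ge0_le_integral => //.
  by apply/measurable_EFinP; exact: continuous_measurable2.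
apply: ge0_subset_integral => //.
by apply/measurable_EFinP; exact: continuous_measurable2.
Qed.

Lemma box_positive (f : R * R -> R) (a b c d : R) : continuous f ->
  (forall p, box a b c d p -> 0 < f p) ->
  exists2 k, 0 < k & forall p, box a b c d p -> k <= f p.
Proof.
move=> cf f0.
have K : near_covering (box a b c d : set (R * R)).
  by apply/compact_near_coveringP; apply: compact_setX; exact: segment_compact.
have := K R (0 : R)^'+ (fun e p => e <= f p) _ _; case.
  move=> p Bp; have fp := f0 p Bp.
  exists ([set q | f p / 2 < f q], [set e | e < f p / 2]) => /=.
    split; last by apply: nbhs_right_lt; rewrite divr_gt0.
    by have := cf p => /cvgr_gt; apply; rewrite ltr_pdivrMr// ltr_pMr// ltr1n.
  by move=> [q e] /= [h1 h2]; exact: ltW (lt_trans h2 h1).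
move=> e /= e0 H; exists (e / 2); first by rewrite divr_gt0.
move=> p Bp; apply: (H (e / 2)) => //=; last by rewrite divr_gt0.
by rewrite sub0r normrN gtr0_norm ?divr_gt0// ltr_pdivrMr// ltr_pMr// ltr1n.
Qed.

End BoxEstimates.

Section UpperBound.
Context {R : realType}.
Variables (R1 R2 : R).
Hypotheses (hR1 : 0 < R1) (hR12 : R1 < R2).
Local Notation Q := (quarter R2).
Local Notation leb2 := (@lebesgue2 R).
Local Notation phi := (phi R2).
Local Notation phi1 := (phi1 R2).
Local Notation phi2 := (phi2 R2).
Let R20 : 0 < R2. Proof. exact: lt_trans hR12. Qed.

Local Notation a := (R1 / 8).
Let a0 : 0 < a. Proof. by rewrite divr_gt0. Qed.
(** A square that every crack avoids. *)
Definition core : set (mplane R) := box a (2 * a) a (2 * a).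
Local Notation B := core.

Lemma coreP p : B p -> [/\ a <= p.1, p.1 <= 2 * a, a <= p.2 & p.2 <= 2 * a].
Proof. by rewrite /core /box => -[] /=; rewrite !in_itv /= => /andP[? ?] /andP[? ?]. Qed.

Lemma core_sqn p : B p -> sqn p < R1 ^+ 2.
Proof.
move=> /coreP[x1 x2 y1 y2]; rewrite /sqn; have := hR1 => h0; have : p.1 ^+ 2 <= (2 * a) ^+ 2 by rewrite ler_pXn2r ?nnegrE//; lra.
have : p.2 ^+ 2 <= (2 * a) ^+ 2 by rewrite ler_pXn2r ?nnegrE//; lra.
by have := exprn_gt0 2 hR1; lra.
Qed.

Lemma core_sub : B `<=` Q.
Proof.
move=> p Bp; have [x1 x2 y1 y2] := coreP Bp; split.
- exact: lt_le_trans x1.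
- exact: lt_le_trans y1.
- by apply: lt_trans (core_sqn Bp) _; rewrite ltr_pXn2r ?nnegrE ?(ltW hR1) ?(ltW R20).
Qed.

(** A product of bumps supported in [core]: one function that is admissible for
every crack, for use when the crack is long. *)
Definition bubble1 (t : R) : R := pos2 (t - a) * pos2 (2 * a - t).
Definition bubble1' (t : R) : R :=
  2 * Num.max (t - a) 0 * pos2 (2 * a - t) - pos2 (t - a) * (2 * Num.max (2 * a - t) 0).
Definition bubble (p : R * R) : R := bubble1 p.1 * bubble1 p.2.

Let ci : continuous (fun t : R => t). Proof. by move=> t; exact: cvg_id. Qed.

Let cp1 : continuous (fun t : R => pos2 (t - a)).
Proof.
by apply: cts_comp; [exact: continuous_pos2|apply: ctsD; [exact: ci|exact: cts_cst]].
Qed.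

Let cp2 : continuous (fun t : R => pos2 (2 * a - t)).
Proof.
by apply: cts_comp; [exact: continuous_pos2|apply: ctsD; [exact: cts_cst|exact: ctsN ci]].
Qed.

Let c_bubble1 : continuous bubble1. Proof. exact: ctsM cp1 cp2. Qed.

Let c_bubble1' : continuous bubble1'.
Proof.
apply: ctsD.
  apply: ctsM cp2; apply: ctsM; first exact: cts_cst.
  by apply: cts_max; [apply: ctsD; [exact: ci|exact: cts_cst]|exact: cts_cst].
apply: ctsN; apply: ctsM; first exact: cp1.
apply: ctsM; first exact: cts_cst.
by apply: cts_max; [apply: ctsD; [exact: cts_cst|exact: ctsN ci]|exact: cts_cst].
Qed.

Let d_bubble1 t : has_deriv bubble1 t (bubble1' t).
Proof.
have h1 : has_deriv (fun t => t - a) t 1.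
  by apply: has_deriv_eq (has_derivD (has_deriv_id t) (has_deriv_cst (- a) t)) _; rewrite addr0.
have h2 : has_deriv (fun t => 2 * a - t) t (- 1).
  by apply: has_deriv_eq (has_derivD (has_deriv_cst (2 * a) t) (has_derivN (has_deriv_id t))) _; rewrite add0r.
apply: has_deriv_eq (has_derivM (has_deriv_comp h1 (has_deriv_pos2 _)) (has_deriv_comp h2 (has_deriv_pos2 _))) _.
rewrite /bubble1'; ring.
Qed.

Let bubble1_out t : t <= a \/ 2 * a <= t -> bubble1 t = 0.
Proof.
move=> [h|h]; rewrite /bubble1.
  by rewrite (@pos2_le0 _ (t - a)) ?subr_le0// mul0r.
by rewrite (@pos2_le0 _ (2 * a - t)) ?subr_le0// mulr0.
Qed.

Let bubble_C1 : [/\ C1 bubble, partial1 bubble = (fun p => bubble1' p.1 * bubble1 p.2) &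
  partial2 bubble = (fun p => bubble1 p.1 * bubble1' p.2)].
Proof.
apply: C1_of_partials => [p|p||].
- apply: has_deriv_eq (has_derivM (d_bubble1 p.1) (has_deriv_cst (bubble1 p.2) _)) _; ring.
- apply: has_deriv_eq (has_derivM (has_deriv_cst (bubble1 p.1) _) (d_bubble1 p.2)) _; ring.
- by apply: ctsM; apply: cts_comp => //; [exact: cts_fst|exact: cts_snd].
- by apply: ctsM; apply: cts_comp => //; [exact: cts_fst|exact: cts_snd].
Qed.

Let closed_B : closed (B : set (R * R)).
Proof.
have -> : B = [set p | a <= p.1] `&` [set p | p.1 <= 2 * a] `&`
    [set p | a <= p.2] `&` [set p | p.2 <= 2 * a] :> set (R * R).
  apply/seteqP; split=> p; first by move=> /coreP[].
  by move=> [[[? ?] ?] ?]; split; rewrite /= in_itv /=; apply/andP.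
by do 3 ?apply: closedI; [exact: closed_fun_ge cts_fst|exact: closed_fun_le cts_fst|
  exact: closed_fun_ge cts_snd|exact: closed_fun_le cts_snd].
Qed.

Let bubble_out p : ~ B p -> bubble p = 0.
Proof.
move=> nB; rewrite /bubble.
have [x1|x1] := leP p.1 a; first by rewrite (@bubble1_out p.1) ?mul0r//; left.
have [x2|x2] := leP (2 * a) p.1; first by rewrite (@bubble1_out p.1) ?mul0r//; right.
have [y1|y1] := leP p.2 a; first by rewrite (@bubble1_out p.2) ?mulr0//; left.
have [y2|y2] := leP (2 * a) p.2; first by rewrite (@bubble1_out p.2) ?mulr0//; right.
by exfalso; apply: nB; split; rewrite /= in_itv /= !ltW.
Qed.

Lemma bubble_adm (eps : R) : 0 < eps -> eps < pi / 2 -> adm R1 R2 eps bubble.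
Proof.
move=> e0 e1; have [Cb _ _] := bubble_C1; split => // p /(DE hR1 hR12 e0 e1)[_ h].
have nB : ~ B p.
  move=> Bp; have [x1 _ _ _] := coreP Bp; have s := core_sqn Bp; case: h => [x|[s'|[s' _]]].
  - by move: x1; rewrite x leNgt a0.
  - move: s; rewrite s' ltNge ler_pXn2r ?nnegrE ?(ltW hR1) ?(ltW R20)//.
    by rewrite (ltW hR12).
  - by move: s; rewrite s' ltxx.
have : \forall q \near p, (~` B) q.
  by apply: open_nbhs_nbhs; split => //; exact: closed_openC.
by apply: filterS => q; exact: bubble_out.
Qed.

Let ipQ := ip leb2 (Q : set (mplane R)).

Lemma bubble_pos : 0 < ipQ bubble bubble.
Proof.
have [Cb _ _] := bubble_C1; have cb := C1_continuous Cb.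
have [b b0 bE] : exists2 b : R, 0 < b & 4 * b = a by exists (a / 4); [rewrite divr_gt0|field].
have a0' := a0.
have -> : ipQ bubble bubble = \int[leb2]_(p in Q) (bubble p ^+ 2).
  by apply: eq_Rintegral => p _; rewrite expr2.
have := @integral_ge_box _ _ R20 (fun p => bubble p ^+ 2) (((b ^+ 2 * b ^+ 2) * (b ^+ 2 * b ^+ 2)) ^+ 2)
  (a + b) (2 * a - b) (a + b) (2 * a - b).
have inb t : a + b <= t <= 2 * a - b -> b ^+ 2 * b ^+ 2 <= bubble1 t.
  move=> /andP[t1 t2]; apply: ler_pM; rewrite ?sqr_ge0//.
    by rewrite pos2_ge0E ?ler_pXn2r ?nnegrE//; lra.
  by rewrite pos2_ge0E ?ler_pXn2r ?nnegrE//; lra.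
have bb : 0 < b ^+ 2 * b ^+ 2 by rewrite mulr_gt0 ?exprn_gt0.
have ab : a + b < 2 * a - b by lra.
move=> /(_ (@ctsX _ _ bubble 2 cb) ab ab (sqr_ge0 _)) H.
apply: lt_le_trans (H _ _ _).
- by rewrite !mulr_gt0 ?exprn_gt0 ?subr_gt0// mulr_gt0.
- by move=> p _; exact: sqr_ge0.
- move=> p [] /=; rewrite !in_itv /= => /andP[x1 x2] /andP[y1 y2]; apply: core_sub.
  rewrite /core /box; split; rewrite /= in_itv /=; apply/andP; split; lra.
- move=> p [] /=; rewrite !in_itv /= => xx yy.
  have h : (b ^+ 2 * b ^+ 2) * (b ^+ 2 * b ^+ 2) <= bubble p.
    by apply: ler_pM; rewrite ?(ltW bb)//; exact: inb.
  rewrite ler_pXn2r ?nnegrE//; first by rewrite mulr_ge0 ?(ltW bb).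
  by apply: le_trans h; rewrite mulr_ge0 ?(ltW bb).
Qed.

Definition bubble_quotient : R :=
  (ipQ (partial1 bubble) (partial1 bubble) + ipQ (partial2 bubble) (partial2 bubble)) / ipQ bubble bubble.

Lemma bubble_bound (eps L : R) : 0 < eps -> eps < pi / 2 ->
  (forall v, adm R1 R2 eps v -> L * ip leb2 (cracked_sector R1 R2 eps) v v <=
     ip leb2 (cracked_sector R1 R2 eps) (partial1 v) (partial1 v) +
     ip leb2 (cracked_sector R1 R2 eps) (partial2 v) (partial2 v)) ->
  L <= bubble_quotient.
Proof.
move=> e0 e1 H; have ab := bubble_adm e0 e1; have := H _ ab.
have [-> -> ->] := adm_ip hR1 hR12 e0 e1 ab.
by rewrite -ler_pdivlMr// bubble_pos.
Qed.

Section Trial.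
Variables (A e : R).
Hypotheses (A0 : 0 < A) (e0 : 0 < e).

(** The ground state of the quarter disc, made to vanish near the Dirichlet
boundary by [trunc] and near the crack by [cutoff]; [A] is of the order of the
length of the crack. *)
Definition trial (p : R * R) : R := phi p * trunc e (phi p) * cutoff R1 A p.
Definition trial1 (p : R * R) : R :=
  (phi1 p * trunc e (phi p) + phi p * (trunc' e (phi p) * phi1 p)) * cutoff R1 A p
  + phi p * trunc e (phi p) * cutoff1 R1 A p.
Definition trial2 (p : R * R) : R :=
  (phi2 p * trunc e (phi p) + phi p * (trunc' e (phi p) * phi2 p)) * cutoff R1 A p
  + phi p * trunc e (phi p) * cutoff2 R1 A p.

Let c_phi : continuous phi. Proof. exact: continuous_phi. Qed.
Let c_phi1 : continuous phi1. Proof. exact: continuous_phi1. Qed.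
Let c_phi2 : continuous phi2. Proof. exact: continuous_phi2. Qed.
Let c_t : continuous (fun p => trunc e (phi p)).
Proof. by apply: cts_comp => //; exact: continuous_trunc. Qed.
Let c_t' : continuous (fun p => trunc' e (phi p)).
Proof. by apply: cts_comp => //; exact: continuous_trunc'. Qed.
Let c_c : continuous (cutoff R1 A). Proof. exact: continuous_cutoff. Qed.

Lemma trial_C1 : [/\ C1 trial, partial1 trial = trial1 & partial2 trial = trial2].
Proof.
apply: C1_of_partials => [p|p||].
- have d := deriv_phi1 R2 p; have := has_deriv_comp d (deriv_trunc e0 _).
  rewrite -surjective_pairing => dt.
  apply: has_deriv_eq (has_derivM (has_derivM d dt) (deriv_cutoff1 R1 A p)) _.
  by rewrite -surjective_pairing.
- have d := deriv_phi2 R2 p; have := has_deriv_comp d (deriv_trunc e0 _).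
  rewrite -surjective_pairing => dt.
  apply: has_deriv_eq (has_derivM (has_derivM d dt) (deriv_cutoff2 R1 A p)) _.
  by rewrite -surjective_pairing.
- apply: ctsD; last by apply: ctsM; [exact: ctsM c_phi c_t|exact: continuous_cutoff1].
  by apply: ctsM c_c; apply: ctsD; [exact: ctsM c_phi1 c_t|exact: ctsM c_phi (ctsM c_t' c_phi1)].
- apply: ctsD; last by apply: ctsM; [exact: ctsM c_phi c_t|exact: continuous_cutoff2].
  by apply: ctsM c_c; apply: ctsD; [exact: ctsM c_phi2 c_t|exact: ctsM c_phi (ctsM c_t' c_phi2)].
Qed.

Lemma trial_small p : phi p <= e -> trial p = 0.
Proof. by move=> h; rewrite /trial (trunc_small h).1 mulr0 mul0r. Qed.

Lemma trial_adm (eps : R) : 0 < eps -> eps < pi / 2 -> A = 2 * R1 * (pi / 2 - eps) ->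
  adm R1 R2 eps trial.
Proof.
move=> ep0 ep1 Ae; have [Ct _ _] := trial_C1; split => // p /(DE hR1 hR12 ep0 ep1)[Kp h].
have [pD|[nD cp]] : (p.1 = 0 \/ sqn p = R2 ^+ 2) \/ (~ (p.1 = 0 \/ sqn p = R2 ^+ 2) /\ crack R1 eps p).
- have [?|nd] := pselect (p.1 = 0 \/ sqn p = R2 ^+ 2); [by left|right].
  by split => //; case: h => [?|[?|//]]; exfalso; apply: nd; [left|right].
- have : \forall q \near p, phi q < e.
    by have := @c_phi p => /cvgr_lt; apply; rewrite (phi_D R20 Kp pD).
  by apply: filterS => q qe; apply: trial_small; exact: ltW.
- have : \forall q \near p, rho R1 A q < 1.
    have := @continuous_rho _ R1 A p => /cvgr_lt; apply.
    rewrite /rho ltr_pdivrMr ?exprn_gt0// mul1r.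
    have x0 : 0 <= p.1 by case: Kp.
    apply: le_lt_trans (crack_near hR1 ep1 cp x0) _.
    rewrite Ae exprMn exprMn.
    have : 0 < R1 ^+ 2 * (pi / 2 - eps) ^+ 2 by rewrite mulr_gt0 ?exprn_gt0 ?subr_gt0.
    lra.
  by apply: filterS => q qe; rewrite /trial cutoff_in ?mulr0// ltW.
Qed.

Let defectE (phii : R * R -> R) (chi_i v_i : R * R -> R) p :
  v_i p = (phii p * trunc e (phi p) + phi p * (trunc' e (phi p) * phii p)) * cutoff R1 A p
    + phi p * trunc e (phi p) * chi_i p -> Q p ->
  (v_i p - trial p * phii p * (Num.max (phi p) e)^-1) ^+ 2 <=
    2 * (trunc_err e (phi p) * phii p ^+ 2) + 2 * (phi p ^+ 2 * chi_i p ^+ 2).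
Proof.
move=> -> Qp; have p0 := phi_gt0 R20 Qp.
set t := trunc e (phi p); set t' := trunc' e (phi p); set c := cutoff R1 A p.
have -> : (phii p * t + phi p * (t' * phii p)) * c + phi p * t * chi_i p -
    trial p * phii p * (Num.max (phi p) e)^-1 = (phi p * t') * phii p * c + t * (phi p * chi_i p).
  rewrite /trial -/t -/c; have [pe|pe] := leP (phi p) e.
    by rewrite /t (trunc_small pe).1; ring.
  by field; exact: lt0r_neq0.
have t0 : 0 <= t by exact: trunc_ge0.
have t1 : t <= 1 by apply: trunc_le1 => //; exact: ltW.
have c0 : 0 <= c by exact: cutoff_ge0.
have c1 : c <= 1 by exact: cutoff_le1.
have err : (phi p * t') ^+ 2 <= trunc_err e (phi p) by apply: trunc'_bound => //; exact: ltW.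
have h1 : ((phi p * t') * phii p * c) ^+ 2 <= trunc_err e (phi p) * phii p ^+ 2.
  rewrite exprMn; apply: (@le_trans _ _ ((phi p * t' * phii p) ^+ 2)).
    by apply: ler_piMr; [exact: sqr_ge0|rewrite expr_le1].
  by rewrite exprMn; apply: ler_wpM2r err; exact: sqr_ge0.
have h2 : (t * (phi p * chi_i p)) ^+ 2 <= phi p ^+ 2 * chi_i p ^+ 2.
  rewrite exprMn [(phi p * _) ^+ 2]exprMn; apply: ler_piMl; last by rewrite expr_le1.
  by apply: mulr_ge0; exact: sqr_ge0.
have := sqr_ge0 ((phi p * t') * phii p * c - t * (phi p * chi_i p)).
move: h1 h2; set X := _ * c; set Y := t * _; nra.
Qed.

Variable H0 : R.
Hypothesis H0P : forall p, cquarter R2 p -> `|clif 0 (kap R2 * sqn p)| <= H0.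

(* The ground state is at most of the order of [A] near the crack, because it
   vanishes on the axis on which the crack ends. *)
Let phi_le p : Q p -> phi p ^+ 2 <= p.1 ^+ 2 * H0 ^+ 2.
Proof.
move=> Qp; rewrite (_ : phi p = p.1 * clif 0 (kap R2 * sqn p)) // exprMn ler_wpM2l ?sqr_ge0//.
rewrite -(real_normK (num_real (clif _ _))) ler_pXn2r ?nnegrE//.
  exact/H0P/quarter_sub.
by apply: le_trans (H0P (quarter_sub Qp)).
Qed.

Let cut_int (chi_i : R * R -> R) : continuous chi_i ->
  (forall p, p.1 ^+ 2 * chi_i p ^+ 2 <= (64 * 16)) -> (forall p, 2 <= rho R1 A p -> chi_i p = 0) ->
  \int[leb2]_(p in Q) (phi p ^+ 2 * chi_i p ^+ 2) <= (64 * 16) * H0 ^+ 2 * ((4 * A) * (4 * A)).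
Proof.
move=> cc cb co.
have -> : (4 * A) * (4 * A) = ((2 * A) - (- (2 * A))) * ((R1 + 2 * A) - (R1 - 2 * A)) by ring.
apply: integral_le_box => //.
- by apply: ctsM; apply: ctsX.
- by have := A0; lra.
- by have := A0; lra.
- by rewrite mulr_ge0// sqr_ge0.
- move=> p Qp; apply: (@le_trans _ _ (p.1 ^+ 2 * H0 ^+ 2 * chi_i p ^+ 2)).
    by rewrite ler_wpM2r ?sqr_ge0// phi_le.
  by rewrite mulrAC ler_wpM2r ?sqr_ge0.
- move=> p Qp nB; rewrite co ?expr0n ?mulr0//.
  rewrite leNgt; apply/negP => r2; apply: nB.
  have : p.1 ^+ 2 + (p.2 - R1) ^+ 2 <= (2 * A) ^+ 2.
    move: r2; rewrite /rho ltr_pdivrMr ?exprn_gt0// => /ltW h; apply: le_trans h _.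
    by rewrite exprMn ler_wpM2r ?sqr_ge0//; lra.
  move=> h; have h1 : p.1 ^+ 2 <= (2 * A) ^+ 2 by have := sqr_ge0 (p.2 - R1); lra.
  have h2 : (p.2 - R1) ^+ 2 <= (2 * A) ^+ 2 by have := sqr_ge0 p.1; lra.
  have A20 : 0 <= 2 * A by rewrite mulr_ge0// ltW.
  move: h1 h2; rewrite -[X in X <= _ -> _](real_normK (num_real _)) -[X in _ -> X <= _ -> _](real_normK (num_real _)).
  rewrite !ler_pXn2r ?nnegrE// !ler_norml => /andP[? ?] /andP[? ?].
  by split; rewrite /= in_itv /=; apply/andP; split; lra.
Qed.

Definition err_int : R :=
  \int[leb2]_(p in Q) (trunc_err e (phi p) * phi1 p ^+ 2 + trunc_err e (phi p) * phi2 p ^+ 2).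

(** For [v = phi * chi] the logarithmic defect is [phi * grad chi]. The part of
[chi] near the crack contributes a term of order [A ^+ 2]: [phi] compensates the
size [1 / A] of its gradient, and the support has area of order [A ^+ 2]. *)
Lemma trial_defect :
  ipQ (log_defect1 phi phi1 trial e) (log_defect1 phi phi1 trial e) +
  ipQ (log_defect2 phi phi2 trial e) (log_defect2 phi phi2 trial e) <=
  2 * err_int + 2 * (2 * ((64 * 16) * H0 ^+ 2 * ((4 * A) * (4 * A)))).
Proof.
have mQ := @measurable_quarter R R2.
have [Ct e1 e2] := trial_C1; have ct := C1_continuous Ct; have [_ _ ct1 ct2] := Ct.
have c_m : continuous (fun p => (Num.max (phi p) e)^-1).
  apply: ctsV; first by move=> p; rewrite gt_eqF// lt_max e0 orbT.
  by apply: cts_max => //; exact: cts_cst.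
have c_e : continuous (fun p => trunc_err e (phi p)).
  by apply: cts_comp => //; exact: continuous_trunc_err.
have sq (f : R * R -> R) : continuous f -> sqint leb2 Q f.
  by move=> cf; exact: (continuous_sqint R20 mQ (fun _ h => h) cf).
have int (f : R * R -> R) : continuous f -> leb2.-integrable Q (EFin \o (f : mplane R -> R)).
  by move=> cf; exact: (continuous_integrable R20 mQ (fun _ h => h) cf).
have est (phii chi_i v_i : R * R -> R) : continuous phii -> continuous chi_i -> continuous v_i ->
    (forall p, v_i p = (phii p * trunc e (phi p) + phi p * (trunc' e (phi p) * phii p)) * cutoff R1 A p
    + phi p * trunc e (phi p) * chi_i p) ->
    ipQ (fun p => v_i p - trial p * phii p * (Num.max (phi p) e)^-1)
        (fun p => v_i p - trial p * phii p * (Num.max (phi p) e)^-1) <=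
    2 * \int[leb2]_(p in Q) (trunc_err e (phi p) * phii p ^+ 2) +
    2 * \int[leb2]_(p in Q) (phi p ^+ 2 * chi_i p ^+ 2).
  move=> cp cc cv vE.
  have c1 : continuous (fun p => trunc_err e (phi p) * phii p ^+ 2) by apply: ctsM => //; exact: ctsX.
  have c2 : continuous (fun p => phi p ^+ 2 * chi_i p ^+ 2) by apply: ctsM; exact: ctsX.
  have cd : continuous (fun p => v_i p - trial p * phii p * (Num.max (phi p) e)^-1).
    by apply: ctsD => //; apply: ctsN; apply: ctsM => //; exact: ctsM.
  rewrite -!RintegralZl//; try exact: int.
  rewrite -RintegralD//; try by apply: int; apply: ctsM => //; exact: cts_cst.
  rewrite /ipQ /ip; apply: le_Rintegral => //.
  - by apply: int; exact: ctsM.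
  - by apply: int; apply: ctsD; apply: ctsM => //; exact: cts_cst.
  - by move=> p Qp; rewrite -expr2; apply: defectE.
have k1 := @continuous_cutoff1 _ R1 A; have k2 := @continuous_cutoff2 _ R1 A.
have E1 := est phi1 (cutoff1 R1 A) (partial1 trial) c_phi1 k1 ct1 (fun p => ltac:(by rewrite e1)).
have E2 := est phi2 (cutoff2 R1 A) (partial2 trial) c_phi2 k2 ct2 (fun p => ltac:(by rewrite e2)).
have C1b := cut_int k1 (fun p => (cutoff_grad_bound R1 A0 p).1) (fun p h => (cutoff_grad_out (R1 := R1) (A := A) h).1).
have C2b := cut_int k2 (fun p => (cutoff_grad_bound R1 A0 p).2) (fun p h => (cutoff_grad_out (R1 := R1) (A := A) h).2).
have -> : err_int = \int[leb2]_(p in Q) (trunc_err e (phi p) * phi1 p ^+ 2) +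
    \int[leb2]_(p in Q) (trunc_err e (phi p) * phi2 p ^+ 2).
  by rewrite /err_int RintegralD//; apply: int; apply: ctsM => //; exact: ctsX.
apply: le_trans (lerD E1 E2) _; move: C1b C2b.
set x1 := Rintegral _ _ _; set x2 := Rintegral _ _ _; set x3 := Rintegral _ _ _.
set x4 := Rintegral _ _ _; lra.
Qed.

End Trial.

End UpperBound.

Section Upper.
Context {R : realType}.
Variables (R1 R2 : R).
Hypotheses (hR1 : 0 < R1) (hR12 : R1 < R2).
Local Notation Q := (quarter R2).
Local Notation leb2 := (@lebesgue2 R).
Local Notation phi := (phi R2).
Local Notation phi1 := (phi1 R2).
Local Notation phi2 := (phi2 R2).
Let R20 : 0 < R2. Proof. exact: lt_trans hR12. Qed.

(** Dominated convergence, along [e = 1 / n.+1]: [trunc_err] is at most 1 and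
tends to 0 where [phi] is positive. *)
Lemma err_int_small (k b : R) : 0 < k -> 0 < b ->
  exists e : R, [/\ 0 < e, e <= b & err_int R2 e <= k].
Proof.
move=> k0 b0; pose es (n : nat) : R := n.+1%:R^-1.
have es0 n : 0 < es n by rewrite invr_gt0.
have mQ := @measurable_quarter R R2.
have cp := @continuous_phi R R2; have c1 := @continuous_phi1 R R2; have c2 := @continuous_phi2 R R2.
pose g (p : R * R) := phi1 p ^+ 2 + phi2 p ^+ 2.
have cg : continuous g by apply: ctsD; exact: ctsX.
pose f n (p : R * R) := trunc_err (es n) (phi p) * phi1 p ^+ 2 + trunc_err (es n) (phi p) * phi2 p ^+ 2.
have fE n p : f n p = trunc_err (es n) (phi p) * g p by rewrite /f /g mulrDr.
have cf n : continuous (f n).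
  have ce : continuous (fun p => trunc_err (es n) (phi p)).
    by apply: cts_comp => //; exact: continuous_trunc_err.
  by apply: ctsD; apply: ctsM => //; exact: ctsX.
have g0 p : 0 <= g p by rewrite addr_ge0 ?sqr_ge0.
have fg0 n p : 0 <= trunc_err (es n) (phi p) * g p.
  by apply: mulr_ge0; [exact: trunc_err_ge0|exact: g0].
have ces : es n @[n --> \oo] --> (0 : R) by exact: cvg_harmonic.
have lim0 : forall x : mplane R, Q x -> (f n x)%:E @[n --> \oo] --> (cst 0%E : mplane R -> \bar R) x.
  move=> p Qp; apply: cvg_EFin; first exact: nearW.
  have p0 := phi_gt0 R20 Qp.
  apply: (@squeeze_cvgr _ _ _ _ (fun=> 0) (fun n => es n ^+ 2 * ((2 / phi p) ^+ 2 * g p))).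
  - apply: nearW => n; change (0 <= f n p <= es n ^+ 2 * ((2 / phi p) ^+ 2 * g p)); rewrite fE; apply/andP; split; first exact: fg0.
    rewrite [leRHS]mulrA; apply: ler_wpM2r; [exact: g0|exact: trunc_err_small].
  - exact: cvg_cst.
  - rewrite [X in _ --> X](_ : 0 = 0 * 0 * ((2 / phi p) ^+ 2 * g p)); last by rewrite !mul0r.
    by under eq_fun do rewrite expr2; apply: cvgM; [exact: cvgM|exact: cvg_cst].
have mf n : measurable_fun (Q : set (mplane R)) (fun p => (f n p)%:E).
  by apply/measurable_EFinP; exact: continuous_measurable2.
have ig := continuous_integrable R20 mQ (fun _ h => h) cg.
have hdom : forall p n, Q p -> (`|(f n p)%:E| <= (g p)%:E)%E.
  move=> p n Qp; rewrite abse_EFin lee_fin fE (ger0_norm (fg0 _ _)).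
  apply: ler_piMl; first exact: g0.
  by apply: trunc_err_le1; [exact: es0|exact: ltW (phi_gt0 R20 Qp)].
have ae1 : {ae leb2, forall x : mplane R, Q x -> (f n x)%:E @[n --> \oo] --> (cst 0%E : mplane R -> \bar R) x}.
  by apply: aeW => q; exact: lim0.
have ae2 : {ae leb2, forall (x : mplane R) n, Q x -> (`|(f n x)%:E| <= (g x)%:E)%E}.
  apply: aeW => q m; exact: hdom.
have DC := @dominated_convergence _ (mplane R) R leb2 Q mQ (fun n p => (f n p)%:E) (cst 0%E)
  (fun p => (g p)%:E) mf (@measurable_cst _ _ _ _ _ _) ae1 ig ae2.
case: DC => _ _; rewrite integral0 => /fine_cvg /cvgr_lt /(_ k k0) near1.
have near2 : \forall n \near \oo, es n < b by have := ces => /cvgr_lt; apply.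
have [n [h1 h2]] := filter_ex (filterI near1 near2).
by exists (es n); split; [exact: es0|exact: ltW|exact: ltW h1].
Qed.

End Upper.

(** * The upper bound *)

Section Upper2.
Context {R : realType}.
Variables (R1 R2 : R).
Hypotheses (hR1 : 0 < R1) (hR12 : R1 < R2).
Local Notation Q := (quarter R2 : set (mplane R)).
Local Notation leb2 := (@lebesgue2 R).
Local Notation phi := (phi R2).
Let R20 : 0 < R2. Proof. exact: lt_trans hR12. Qed.
Let mu : R := besselJ_zero R 1 1 ^+ 2 / R2 ^+ 2.

(** On [core], which is far from the crack and where [phi] is bounded below, the
two cutoffs are bounded below as well. *)
Lemma trial_norm : exists c b : R, [/\ 0 < c, 0 < b & forall e d : R,
  0 < e -> e <= b -> 0 < d -> d <= 4^-1 ->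
  c <= ip leb2 Q (trial R1 R2 (2 * R1 * d) e) (trial R1 R2 (2 * R1 * d) e)].
Proof.
have [k k0 kP] : exists2 k : R, 0 < k & forall p, core R1 p -> k <= phi p.
  apply: box_positive; first exact: continuous_phi.
  by move=> p /(core_sub hR1 hR12); exact: phi_gt0.
exists ((k * 5^-1) ^+ 2 * ((R1 / 8) * (R1 / 8))), (k / 2); split.
- by rewrite !mulr_gt0 ?exprn_gt0 ?mulr_gt0.
- by rewrite divr_gt0.
move=> e d e0 ek d0 d4; have h1 := hR1.
set v := trial _ _ _ _; have [Cv _ _] := @trial_C1 R R1 R2 (2 * R1 * d) e e0.
have cv : continuous v by exact: C1_continuous Cv.
have -> : ip leb2 Q v v = \int[leb2]_(p in Q) (v p ^+ 2).
  by apply: eq_Rintegral => p _; rewrite expr2.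
have E : R1 / 8 = 2 * (R1 / 8) - R1 / 8 by lra.
rewrite [in leLHS]E; have lt8 : R1 / 8 < 2 * (R1 / 8) by lra.
apply: (integral_ge_box R20 _ lt8 lt8) => //.
- exact: ctsX.
- exact: sqr_ge0.
- by move=> p _; exact: sqr_ge0.
- exact: core_sub.
move=> p Bp; have kp := kP p Bp; have [x1 x2 y1 y2] := coreP Bp.
have c1 : cutoff R1 (2 * R1 * d) p = 1.
  apply: cutoff_out; rewrite /rho ler_pdivlMr ?exprn_gt0 ?mulr_gt0//.
  have : (2 * R1 * d) ^+ 2 <= (R1 / 2) ^+ 2.
    have -> : R1 / 2 = 2 * R1 * 4^-1 by field.
    have A0 : 0 < 2 * R1 by lra.
    have dd : 2 * R1 * d <= 2 * R1 * 4^-1 by rewrite ler_pM2l.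
    by rewrite ler_pXn2r ?nnegrE// mulr_ge0// ltW.
  have : (R1 * (3 / 4)) ^+ 2 <= (R1 - p.2) ^+ 2 by rewrite ler_pXn2r ?nnegrE//; lra.
  have -> : (R1 - p.2) ^+ 2 = (p.2 - R1) ^+ 2 by ring.
  have -> : (R1 * (3 / 4)) ^+ 2 = R1 ^+ 2 * (9 / 16) by field.
  have -> : (R1 / 2) ^+ 2 = R1 ^+ 2 * (4 / 16) by field.
  have := sqr_ge0 p.1; have := exprn_gt0 2 h1.
  set X := R1 ^+ 2; set Y := (p.2 - R1) ^+ 2; set Z := _ ^+ 2; lra.
have t1 : 5^-1 <= trunc e (phi p) by apply: trunc_large => //; lra.
have vk : k * 5^-1 <= v p.
  by rewrite /v /trial c1 mulr1; apply: ler_pM => //; rewrite ?invr_ge0 ltW.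
have k5 : 0 <= k * 5^-1 by rewrite mulr_ge0 ?invr_ge0 ?ltW.
by rewrite ler_pXn2r ?nnegrE//; exact: le_trans vk.
Qed.

(** By [adm_jacobi], the excess of [L] over [mu] is at most the defect of a trial
function divided by its squared norm. When [pi / 2 - eps] exceeds 1/4, so that
[16 * (pi / 2 - eps) ^+ 2] exceeds 1, the quotient of [bubble] is a sufficient
bound. *)
Lemma bottom_upper : exists C : R, 0 < C /\ forall eps L : R, 0 < eps -> eps < pi / 2 ->
  (forall v, adm R1 R2 eps v -> L * ip leb2 (cracked_sector R1 R2 eps) v v <=
     ip leb2 (cracked_sector R1 R2 eps) (partial1 v) (partial1 v) +
     ip leb2 (cracked_sector R1 R2 eps) (partial2 v) (partial2 v)) ->
  L <= mu + C * (pi / 2 - eps) ^+ 2.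
Proof.
have [c [b [c0 b0 cP]]] := trial_norm.
have [H0 H0P] : exists H0 : R, forall p, cquarter R2 p -> `|clif 0 (kap R2 * sqn p)| <= H0.
  have ck : continuous (fun p : R * R => clif 0 (kap R2 * sqn p)).
    apply: cts_comp; first exact: clif_continuous.
    by apply: ctsM; [exact: cts_cst|exact: sqn_continuous].
  by have [H0 HP] := cquarter_bounded R20 ck; exists H0.
pose K : R := 2 * (2 * ((64 * 16) * H0 ^+ 2 * ((4 * (2 * R1)) * (4 * (2 * R1))))).
have K0 : 0 <= K.
  by rewrite /K; apply: mulr_ge0 => //; apply: mulr_ge0 => //; apply: mulr_ge0; [apply: mulr_ge0 => //; exact: sqr_ge0|rewrite -expr2; exact: sqr_ge0].
pose q := bubble_quotient R1 R2.
have mu0 : 0 <= mu by rewrite divr_ge0 ?sqr_ge0.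
have q0 : 0 <= q.
  by apply: divr_ge0; [apply: addr_ge0; exact: ip_ge0|exact: ip_ge0].
have C0 : 0 < K / c + 16 * q + 1.
  rewrite ltr_wpDl//; apply: addr_ge0; last exact: mulr_ge0.
  by apply: divr_ge0 => //; exact: ltW.
exists (K / c + 16 * q + 1); split => // eps L e0 e1 HL.
pose d := pi / 2 - eps; have d0 : 0 < d by rewrite subr_gt0.
have d20 : 0 <= d ^+ 2 by exact: sqr_ge0.
rewrite -/d; have [d4|d4] := leP d 4^-1; last first.
  apply: (le_trans (bubble_bound hR1 hR12 e0 e1 HL)); rewrite -/q.
  have : 1 <= 16 * d ^+ 2.
    have -> : 16 * d ^+ 2 = (4 * d) ^+ 2 by ring.
    by rewrite expr_ge1//; lra.
  have kc : 0 <= (K / c + 1) * d ^+ 2.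
    by apply: mulr_ge0 => //; apply: addr_ge0 => //; apply: divr_ge0 => //; exact: ltW.
  move=> h; have : q * 1 <= q * (16 * d ^+ 2) by rewrite ler_wpM2l.
  lra.
suff main : L - mu <= K / c * d ^+ 2.
  have : 0 <= (16 * q + 1) * d ^+ 2 by apply: mulr_ge0 => //; lra.
  lra.
have [h|Lm] := leP (L - mu) 0.
  by apply: le_trans h _; apply: mulr_ge0 => //; apply: divr_ge0 => //; exact: ltW.
(* The truncation parameter [e] is sent to 0 before anything else. *)
rewrite mulrAC ler_pdivlMr//; apply/ler_addgt0Pr => k k0.
have [e [ee eb ek]] := err_int_small hR1 hR12 (divr_gt0 k0 (ltr0Sn R 1)) b0.
have A0 : 0 < 2 * R1 * d by rewrite !mulr_gt0.
have av := trial_adm hR1 hR12 A0 ee e0 e1 erefl.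
have := HL _ av.
rewrite (adm_jacobi hR1 hR12 e0 e1 av ee (fun p _ h => trial_small _ _ h)).
have [-> _ _] := adm_ip hR1 hR12 e0 e1 av.
have := trial_defect hR1 hR12 A0 ee H0P.
have := cP e d ee eb d0 d4.
rewrite -/mu; set N := ip _ _ _ _; set D1 := ip _ _ _ _; set D2 := ip _ _ _ _.
move=> cN dd h.
have h3 : (L - mu) * c <= (L - mu) * N by rewrite ler_wpM2l// ltW.
have h4 : 2 * (2 * ((64 * 16) * H0 ^+ 2 * ((4 * (2 * R1 * d)) * (4 * (2 * R1 * d))))) = K * d ^+ 2.
  by rewrite /K; ring.
move: dd; rewrite h4; clearbody K; lra.
Qed.

End Upper2.

(** * The spectrum of the cracked quarter disc *)

Section L2Limits.
Context {R : realType}.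
Variable Om : set (R * R).
Hypothesis mOm : measurable (Om : set (mplane R)).
Local Notation leb2 := (@lebesgue2 R).
Local Notation O := (Om : set (mplane R)).
Local Notation ip := (ip leb2 O).
Local Notation sqint := (sqint leb2 O).

(** Some [v n - u] is square integrable, and [u = v n - (v n - u)]. *)
Lemma L2_cvg_sqint (v : nat -> R * R -> R) (u : R * R -> R) :
  (forall n, sqint (v n)) -> measurable_fun O u -> L2_cvg Om v u -> sqint u.
Proof.
move=> sv mu vu.
have [n hn] : exists n, (\int[leb2]_(p in O) ((v n p - u p) ^+ 2)%:E < 1)%E.
  suff : \forall n \near \oo, (\int[leb2]_(p in O) ((v n p - u p) ^+ 2)%:E < 1)%E by case/filter_ex => n h; exists n.
  apply: (vu [set x | (x < 1)%E]); apply: open_nbhs_nbhs; split; last by rewrite /= lte_fin.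
  exact: open_ereal_lt_ereal.
have sd : sqint (fun p => v n p - u p).
  split; last exact: lt_trans hn (ltry _).
  by apply: measurable_funB => //; exact: (sv n).1.
have := sqintB mOm (sv n) sd; congr sqint.
by apply/funext => p; rewrite opprB addrC subrK.
Qed.

Lemma L2_cvgP (v : nat -> R * R -> R) (u : R * R -> R) : (forall n, sqint (v n)) -> sqint u ->
  L2_cvg Om v u <-> forall e : R, 0 < e ->
    \forall n \near \oo, ip (fun p => v n p - u p) (fun p => v n p - u p) <= e.
Proof.
move=> sv su.
have E n : (\int[leb2]_(p in O) ((v n p - u p) ^+ 2)%:E =
    (ip (fun p => v n p - u p) (fun p => v n p - u p))%:E)%E.
  exact: (ip_sqE mOm (sqintB mOm (sv n) su)).
rewrite /L2_cvg; under eq_fun do rewrite E; split => [h e e0|h].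
  have := h => /fine_cvg /cvgr_le; exact.
apply: cvg_EFin; first exact: nearW.
apply/cvgr0Pnorm_le => e e0; have := h e e0.
by apply: filterS => n hn; rewrite /= ger0_norm// ip_ge0.
Qed.

End L2Limits.

Section Spectrum.
Context {R : realType}.
Variables (R1 R2 eps : R).
Hypotheses (hR1 : 0 < R1) (hR12 : R1 < R2) (he0 : 0 < eps) (he1 : eps < pi / 2).
Local Notation leb2 := (@lebesgue2 R).
Local Notation Om := (cracked_sector R1 R2 eps).
Local Notation D := (boundary Om `\` neumann_radius R2).
Local Notation O := (Om : set (mplane R)).
Local Notation ip := (ip leb2 O).
Local Notation sqint := (sqint leb2 O).
Local Notation A := (adm R1 R2 eps : set (mplane R -> R)).
Local Notation d1 := (@partial1 R : (mplane R -> R) -> mplane R -> R).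
Local Notation d2 := (@partial2 R : (mplane R -> R) -> mplane R -> R).
Local Notation lim := (limit_pt leb2 O A d1 d2).
Let mOm : measurable O. Proof. exact: measurable_Om. Qed.

(** A sequence converging to [u] is obtained by choosing an approximation at
distance at most [1 / n.+1] for each [n]. *)
Lemma H1D_limit_pt u g1 g2 : H1D Om D u g1 g2 <-> lim u g1 g2.
Proof.
split=> [[mu m1 m2 [v [Av c0 c1 c2]]]|[su s1 s2 H]].
  have sq n := adm_sqint hR1 hR12 he0 he1 (Av n).
  have sv n : sqint (v n) by case: (sq n) => h _ _; exact: h.
  have sv1 n : sqint (partial1 (v n)) by case: (sq n) => _ h _; exact: h.
  have sv2 n : sqint (partial2 (v n)) by case: (sq n) => _ _ h; exact: h.
  have su := L2_cvg_sqint mOm sv mu c0.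
  have s1 := L2_cvg_sqint mOm sv1 m1 c1.
  have s2 := L2_cvg_sqint mOm sv2 m2 c2.
  split; [exact: su|exact: s1|exact: s2|move=> e e0].
  have h0 := (L2_cvgP mOm sv su).1 c0 e e0.
  have h1 := (L2_cvgP mOm sv1 s1).1 c1 e e0.
  have h2 := (L2_cvgP mOm sv2 s2).1 c2 e e0.
  have [n [[k0 k1] k2]] := filter_ex (filterI (filterI h0 h1) h2).
  by exists (v n); split; [exact: Av|exact: k0|exact: k1|exact: k2].
have invn0 n : 0 < n.+1%:R^-1 :> R by rewrite invr_gt0.
have /choice[v Hv] := fun n => H _ (invn0 n).
have sq n : [/\ sqint (v n), sqint (partial1 (v n)) & sqint (partial2 (v n))].
  by apply: (adm_sqint hR1 hR12 he0 he1); case: (Hv n) => h _ _ _; exact: h.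
have sv n : sqint (v n) by case: (sq n) => h _ _; exact: h.
have sv1 n : sqint (partial1 (v n)) by case: (sq n) => _ h _; exact: h.
have sv2 n : sqint (partial2 (v n)) by case: (sq n) => _ _ h; exact: h.
have small (f : nat -> R) : (forall n, f n <= n.+1%:R^-1) -> forall e : R, 0 < e ->
    \forall n \near \oo, f n <= e.
  move=> fn e e0; have : n.+1%:R^-1 @[n --> \oo] --> (0 : R) by exact: cvg_harmonic.
  move=> /cvgr_le /(_ _ e0); apply: filterS => n; exact: le_trans.
split; [exact: su.1|exact: s1.1|exact: s2.1|exists v; split].
- by move=> n; case: (Hv n) => h _ _ _; exact: h.
- by apply/(L2_cvgP mOm sv su); apply: small => n; case: (Hv n) => _ h _ _; exact: h.
- by apply/(L2_cvgP mOm sv1 s1); apply: small => n; case: (Hv n) => _ _ h _; exact: h.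
- by apply/(L2_cvgP mOm sv2 s2); apply: small => n; case: (Hv n) => _ _ _ h; exact: h.
Qed.

Let A_lin (f g : mplane R -> R) (a b : R) : A f -> A g -> A (fun x => a * f x + b * g x).
Proof. exact: adm_lin. Qed.

Let d1_lin (f g : mplane R -> R) (a b : R) : A f -> A g ->
  d1 (fun x => a * f x + b * g x) = (fun x => a * d1 f x + b * d1 g x).
Proof. by move=> [Cf _] [Cg _]; case: (C1_lin a b Cf Cg). Qed.

Let d2_lin (f g : mplane R -> R) (a b : R) : A f -> A g ->
  d2 (fun x => a * f x + b * g x) = (fun x => a * d2 f x + b * d2 g x).
Proof. by move=> [Cf _] [Cg _]; case: (C1_lin a b Cf Cg). Qed.

Let A_sq (v : mplane R -> R) : A v -> [/\ sqint v, sqint (d1 v) & sqint (d2 v)].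
Proof. by move=> av; exact: (adm_sqint hR1 hR12 he0 he1 av). Qed.

Let A_nz : exists2 v, A v & 0 < ip v v.
Proof.
exists (bubble R1 : mplane R -> R); first exact: bubble_adm.
have [-> _ _] := adm_ip hR1 hR12 he0 he1 (bubble_adm hR1 hR12 he0 he1).
exact: bubble_pos.
Qed.

Definition bottom_NDD : R := rayleigh_bottom leb2 O A d1 d2.

Lemma bottom_NDD_le v : adm R1 R2 eps v -> bottom_NDD * ip v v <=
  ip (partial1 v) (partial1 v) + ip (partial2 v) (partial2 v).
Proof. by move=> av; exact: (rayleigh_bottom_le _ _ A_nz av). Qed.

Lemma bottom_NDD_ge : besselJ_zero R 1 1 ^+ 2 / R2 ^+ 2 <= bottom_NDD.
Proof.
apply: lb_le_inf; first exact: (rayleigh_inf d1 d2 A_nz).1.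
move=> _ [v [Av v0 ->]]; rewrite ler_pdivlMr//.
exact: adm_lower.
Qed.

(** [minimizer_exists] with [euler_lagrange] makes it an eigenvalue; testing the
equation of any eigenfunction with itself shows that it is the lowest one. *)
Lemma lambda1_bottom : lambda1_NDD R1 R2 eps bottom_NDD.
Proof.
have RI f1 f2 h1 h2 : sqint f1 -> sqint f2 -> sqint h1 -> sqint h2 ->
    (\int[leb2]_(p in Om) (f1 p * h1 p + f2 p * h2 p))%R = ip f1 h1 + ip f2 h2.
  by move=> *; rewrite RintegralD//; apply: sqint_mul.
split.
  have [u [g1 [g2 [L uu gg]]]] := minimizer_exists mOm A_lin d1_lin d2_lin A_sq
    (friedrichs hR1 hR12 he0 he1) A_nz.
  exists u, g1, g2; split; first exact/H1D_limit_pt.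
    by have [su _ _ _] := L; rewrite (ip_sqE mOm su) uu eqe oner_eq0.
  move=> w h1 h2 /H1D_limit_pt Lw.
  have [su s1 s2 _] := L; have [sw r1 r2 _] := Lw.
  rewrite RI//; apply: (euler_lagrange mOm A_lin d1_lin d2_lin A_sq A_nz L _ Lw).
  by rewrite gg uu mulr1.
move=> m [u [g1 [g2 [/[dup] Hu /H1D_limit_pt L un /(_ _ _ _ Hu)]]]].
have [su s1 s2 _] := L; rewrite RI// => E.
have := limit_pt_bottom mOm A_sq A_nz L; rewrite E.
move: un; rewrite (ip_sqE mOm su) eqe => un.
by rewrite ler_pM2r// lt_def un ip_ge0.
Qed.

End Spectrum.

Theorem proposition7p3 (R : realType) (R1 R2 : R) (hR1 : 0 < R1)
    (hR12 : R1 < R2) :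
  exists C : R, 0 < C /\
    forall eps : R, 0 < eps -> eps < pi / 2 ->
      exists lambda : R,
        [/\ lambda1_NDD R1 R2 eps lambda,
            besselJ_zero R 1 1 ^+ 2 / R2 ^+ 2 <= lambda &
            lambda <= besselJ_zero R 1 1 ^+ 2 / R2 ^+ 2
                      + C * (pi / 2 - eps) ^+ 2].
Proof.
have [C [C0 CP]] := bottom_upper hR1 hR12; exists C; split => // eps e0 e1.
exists (bottom_NDD R1 R2 eps); split; first exact: lambda1_bottom.
- exact: bottom_NDD_ge.
- by apply: CP => // v; exact: bottom_NDD_le.
Qed.
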